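(* Among all $\mathbf{SO}(3)$ structures $(M,g,\Upsilon)$ (on 5-dimensional Riemannian manifolds) only the nearly integrable ones admit a characteristic connection $\Gamma$. Every nearly integrable $\mathbf{SO}(3)$ structure defines a characteristic connection $\Gamma$ uniquely (i.e. it admits exactly one characteristic connection).
   Context: An $\mathbf{SO}(3)$ structure on a 5-dimensional Riemannian manifold $(M,g)$ is given by a rank 3 tensor field $\Upsilon$ such that the map $v\mapsto\Upsilon_v\in\mathrm{End}(TM)$, $(\Upsilon_v)_{ij}=\Upsilon_{ijk}v_k$, is totally symmetric ($g(u,\Upsilon_vw)=g(w,\Upsilon_vu)=g(u,\Upsilon_wv)$), trace free ($\mathrm{tr}\,\Upsilon_v=0$) and satisfies $\Upsilon_v^2v=g(v,v)v$. It is called nearly integrable if $(\nabla^{LC}_v\Upsilon)(v,v,v)\equiv0$ for all tangent vectors $v$, where $\nabla^{LC}$ is the Levi-Civita connection of $g$. Locally there is an adapted coframe, i.e. a $g$-orthonormal coframe $(\theta^1,\dots,\theta^5)$ with $\Upsilon=\tfrac12\theta_1(6\theta_2^2+6\theta_4^2-2\theta_1^2-3\theta_3^2-3\theta_5^2)+\tfrac{3\sqrt3}{2}\theta_4(\theta_5^2-\theta_3^2)+3\sqrt3\,\theta_2\theta_3\theta_5$. Let $e_{ij}$ be the $5\times5$ antisymmetric matrix with $1$ at entry $(i,j)$ and $-1$ at $(j,i)$, and $E_1=\sqrt3e_{15}+e_{23}+e_{45}$, $E_2=\sqrt3e_{13}+e_{25}+e_{34}$, $E_3=2e_{24}+e_{35}$;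 these span the irreducible $\mathfrak{so}(3)\subset\mathfrak{so}(5)$. An $\mathfrak{so}(3)$ connection on $M$ is a connection represented in adapted coframes by an $\mathfrak{so}(3)$-valued 1-form $\Gamma=\gamma^1E_1+\gamma^2E_2+\gamma^3E_3$; its torsion is $T^i=d\theta^i+\Gamma^i{}_j\wedge\theta^j=\tfrac12T^i{}_{jk}\theta^j\wedge\theta^k$. An $\mathfrak{so}(3)$ connection is called a characteristic connection if $T_{ijk}$ is totally skew symmetric. *)

(* Defs.v *)
(* The real numbers are an arbitrary R : realType (MathComp-Analysis). *)
From HB Require Import structures.
From mathcomp Require Import all_boot all_order all_algebra.
From mathcomp Require Import all_classical all_reals all_analysis.

Set Implicit Arguments.
Unset Strict Implicit.
Unset Printing Implicit Defensive.

Import Order.TTheory GRing.Theory Num.Theory.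
Import numFieldNormedType.Exports.

Local Open Scope classical_set_scope.
Local Open Scope ring_scope.

(* Points of coordinate space are row vectors, tangent vectors are columns. *)

Definition partial (R : realType) (n : nat) (l : 'I_n)
    (f : 'rV[R]_n -> R) : 'rV[R]_n -> R :=
  fun x => 'D_(delta_mx 0 l) f x.

(* f is C^oo on the open set D: every iterated partial derivative of f exists
   and is differentiable at each point of D.  Values outside D are irrelevant. *)
Definition smooth_on (R : realType) (n : nat) (D : set 'rV[R]_n)
    (f : 'rV[R]_n -> R) : Prop :=
  forall (s : seq 'I_n) (x : 'rV[R]_n), D x ->
    differentiable (foldr (@partial R n) f s) x.

(* entrywise derivative of a matrix-valued function in direction x^l *)
Definition partial_mx (R : realType) (n p q : nat) (l : 'I_n)
    (F : 'rV[R]_n -> 'M[R]_(p, q)) (x : 'rV[R]_n) : 'M[R]_(p, q) :=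
  \matrix_(a, b) partial l (fun y => F y a b) x.

Definition smooth_mx_on (R : realType) (n p q : nat) (D : set 'rV[R]_n)
    (F : 'rV[R]_n -> 'M[R]_(p, q)) : Prop :=
  forall a b, smooth_on D (fun y => F y a b).

(* Smooth n-manifolds (Hausdorff, second countable) given by a smooth atlas.
   [chart i] is a homeomorphism from the open set [dom i] onto the open set
   [img i] of R^n, with inverse [param i]. *)
Record manifold (R : realType) (n : nat) := Manifold {
  carrier :> topologicalType;
  carrier_hausdorff : hausdorff_space carrier;
  carrier_countable : @second_countable carrier;
  atlas_index : Type;
  dom : atlas_index -> set carrier;
  img : atlas_index -> set 'rV[R]_n;
  chart : atlas_index -> carrier -> 'rV[R]_n;
  param : atlas_index -> 'rV[R]_n -> carrier;
  dom_open : forall i, open (dom i);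
  img_open : forall i, open (img i);
  dom_cover : forall p, exists i, dom i p;
  chart_img : forall i p, dom i p -> img i (chart i p);
  param_dom : forall i x, img i x -> dom i (param i x);
  chartK : forall i p, dom i p -> param i (chart i p) = p;
  paramK : forall i x, img i x -> chart i (param i x) = x;
  chart_continuous : forall i p, dom i p -> {for p, continuous (chart i)};
  param_continuous : forall i x, img i x -> {for x, continuous (param i)};
  transition_smooth : forall i j,
    smooth_mx_on [set x | img i x /\ dom j (param i x)]
                 (fun x => chart j (param i x))
}.

Definition overlap (R : realType) (n : nat) (M : manifold R n)
    (i j : atlas_index M) : set 'rV[R]_n :=
  [set x | img i x /\ dom j (param i x)].

Definition transition (R : realType) (n : nat) (M : manifold R n)
    (i j : atlas_index M) : 'rV[R]_n -> 'rV[R]_n :=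
  fun x => chart j (param i x).

(* entry (k, l) is the derivative of the k-th new coordinate in the l-th old
   one, so that tangent (column) vectors transform by left multiplication *)
Definition transition_jac (R : realType) (n : nat) (M : manifold R n)
    (i j : atlas_index M) (x : 'rV[R]_n) : 'M[R]_n :=
  \matrix_(k, l) partial l (fun y => transition i j y 0 k) x.

(* Tensor fields and connections are given by their components in every chart,
   subject to the change-of-coordinates rule on overlaps. *)

Record metric (R : realType) (n : nat) (M : manifold R n) := Metric {
  gmx : atlas_index M -> 'rV[R]_n -> 'M[R]_n;
  gmx_smooth : forall i, smooth_mx_on (img i) (gmx i);
  gmx_sym : forall i x, img i x -> (gmx i x)^T = gmx i x;
  gmx_pos : forall i x, img i x -> forall v : 'cV[R]_n,
    v != 0 -> 0 < (v^T *m gmx i x *m v) 0 0;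
  gmx_trans : forall i j x, overlap i j x ->
    gmx i x = (transition_jac i j x)^T *m gmx j (transition i j x)
              *m transition_jac i j x
}.

Record tensor3 (R : realType) (n : nat) (M : manifold R n) := Tensor3 {
  tcoef : atlas_index M -> 'rV[R]_n -> 'I_n -> 'I_n -> 'I_n -> R;
  tcoef_smooth : forall i a b c,
    smooth_on (img i) (fun x => tcoef i x a b c);
  tcoef_trans : forall i j x, overlap i j x -> forall a b c,
    tcoef i x a b c =
    \sum_p \sum_q \sum_r tcoef j (transition i j x) p q r
      * transition_jac i j x p a * transition_jac i j x q b
      * transition_jac i j x r c
}.

(* [ccoef i x l] is the matrix of the connection 1-form at d/dx^l in the
   coordinate frame: its entry (k, m) is the Christoffel symbol Gamma^k_{lm},
   nabla_{d/dx^l} d/dx^m = \sum_k Gamma^k_{lm} d/dx^k. *)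
Record connection (R : realType) (n : nat) (M : manifold R n) := Connection {
  ccoef : atlas_index M -> 'rV[R]_n -> 'I_n -> 'M[R]_n;
  ccoef_smooth : forall i l, smooth_mx_on (img i) (fun x => ccoef i x l);
  ccoef_trans : forall i j x, overlap i j x -> forall l,
    transition_jac i j x *m ccoef i x l =
    (\sum_q transition_jac i j x q l *:
       (ccoef j (transition i j x) q *m transition_jac i j x))
    + partial_mx l (transition_jac i j) x
}.

Definition eq_connection (R : realType) (n : nat) (M : manifold R n)
    (G G' : connection M) : Prop :=
  forall i x, img i x -> forall l, ccoef G i x l = ccoef G' i x l.

Definition gdot (R : realType) (n : nat) (M : manifold R n) (g : metric M)
    (i : atlas_index M) (x : 'rV[R]_n) (u v : 'cV[R]_n) : R :=
  (u^T *m gmx g i x *m v) 0 0.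

(* Christoffel symbols of the Levi-Civita connection, laid out as [ccoef]:
   Gamma^k_{lm} = 1/2 g^{kp} (d_l g_{pm} + d_m g_{pl} - d_p g_{lm}) *)
Definition levi_civita (R : realType) (n : nat) (M : manifold R n)
    (g : metric M) (i : atlas_index M) (x : 'rV[R]_n) (l : 'I_n) : 'M[R]_n :=
  let d := fun l a b => partial l (fun y => gmx g i y a b) x in
  \matrix_(k, m) (2^-1 * \sum_p invmx (gmx g i x) k p
                          * (d l p m + d m p l - d p l m)).

(* component (nabla^LC_{d/dx^l} Y)(d/dx^a, d/dx^b, d/dx^c) *)
Definition nablaLC (R : realType) (n : nat) (M : manifold R n) (g : metric M)
    (Y : tensor3 M) (i : atlas_index M) (x : 'rV[R]_n) (l a b c : 'I_n) : R :=
  let A := levi_civita g i x l in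
  partial l (fun y => tcoef Y i y a b c) x
  - \sum_m (A m a * tcoef Y i x m b c + A m b * tcoef Y i x a m c
            + A m c * tcoef Y i x a b m).

(* matrix, acting on column vectors, of the endomorphism Y_v, i.e.
   g(u, Y_v w) = Y_{abc} u^a w^b v^c; the metric raises the first index *)
Definition tend (R : realType) (n : nat) (M : manifold R n) (g : metric M)
    (Y : tensor3 M) (i : atlas_index M) (x : 'rV[R]_n) (v : 'cV[R]_n) : 'M[R]_n :=
  invmx (gmx g i x) *m
  (\matrix_(a, b) \sum_c tcoef Y i x a b c * v c 0).

Record so3_structure (R : realType) (M : manifold R 5) := So3Structure {
  so3_metric : metric M;
  ups : tensor3 M;
  ups_sym : forall i x, img i x -> forall u v w : 'cV[R]_5,
    gdot so3_metric i x u (tend so3_metric ups i x v *m w)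
      = gdot so3_metric i x w (tend so3_metric ups i x v *m u)
    /\ gdot so3_metric i x u (tend so3_metric ups i x v *m w)
      = gdot so3_metric i x u (tend so3_metric ups i x w *m v);
  ups_trace : forall i x, img i x -> forall v : 'cV[R]_5,
    \tr (tend so3_metric ups i x v) = 0;
  ups_sqr : forall i x, img i x -> forall v : 'cV[R]_5,
    tend so3_metric ups i x v *m (tend so3_metric ups i x v *m v)
      = gdot so3_metric i x v v *: v
}.

Definition nearly_integrable (R : realType) (M : manifold R 5)
    (S : so3_structure M) : Prop :=
  forall i x, img i x -> forall v : 'cV[R]_5,
    \sum_l \sum_a \sum_b \sum_c
      nablaLC (so3_metric S) (ups S) i x l a b c
      * v l 0 * v a 0 * v b 0 * v c 0 = 0.

(* A local coframe on an open set V of a chart is a matrix-valued function th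
   with th x a k = theta^a(d/dx^k); the dual frame is the matrix [invmx]. *)

(* the 1-based index k = 1, ..., 5 *)
Definition ix (k : nat) : 'I_5 := inord k.-1.

(* The cubic form v |-> Upsilon(v, v, v) in adapted components t_k = theta_k(v).
   A product of the theta's is a symmetric product, so the totally symmetric
   tensor Upsilon has the prescribed expression iff its cubic form is this one. *)
Definition ups_model (R : realType) (v : 'cV[R]_5) : R :=
  let t k := v (ix k) 0 in
  2^-1 * t 1%N * (6 * t 2%N ^+ 2 + 6 * t 4%N ^+ 2 - 2 * t 1%N ^+ 2
                - 3 * t 3%N ^+ 2 - 3 * t 5%N ^+ 2)
  + 3 * Num.sqrt 3 / 2 * t 4%N * (t 5%N ^+ 2 - t 3%N ^+ 2)
  + 3 * Num.sqrt 3 * t 2%N * t 3%N * t 5%N.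

Definition adapted_coframe (R : realType) (M : manifold R 5)
    (S : so3_structure M) (i : atlas_index M) (V : set 'rV[R]_5)
    (th : 'rV[R]_5 -> 'M[R]_5) : Prop :=
  [/\ open V, V `<=` img i, smooth_mx_on V th,
      forall x, V x -> (th x)^T *m th x = gmx (so3_metric S) i x
    & forall x, V x -> forall v : 'cV[R]_5,
        \sum_a \sum_b \sum_c tcoef (ups S) i x a b c * v a 0 * v b 0 * v c 0
        = ups_model (th x *m v)].

(* Gamma^a_b(d/dx^l) = theta^a(nabla_{d/dx^l} e_b), e the dual frame; using
   d(th^-1) = - th^-1 (d th) th^-1 *)
Definition conn_form (R : realType) (M : manifold R 5) (G : connection M)
    (i : atlas_index M) (th : 'rV[R]_5 -> 'M[R]_5) (x : 'rV[R]_5) (l : 'I_5)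
    : 'M[R]_5 :=
  (th x *m ccoef G i x l - partial_mx l th x) *m invmx (th x).

(* T^a(d/dx^k, d/dx^l) for T^a = d theta^a + Gamma^a_b /\ theta^b *)
Definition torsion_form (R : realType) (M : manifold R 5) (G : connection M)
    (i : atlas_index M) (th : 'rV[R]_5 -> 'M[R]_5) (x : 'rV[R]_5)
    (a k l : 'I_5) : R :=
  partial_mx k th x a l - partial_mx l th x a k
  + \sum_b (conn_form G i th x k a b * th x b l
            - conn_form G i th x l a b * th x b k).

(* T^a_{bc} = T^a(e_b, e_c), i.e. T^a = 1/2 T^a_{bc} theta^b /\ theta^c *)
Definition torsion (R : realType) (M : manifold R 5) (G : connection M)
    (i : atlas_index M) (th : 'rV[R]_5 -> 'M[R]_5) (x : 'rV[R]_5)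
    (a b c : 'I_5) : R :=
  \sum_k \sum_l torsion_form G i th x a k l
    * invmx (th x) k b * invmx (th x) l c.

Definition e_ (R : realType) (i j : nat) : 'M[R]_5 :=
  delta_mx (ix i) (ix j) - delta_mx (ix j) (ix i).

Definition E1 (R : realType) : 'M[R]_5 :=
  Num.sqrt 3 *: e_ R 1 5 + e_ R 2 3 + e_ R 4 5.
Definition E2 (R : realType) : 'M[R]_5 :=
  Num.sqrt 3 *: e_ R 1 3 + e_ R 2 5 + e_ R 3 4.
Definition E3 (R : realType) : 'M[R]_5 := 2 *: e_ R 2 4 + e_ R 3 5.

(* The coefficients gamma^k(d/dx^l) are automatically smooth in x, the E_k being
   linearly independent constant matrices. *)
Definition so3_connection (R : realType) (M : manifold R 5)
    (S : so3_structure M) (G : connection M) : Prop :=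
  forall i V th, adapted_coframe S i V th ->
  forall x, V x -> forall l, exists c1 c2 c3 : R,
    conn_form G i th x l = c1 *: E1 R + c2 *: E2 R + c3 *: E3 R.

(* adapted coframes are orthonormal, so T_{abc} = T^a_{bc} *)
Definition totally_skew_torsion (R : realType) (M : manifold R 5)
    (S : so3_structure M) (G : connection M) : Prop :=
  forall i V th, adapted_coframe S i V th ->
  forall x, V x -> forall a b c,
    torsion G i th x a b c = - torsion G i th x b a c
    /\ torsion G i th x a b c = - torsion G i th x a c b.

Definition characteristic (R : realType) (M : manifold R 5)
    (S : so3_structure M) (G : connection M) : Prop :=
  so3_connection S G /\ totally_skew_torsion S G.

(* Main.v *)
Require Import Defs.
From mathcomp Require Import all_boot all_order all_algebra.
From mathcomp Require Import all_classical all_reals all_analysis.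
From mathcomp Require Import ring lra.

(** Fix a point and a chart, and consider a family of matrices [C], the
    candidate Christoffel symbols at that point. Call it [compatible] when the
    metric is parallel, the cubic form of the structure tensor is parallel, and
    the torsion made trilinear by the metric is totally skew. In an adapted
    coframe the metric is the identity and the cubic form is a constant one whose
    stabilizer in so(5) is spanned by E1, E2, E3 ([stabilizer]), so the first two
    conditions say that the connection matrices lie in so(3)
    ([frame_conn_so3]). Hence a connection is characteristic iff its Christoffel
    symbols are compatible at every point ([characteristicP]). This condition
    mentions no coframe, but the equivalence needs an adapted coframe around
    every point ([exists_adapted_coframe]).

    Characteristic implies nearly integrable. Subtracting the Levi-Civita
    symbols from compatible ones leaves a totally skew tensor, so both have the
    same value of the covariant derivative of v along v; differentiating the
    cubic form along v with either gives the same quartic form, which vanishes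
    for compatible symbols ([compatible_nearly_integrable]).

    Uniqueness. The difference of two compatible families is, in an adapted
    coframe, a totally skew tensor with values in so(3), and such a tensor is
    zero ([so3_skew0], [compatible_unique]).

    Existence. Let [w] be the Levi-Civita form in an adapted coframe, a 1-form
    with values in so(5). Near integrability says that the quartic form
    u |-> Upsilon(u, u, w(u) u) vanishes. Polarising gives linear equations in
    the fifty entries of [w]; solving them leaves twenty-five free entries
    ([quartic_relations]), and exactly then [w] differs from an so(3)-valued form
    by a totally skew one: 25 = 15 + 10 ([so3_part_skew]). This yields compatible
    symbols over the domain of the coframe, smooth since the Levi-Civita form is.
    By uniqueness the local symbols agree wherever two coframes overlap. They
    also transform as a connection, because compatibility is invariant under
    changes of coordinates ([pull_back_compatible]): the inhomogeneous term is
    symmetric, by Schwarz, and does not contribute to the torsion.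

    Adapted coframes. The structure tensor turns each tangent space into a
    commutative algebra with v (v v) = |v|^2 v. A unit vector v in general
    position spans with v v a plane which is a subalgebra, squaring in it being a
    reflection that doubles angles; the position of v relative to the two
    distinguished basis vectors of the plane is an angle whose triple has cosine
    - <v, v v>, so trisecting with [acos] finds them smoothly
    ([flat_frame]). On the orthogonal complement of the plane, multiplication by
    the first of them is 1 on a line and -1/2 on a plane, which multiplication by
    the second splits into two eigenlines ([joint_partP], [joint_part_neq0]).
    Unit vectors on these, suitably combined, and their product complete the
    frame, in which the cubic form takes its normal form ([frame_cubic]). *)

Set Implicit Arguments.
Unset Strict Implicit.
Unset Printing Implicit Defensive.

Import Order.TTheory GRing.Theory Num.Theory.
Import numFieldNormedType.Exports.

Local Open Scope classical_set_scope.
Local Open Scope ring_scope.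

(** * Smooth functions on an open set *)

(** Differentiability only sees the germ of a function: the two differentials
    are the unique linear part of the same expansion. *)
Lemma near_eq_differentiable (R : realType) (V W : normedModType R)
    (f g : V -> W) (x : V) : (\near x, f x = g x) ->
  differentiable f x -> differentiable g x.
Proof.
move=> fg df; have fgx : f x = g x := nbhs_singleton fg.
have gE : g \o shift x = cst (g x) + 'd f x +o_ 0 id.
  apply/eqaddoP => e e0; have /eqaddoP/(_ e e0) := diff_locally df.
  have fg0 : \forall h \near 0, f (h + x) = g (h + x).
    by move: fg; rewrite nbhs0P; apply: filterS => h; rewrite addrC.
  by apply: filter_app; near=> h; rewrite /= !fctE /= -fgx (near fg0 h).
have dgE := @diff_unique _ _ _ g ('d f x) x (diff_continuous df) gE.
by apply/diff_locallyP; rewrite dgE; split => //; exact: diff_continuous.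
Unshelve. all: by end_near. Qed.

Section Partial.
Variables (R : realType) (n : nat).
Implicit Types (f g : 'rV[R]_n -> R) (x : 'rV[R]_n) (l : 'I_n).

Lemma partialE l f x : differentiable f x ->
  partial l f x = 'd f x (delta_mx 0 l).
Proof. by move=> df; rewrite /partial deriveE. Qed.

Lemma near_partial l f g x : (\near x, f x = g x) ->
  partial l f x = partial l g x.
Proof. by move=> fg; apply: near_eq_derive. Qed.

Lemma partial_cst l (c : R) x : partial l (fun=> c) x = 0.
Proof. by rewrite /partial derive_cst. Qed.

Lemma partialD l f g x : differentiable f x -> differentiable g x ->
  partial l (fun y => f y + g y) x = partial l f x + partial l g x.
Proof.
by move=> df dg; rewrite /partial (deriveD (diff_derivable df) (diff_derivable dg)).
Qed.

Lemma partialM l f g x : differentiable f x -> differentiable g x ->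
  partial l (fun y => f y * g y) x = f x * partial l g x + g x * partial l f x.
Proof.
by move=> df dg; rewrite /partial (deriveM (diff_derivable df) (diff_derivable dg)).
Qed.

Lemma partial_sum (I : Type) (r : seq I) (F : I -> 'rV[R]_n -> R) l x :
  (forall i, differentiable (F i) x) ->
  differentiable (fun y => \sum_(i <- r) F i y) x /\
  partial l (fun y => \sum_(i <- r) F i y) x = \sum_(i <- r) partial l (F i) x.
Proof.
move=> dF; elim: r => [|i r [IHd IHp]].
  rewrite big_nil (_ : (fun _ => _) = (fun=> 0)); last first.
    by apply/funext => y; rewrite big_nil.
  by split; [exact: differentiable_cst|exact: partial_cst].
rewrite big_cons (_ : (fun _ => _) =
    (fun y => F i y + \sum_(i <- r) F i y)); last first.
  by apply/funext => y; rewrite big_cons.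
by split; [exact: differentiableD|rewrite partialD// IHp].
Qed.

Lemma differentiable_comp1 (F : R -> R) (dF : R) f x : differentiable f x ->
  is_derive (f x) 1 F dF -> differentiable (fun y => F (f y)) x.
Proof.
move=> df FdF; apply: (@differentiable_comp _ _ _ _ f F) => //.
by apply/derivable1_diffP; case: FdF.
Qed.

Lemma partial_comp1 (F : R -> R) (dF : R) l f x : differentiable f x ->
  is_derive (f x) 1 F dF -> partial l (fun y => F (f y)) x = dF * partial l f x.
Proof.
move=> df FdF; rewrite !partialE//; last exact: differentiable_comp1 FdF.
have dfF : differentiable F (f x) by apply/derivable1_diffP; case: FdF.
rewrite (@diff_comp _ _ _ _ f F)//= (diff1E dfF) /= derive1E derive_val.
by rewrite mulrC.
Qed.

End Partial.

Section Smooth.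
Variables (R : realType) (n : nat) (D : set 'rV[R]_n).
Hypothesis openD : open D.
Implicit Types (f g : 'rV[R]_n -> R).

(** Smoothness up to a finite order is the induction hypothesis under which the
    Leibniz and chain rules close: the derivative of a product or composite is
    built from the factors, at one order less. *)
Definition smooth_upto (k : nat) f : Prop :=
  forall s : seq 'I_n, (size s <= k)%N -> forall x, D x ->
    differentiable (foldr (@partial R n) f s) x.

Lemma smooth_uptoP f : smooth_on D f <-> forall k, smooth_upto k f.
Proof. by split=> [sf k s _ x|sf s x]; [exact: sf|exact: (sf (size s))]. Qed.

Lemma smooth_uptoS k f : smooth_upto k.+1 f <->
  (forall x, D x -> differentiable f x) /\ forall l, smooth_upto k (partial l f).
Proof.
split=> [sf|[df sf]].
  split=> [x Dx|l s ss x Dx]; first exact: (sf [::]).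
  by have := sf (rcons s l); rewrite foldr_rcons size_rcons ltnS; apply.
move=> s; case/lastP: s => [_ x Dx|s l]; first exact: df.
by rewrite size_rcons ltnS foldr_rcons => ss; exact: sf.
Qed.

Lemma smooth_uptoW k f : smooth_upto k.+1 f -> smooth_upto k f.
Proof. by move=> sf s ss; apply: sf; exact: leqW. Qed.

Lemma near_in (P : set 'rV[R]_n) x : D x -> (forall y, D y -> P y) -> \near x, P x.
Proof. by move=> Dx DP; apply: filterS DP _; exact: open_nbhs_nbhs. Qed.

Lemma eq_smooth_upto k f g : (forall x, D x -> f x = g x) ->
  smooth_upto k f -> smooth_upto k g.
Proof.
elim: k f g => [|k IH] f g fg sf.
  move=> [|//] _ x Dx /=; have df := sf [::] isT x Dx.
  by apply: (near_eq_differentiable _ df); exact: near_in.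
have [df sf'] := (smooth_uptoS _ _).1 sf.
apply/smooth_uptoS; split=> [x Dx|l].
  by apply: (near_eq_differentiable _ (df x Dx)); exact: near_in.
by apply: (IH _ _ _ (sf' l)) => x Dx; apply: near_partial; exact: near_in.
Qed.

Lemma smooth_upto_cst k c : smooth_upto k (fun=> c).
Proof.
elim: k c => [|k IH] c; first by move=> [|//] _ x Dx; exact: differentiable_cst.
apply/smooth_uptoS; split=> [x Dx|l]; first exact: differentiable_cst.
by rewrite (_ : partial l _ = fun=> 0)//; apply/funext => x; exact: partial_cst.
Qed.

Lemma smooth_uptoD k f g : smooth_upto k f -> smooth_upto k g ->
  smooth_upto k (fun x => f x + g x).
Proof.
elim: k f g => [|k IH] f g sf sg.
  by move=> [|//] _ x Dx; apply: differentiableD; [exact: (sf [::])|exact: (sg [::])].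
have [df sf'] := (smooth_uptoS _ _).1 sf; have [dg sg'] := (smooth_uptoS _ _).1 sg.
apply/smooth_uptoS; split=> [x Dx|l].
  by apply: differentiableD; [exact: df|exact: dg].
apply: (eq_smooth_upto _ (IH _ _ (sf' l) (sg' l))) => x Dx.
by rewrite partialD//; [exact: df|exact: dg].
Qed.

Lemma smooth_uptoM k f g : smooth_upto k f -> smooth_upto k g ->
  smooth_upto k (fun x => f x * g x).
Proof.
elim: k f g => [|k IH] f g sf sg.
  by move=> [|//] _ x Dx; apply: differentiableM; [exact: (sf [::])|exact: (sg [::])].
have [df sf'] := (smooth_uptoS _ _).1 sf; have [dg sg'] := (smooth_uptoS _ _).1 sg.
apply/smooth_uptoS; split=> [x Dx|l].
  by apply: differentiableM; [exact: df|exact: dg].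
apply: (eq_smooth_upto _ (smooth_uptoD (IH _ _ (smooth_uptoW sf) (sg' l))
  (IH _ _ (smooth_uptoW sg) (sf' l)))) => x Dx.
by rewrite partialM//; [exact: df|exact: dg].
Qed.

Lemma smooth_upto_comp0 (F dF : R -> R) f :
  (forall x, D x -> is_derive (f x) 1 F (dF (f x))) ->
  smooth_upto 0 f -> smooth_upto 0 (fun x => F (f x)).
Proof.
move=> FdF sf [|//] _ x Dx.
by apply: differentiable_comp1 (FdF x Dx); exact: (sf [::]).
Qed.

(** The derivative of [F \o f] involves [dF \o f], so each order of smoothness of
    the composite costs one order of the latter; functions [F] whose derivative is
    expressed through [F] itself bootstrap. *)
Lemma smooth_upto_compS k (F dF : R -> R) f :
  (forall x, D x -> is_derive (f x) 1 F (dF (f x))) ->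
  smooth_upto k.+1 f -> smooth_upto k (fun x => dF (f x)) ->
  smooth_upto k.+1 (fun x => F (f x)).
Proof.
move=> FdF sf sdF; have [df sf'] := (smooth_uptoS _ _).1 sf.
apply/smooth_uptoS; split=> [x Dx|l].
  by apply: differentiable_comp1 (FdF x Dx); exact: df.
apply: (eq_smooth_upto _ (smooth_uptoM sdF (sf' l))) => x Dx.
by rewrite (partial_comp1 _ _ (FdF x Dx))//; exact: df.
Qed.

Lemma eq_smooth_on f g : (forall x, D x -> f x = g x) ->
  smooth_on D f -> smooth_on D g.
Proof.
by move=> fg /smooth_uptoP sf; apply/smooth_uptoP => k; apply: eq_smooth_upto (sf k).
Qed.

Lemma smooth_on_differentiable f x : smooth_on D f -> D x -> differentiable f x.
Proof. by move=> sf; exact: (sf [::]). Qed.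

Lemma smooth_on_partial l f : smooth_on D f -> smooth_on D (partial l f).
Proof. by move=> sf s x Dx; rewrite -foldr_rcons; exact: sf. Qed.

Lemma smooth_on_cst c : smooth_on D (fun=> c).
Proof. by apply/smooth_uptoP => k; exact: smooth_upto_cst. Qed.

Lemma smooth_onD f g : smooth_on D f -> smooth_on D g ->
  smooth_on D (fun x => f x + g x).
Proof.
move=> /smooth_uptoP sf /smooth_uptoP sg.
by apply/smooth_uptoP => k; exact: smooth_uptoD.
Qed.

Lemma smooth_onM f g : smooth_on D f -> smooth_on D g ->
  smooth_on D (fun x => f x * g x).
Proof.
move=> /smooth_uptoP sf /smooth_uptoP sg.
by apply/smooth_uptoP => k; exact: smooth_uptoM.
Qed.

Lemma smooth_onN f : smooth_on D f -> smooth_on D (fun x => - f x).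
Proof.
move=> sf; apply: eq_smooth_on (smooth_onM (smooth_on_cst (-1)) sf) => x _.
by rewrite mulN1r.
Qed.

Lemma smooth_onB f g : smooth_on D f -> smooth_on D g ->
  smooth_on D (fun x => f x - g x).
Proof. by move=> sf sg; apply: smooth_onD => //; exact: smooth_onN. Qed.

Lemma smooth_on_sum (I : Type) (r : seq I) (F : I -> 'rV[R]_n -> R) :
  (forall i, smooth_on D (F i)) -> smooth_on D (fun x => \sum_(i <- r) F i x).
Proof.
move=> sF; elim: r => [|i r IH].
  by apply: eq_smooth_on (smooth_on_cst 0) => x _; rewrite big_nil.
by apply: eq_smooth_on (smooth_onD (sF i) IH) => x _; rewrite big_cons.
Qed.

Lemma smooth_on_prod (I : Type) (r : seq I) (F : I -> 'rV[R]_n -> R) :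
  (forall i, smooth_on D (F i)) -> smooth_on D (fun x => \prod_(i <- r) F i x).
Proof.
move=> sF; elim: r => [|i r IH].
  by apply: eq_smooth_on (smooth_on_cst 1) => x _; rewrite big_nil.
by apply: eq_smooth_on (smooth_onM (sF i) IH) => x _; rewrite big_cons.
Qed.

Lemma smooth_onX f k : smooth_on D f -> smooth_on D (fun x => f x ^+ k).
Proof.
move=> sf; elim: k => [|k IH]; first by apply: eq_smooth_on (smooth_on_cst 1).
by apply: eq_smooth_on (smooth_onM sf IH) => x _; rewrite exprS.
Qed.

Lemma smooth_onV f : (forall x, D x -> f x != 0) -> smooth_on D f ->
  smooth_on D (fun x => (f x)^-1).
Proof.
move=> f0 /smooth_uptoP sf; apply/smooth_uptoP.
have fV x : D x -> is_derive (f x) 1 (@GRing.inv R) (- (f x)^-1 ^+ 2).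
  move=> Dx; have := @is_deriveV _ id (f x) 1 1 (f0 x Dx) (is_derive_id _ _).
  by rewrite /GRing.scale /= mulr1 exprVn.
elim=> [|k IH]; first exact: (@smooth_upto_comp0 _ (fun y => - y^-1 ^+ 2)).
apply: (@smooth_upto_compS _ _ (fun y => - y^-1 ^+ 2)) => //.
have sVV := smooth_uptoM (smooth_upto_cst (-1)) (smooth_uptoM IH IH).
by apply: eq_smooth_upto sVV => x _; rewrite mulN1r expr2.
Qed.

Lemma smooth_on_sqrt f : (forall x, D x -> 0 < f x) -> smooth_on D f ->
  smooth_on D (fun x => Num.sqrt (f x)).
Proof.
move=> f0 sf; have sf' := (smooth_uptoP _).1 sf.
have fV x : D x -> is_derive (f x) 1 (@Num.sqrt R) (2 * Num.sqrt (f x))^-1.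
  by move=> Dx; apply: is_derive1_sqrt; exact: f0.
apply/smooth_uptoP.
elim=> [|k IH]; first exact: (@smooth_upto_comp0 _ (fun y => (2 * Num.sqrt y)^-1)).
apply: (@smooth_upto_compS _ _ (fun y => (2 * Num.sqrt y)^-1)) => //.
(* 1 / (2 sqrt f) is sqrt f / (2 f), and f itself is smooth to all orders *)
have sV : smooth_upto k (fun x => (2 * f x)^-1).
  apply: (smooth_uptoP _).1; apply: smooth_onV; last first.
    by apply: smooth_onM => //; exact: smooth_on_cst.
  by move=> x Dx; rewrite mulf_neq0 ?gt_eqF// f0.
apply: (eq_smooth_upto _ (smooth_uptoM IH sV)) => x Dx.
have s0 : Num.sqrt (f x) != 0 by rewrite gt_eqF// sqrtr_gt0 f0.
rewrite -{2}[f x]sqr_sqrtr ?ltW ?f0// expr2.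
by rewrite !invfM mulrCA !mulrA mulrK ?unitfE// mulrC.
Qed.

Lemma smooth_on_sin_cos f : smooth_on D f ->
  smooth_on D (fun x => sin (f x)) /\ smooth_on D (fun x => cos (f x)).
Proof.
move=> /smooth_uptoP sf.
suff scU k : smooth_upto k (fun x => sin (f x)) /\ smooth_upto k (fun x => cos (f x)).
  by split; apply/smooth_uptoP => k; case: (scU k).
elim: k => [|k [IHs IHc]].
  split; first exact: (@smooth_upto_comp0 (@sin R) cos).
  exact: (@smooth_upto_comp0 (@cos R) (fun y => - sin y)).
split; first exact: (@smooth_upto_compS _ (@sin R) cos).
have sNs := smooth_uptoM (smooth_upto_cst (-1)) IHs.
apply: (@smooth_upto_compS _ (@cos R) (fun y => - sin y)) => //.
by apply: eq_smooth_upto sNs => x _; rewrite mulN1r.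
Qed.

Lemma smooth_on_acos f : (forall x, D x -> f x ^+ 2 < 1) -> smooth_on D f ->
  smooth_on D (fun x => acos (f x)).
Proof.
move=> f1 sf.
have dacos x : D x -> is_derive (f x) 1 (@acos R) (- (Num.sqrt (1 - f x ^+ 2))^-1).
  move=> Dx; apply: is_derive1_acos; rewrite -ltr_norml.
  by rewrite -(@ltr_pXn2r _ 2)// ?nnegrE// expr1n real_normK ?num_real ?f1.
have sd : smooth_on D (fun x => - (Num.sqrt (1 - f x ^+ 2))^-1).
  have f10 x : D x -> 0 < 1 - f x ^+ 2 by move=> Dx; rewrite subr_gt0 f1.
  apply: smooth_onN; apply: smooth_onV => [x Dx|].
    by rewrite gt_eqF// sqrtr_gt0 f10.
  apply: smooth_on_sqrt => //; apply: smooth_onB; first exact: smooth_on_cst.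
  exact: smooth_onX.
have sf' := (smooth_uptoP _).1 sf; have sd' := (smooth_uptoP _).1 sd.
apply/smooth_uptoP; case=> [|k].
  exact: (@smooth_upto_comp0 _ (fun y => - (Num.sqrt (1 - y ^+ 2))^-1)).
exact: (@smooth_upto_compS _ _ (fun y => - (Num.sqrt (1 - y ^+ 2))^-1)).
Qed.

Lemma open_smooth_neq0 f : smooth_on D f -> open (D `&` [set x | f x != 0]).
Proof.
move=> sf; rewrite openE => x [Dx fx0]; rewrite /interior; apply: filterI.
  exact: open_nbhs_nbhs.
have cf : {for x, continuous f}.
  by apply: differentiable_continuous; exact: smooth_on_differentiable.
exact: (cf [set y | y != 0] (open_nbhs_nbhs (conj (@open_neq _ 0) fx0))).
Qed.

End Smooth.

Lemma smooth_on_sub (R : realType) (n : nat) (D E : set 'rV[R]_n)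
    (f : 'rV[R]_n -> R) : E `<=` D -> smooth_on D f -> smooth_on E f.
Proof. by move=> ED sf s x /ED; exact: sf. Qed.

Section SmoothMx.
Variables (R : realType) (n : nat) (D : set 'rV[R]_n).
Hypothesis openD : open D.

Lemma eq_smooth_mx p q (A B : 'rV[R]_n -> 'M[R]_(p, q)) :
  (forall x, D x -> A x = B x) -> smooth_mx_on D A -> smooth_mx_on D B.
Proof. by move=> AB sA a b; apply: (eq_smooth_on openD _ (sA a b)) => x /AB ->. Qed.

Lemma smooth_mx_cst p q (A : 'M[R]_(p, q)) : smooth_mx_on D (fun=> A).
Proof. by move=> a b; exact: smooth_on_cst. Qed.

Lemma smooth_mxD p q (A B : 'rV[R]_n -> 'M[R]_(p, q)) : smooth_mx_on D A ->
  smooth_mx_on D B -> smooth_mx_on D (fun x => A x + B x).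
Proof.
move=> sA sB a b; apply: (eq_smooth_on openD _ (smooth_onD openD (sA a b) (sB a b))).
by move=> x _; rewrite mxE.
Qed.

Lemma smooth_mxM p q r (A : 'rV[R]_n -> 'M[R]_(p, q)) (B : 'rV[R]_n -> 'M[R]_(q, r)) :
  smooth_mx_on D A -> smooth_mx_on D B -> smooth_mx_on D (fun x => A x *m B x).
Proof.
move=> sA sB a b; apply: (eq_smooth_on openD (f := fun x => \sum_j A x a j * B x j b)).
  by move=> x _; rewrite mxE.
by apply: smooth_on_sum => // j; exact: smooth_onM.
Qed.

Lemma smooth_mxZ p q (f : 'rV[R]_n -> R) (A : 'rV[R]_n -> 'M[R]_(p, q)) :
  smooth_on D f -> smooth_mx_on D A -> smooth_mx_on D (fun x => f x *: A x).
Proof.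
move=> sf sA a b; apply: (eq_smooth_on openD _ (smooth_onM openD sf (sA a b))).
by move=> x _; rewrite mxE.
Qed.

Lemma smooth_mxB p q (A B : 'rV[R]_n -> 'M[R]_(p, q)) : smooth_mx_on D A ->
  smooth_mx_on D B -> smooth_mx_on D (fun x => A x - B x).
Proof.
move=> sA sB a b; apply: (eq_smooth_on openD _ (smooth_onB openD (sA a b) (sB a b))).
by move=> x _; rewrite !mxE.
Qed.

Lemma smooth_mx_tr p q (A : 'rV[R]_n -> 'M[R]_(p, q)) : smooth_mx_on D A ->
  smooth_mx_on D (fun x => (A x)^T).
Proof. by move=> sA a b; apply: (eq_smooth_on openD _ (sA b a)) => x _; rewrite mxE. Qed.

Lemma smooth_mx_sum (I : Type) (r : seq I) p q (A : I -> 'rV[R]_n -> 'M[R]_(p, q)) :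
  (forall i, smooth_mx_on D (A i)) -> smooth_mx_on D (fun x => \sum_(i <- r) A i x).
Proof.
move=> sA a b; apply: (eq_smooth_on openD _ (smooth_on_sum openD r
  (fun i => sA i a b))) => x _.
by rewrite summxE.
Qed.

Lemma smooth_det p (A : 'rV[R]_n -> 'M[R]_p) : smooth_mx_on D A ->
  smooth_on D (fun x => \det (A x)).
Proof.
move=> sA; apply: smooth_on_sum => // s.
by apply: smooth_onM => //; [exact: smooth_on_cst|apply: smooth_on_prod].
Qed.

(** By Cramer's rule the entries of the inverse are rational in those of [A]. *)
Lemma smooth_invmx p (A : 'rV[R]_n -> 'M[R]_p) :
  (forall x, D x -> A x \in unitmx) -> smooth_mx_on D A ->
  smooth_mx_on D (fun x => invmx (A x)).
Proof.
move=> uA sA; apply: (eq_smooth_mx (A := fun x => (\det (A x))^-1 *: \adj (A x))).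
  by move=> x Dx; rewrite /invmx uA.
apply: smooth_mxZ.
  apply: smooth_onV => //; last exact: smooth_det.
  by move=> x /uA; rewrite unitmxE unitfE.
move=> a b; apply: (eq_smooth_on openD (f := fun x => cofactor (A x) b a)).
  by move=> x _; rewrite mxE.
apply: smooth_onM => //; first exact: smooth_on_cst.
by apply: smooth_det => i j; apply: (eq_smooth_on openD _ (sA _ _)) => x _; rewrite !mxE.
Qed.

Lemma smooth_partial_mx p q l (A : 'rV[R]_n -> 'M[R]_(p, q)) :
  smooth_mx_on D A -> smooth_mx_on D (partial_mx l A).
Proof.
move=> sA a b; apply: (eq_smooth_on openD _ (smooth_on_partial l (sA a b))) => x _.
by rewrite mxE.
Qed.

End SmoothMx.

(** * Chain rule and symmetry of second derivatives *)

Section Chain.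
Variables (R : realType) (n m : nat).

Lemma differentiable_row (t : 'rV[R]_n -> 'rV[R]_m) x :
  (forall q, differentiable (fun y => t y 0 q) x) -> differentiable t x.
Proof.
move=> dt; rewrite (_ : t = \sum_q (fun y => t y 0 q *: delta_mx 0 q)); last first.
  by apply/funext => y; rewrite fct_sumE -row_sum_delta.
by apply: differentiable_sum => q; exact: (differentiableZl _ (dt q)).
Qed.

Lemma partial_comp (f : 'rV[R]_m -> R) (t : 'rV[R]_n -> 'rV[R]_m) x l :
  (forall q, differentiable (fun y => t y 0 q) x) -> differentiable f (t x) ->
  partial l (fun y => f (t y)) x =
  \sum_q partial l (fun y => t y 0 q) x * partial q f (t x).
Proof.
move=> dt df; have dtx := differentiable_row dt.
rewrite partialE; last exact: (@differentiable_comp _ _ _ _ t f).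
rewrite (@diff_comp _ _ _ _ t f)//= -(deriveE _ dtx) derive_mx; last exact: diff_derivable.
rewrite [X in 'd _ _ X]row_sum_delta linear_sum; apply: eq_bigr => q _.
by rewrite linearZ mxE /= (partialE _ df).
Qed.
End Chain.

Section Schwarz.
Variables (R : realType) (V : normedModType R).
Implicit Types (f : V -> R) (x a b y : V).

Lemma is_derive_line f y a (t : R) : differentiable f (t *: a + y) ->
  is_derive t 1 (fun t : R => f (t *: a + y)) ('D_a f (t *: a + y)).
Proof.
move=> df; have dfa : derivable f (t *: a + y) a := diff_derivable df.
have E : (fun h : R => h^-1 *: (((fun t : R => f (t *: a + y)) \o shift t) (h *: 1) -
      f (t *: a + y))) =
    (fun h : R => h^-1 *: ((f \o shift (t *: a + y)) (h *: a) - f (t *: a + y))).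
  by apply/funext => h /=; rewrite [h%:A]mulr1 scalerDl addrA.
by apply: DeriveDef; rewrite /derivable /derive E.
Qed.

(** Two applications of the mean value theorem are replaced by one, in the
    direction [a], followed by the first-order expansion of the derivative
    ['D_a f] at [x]: this only needs ['D_a f] differentiable at the single
    point [x]. *)
Lemma second_difference f x a b :
  (\near x, differentiable f x) -> differentiable ('D_a f) x ->
  forall e, 0 < e -> \forall h \near (0 : R)^'+,
    `|f (h *: a + (h *: b + x)) - f (h *: a + x) - (f (h *: b + x) - f x)
      - h ^+ 2 * 'D_b ('D_a f) x| <= e * h ^+ 2.
Proof.
move=> df dP e e0; set P := 'D_a f in dP *.
set M := `|a| + `|b| + 1.
have M0 : 0 < M by rewrite ltr_pwDr// addr_ge0.
have e1 : 0 < e / (2 * M) by rewrite divr_gt0// mulr_gt0.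
have := diff_locally dP; move=> /eqaddoP/(_ _ e1).
rewrite -nbhs_nearE => /nbhs_normP[d1 /= d10 dP1].
have /nbhs_normP[d2 /= d20 df2] := df.
near=> h.
have h0 : 0 < h by [].
have hM : h * M < Num.min d1 d2.
  rewrite -ltr_pdivlMr//; near: h; apply: nbhs_right_lt.
  by rewrite divr_gt0// lt_min d10.
move: hM; rewrite lt_min => /andP[hM1 hM2].
have small (c : R) (z : V) : 0 <= c <= h -> z = h *: b \/ z = 0 ->
    `|c *: a + z| <= h * M.
  move=> /andP[c0 ch] zE; rewrite (le_trans (ler_normD _ _))// normrZ ger0_norm//.
  have zb : `|z| <= h * `|b|.
    case: zE => ->; first by rewrite normrZ gtr0_norm.
    by rewrite normr0 mulr_ge0// ltW.
  have ca : c * `|a| <= h * `|a| by rewrite ler_wpM2r.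
  by rewrite /M; nra.
have dfin (c : R) (z : V) : 0 <= c <= h -> z = h *: b \/ z = 0 ->
    differentiable f (c *: a + (z + x)).
  move=> ch zE; apply: df2; rewrite /ball_ /= addrA opprD addrCA subrr addr0 normrN.
  exact: le_lt_trans (small _ _ ch zE) hM2.
have Pin (c : R) (z : V) : 0 <= c <= h -> z = h *: b \/ z = 0 ->
    `|P (c *: a + (z + x)) - P x - 'd P x (c *: a + z)| <= e / (2 * M) * (h * M).
  move=> ch zE; have := dP1 (c *: a + z); rewrite /ball_ /= sub0r normrN.
  move=> /(_ (le_lt_trans (small _ _ ch zE) hM1)).
  rewrite !fctE /= opprD !addrA => /le_trans; apply.
  by rewrite ler_wpM2l ?(ltW e1)//; exact: small.
pose phi (t : R) := f (t *: a + (h *: b + x)) - f (t *: a + (0 + x)).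
pose dphi (t : R) := P (t *: a + (h *: b + x)) - P (t *: a + (0 + x)).
have dphiP (t : R) : 0 <= t <= h -> is_derive t 1 phi (dphi t).
  by move=> th; apply: is_deriveB; apply: is_derive_line; apply: dfin => //; auto.
have [||c] := @MVT _ phi dphi 0 h h0.
- by move=> t; rewrite in_itv /= => /andP[t0 th]; apply: dphiP; rewrite !ltW.
- apply: derivable_within_continuous => t; rewrite in_itv /= => th.
  by case: (dphiP t th).
rewrite in_itv /= => /andP[c0 ch]; have {c0 ch}ch : 0 <= c <= h by rewrite !ltW.
rewrite /phi !scale0r !add0r subr0 => ->.
have dPE : 'd P x (c *: a + h *: b) - 'd P x (c *: a + 0) = h * 'D_b P x.
  by rewrite -linearB /= addr0 addrAC subrr add0r linearZ /= deriveE.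
rewrite expr2 -mulrA -dPE mulrC -mulrBr normrM gtr0_norm// mulrCA ler_pM2l//.
have /= A1 := Pin c _ ch (or_introl erefl); have /= A2 := Pin c _ ch (or_intror erefl).
rewrite /dphi.
have recenter (t p q r s : R) : p - q - (r - s) = (p - t - r) - (q - t - s).
  by ring.
rewrite (recenter (P x)).
apply: le_trans (ler_normB _ _) _; apply: le_trans (lerD A1 A2) _.
rewrite le_eqVlt; apply/orP; left; apply/eqP; field.
by rewrite gt_eqF.
Unshelve. all: by end_near. Qed.

(** Symmetry of second derivatives: the second difference quotient in [a] and
    [b] does not depend on the order of the two directions. *)
Lemma derive_swap f x a b : (\near x, differentiable f x) ->
  differentiable ('D_a f) x -> differentiable ('D_b f) x ->
  'D_b ('D_a f) x = 'D_a ('D_b f) x.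
Proof.
move=> df da db; apply/eqP; rewrite -subr_eq0 -normr_le0.
apply/ler_addgt0Pl => e e0; rewrite addr0.
have e2 : 0 < e / 2 by rewrite divr_gt0.
have H1 := second_difference b df da e2; have H2 := second_difference a df db e2.
have [h [[B1 B2] h0]] := @filter_ex _ _ (at_right_proper_filter 0) _
  (filterI (filterI H1 H2) (nbhs_right_gt (0 : R))).
rewrite (addrCA (h *: b) (h *: a) x) in B2.
have h20 : 0 < h ^+ 2 by rewrite exprn_gt0.
rewrite -(ler_pM2r h20) -{1}(gtr0_norm h20) -normrM.
rewrite [leRHS](_ : _ = e / 2 * h ^+ 2 + e / 2 * h ^+ 2); last by field.
have recombine (p q r t X Y k : R) :
  (X - Y) * k = (p - r - (q - t) - k * Y) - (p - q - (r - t) - k * X) by ring.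
rewrite (recombine (f (h *: a + (h *: b + x))) (f (h *: a + x))
                   (f (h *: b + x)) (f x)).
by apply: le_trans (ler_normB _ _) _; exact: lerD B2 B1.
Qed.
End Schwarz.

Lemma smooth_partialC (R : realType) (n : nat) (D : set 'rV[R]_n) (l m : 'I_n)
    (f : 'rV[R]_n -> R) x : open D -> smooth_on D f -> D x ->
  partial l (partial m f) x = partial m (partial l f) x.
Proof.
move=> oD sf Dx; apply: derive_swap.
- by apply: (near_in oD Dx) => y Dy; exact: smooth_on_differentiable sf Dy.
- by apply: (smooth_on_differentiable (smooth_on_partial m sf)).
- by apply: (smooth_on_differentiable (smooth_on_partial l sf)).
Qed.

(** * The model cubic form and its stabilizer *)

Local Notation co v k := (v (ix k%N) 0) (only parsing).
Section Polarization.
Variables (R : realFieldType) (V : zmodType) (m : V -> V -> V -> V -> R).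
Hypothesis m1D : forall x x' y z t, m (x + x') y z t = m x y z t + m x' y z t.
Hypothesis m2D : forall x y y' z t, m x (y + y') z t = m x y z t + m x y' z t.
Hypothesis m3D : forall x y z z' t, m x y (z + z') t = m x y z t + m x y z' t.
Hypothesis m4D : forall x y z t t', m x y z (t + t') = m x y z t + m x y z t'.
Hypothesis m34 : forall x y z t, m x y z t = m x y t z.
Hypothesis m0 : forall v, m v v v v = 0.

Definition msym x y z t :=
  m x y z t + m y x z t + m x z y t + m z x y t + m x t y z + m t x y z +
  m y z x t + m z y x t + m y t x z + m t y x z + m z t x y + m t z x y.

(** The alternating sum over the sixteen partial sums of four vectors extracts
    from a quartic form its symmetrised polar form. *)
Lemma polarization x y z t : msym x y z t = 0.
Proof.
transitivity (2^-1 * (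
    m x y z t + m x y t z + m x z y t + m x z t y + m x t y z + m x t z y +
    m y x z t + m y x t z + m y z x t + m y z t x + m y t x z + m y t z x +
    m z x y t + m z x t y + m z y x t + m z y t x + m z t x y + m z t y x +
    m t x y z + m t x z y + m t y x z + m t y z x + m t z x y + m t z y x)).
  rewrite /msym; do ![rewrite [m _ _ y x]m34|rewrite [m _ _ z x]m34|rewrite [m _ _ t x]m34
   |rewrite [m _ _ z y]m34|rewrite [m _ _ t y]m34|rewrite [m _ _ t z]m34].
  by field.
apply/eqP; rewrite mulf_eq0 invr_eq0 pnatr_eq0 /=; apply/eqP.
transitivity (m (x + y + z + t) (x + y + z + t) (x + y + z + t) (x + y + z + t)
  - m (x + y + z) (x + y + z) (x + y + z) (x + y + z)
  - m (x + y + t) (x + y + t) (x + y + t) (x + y + t)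
  - m (x + z + t) (x + z + t) (x + z + t) (x + z + t)
  - m (y + z + t) (y + z + t) (y + z + t) (y + z + t)
  + m (x + y) (x + y) (x + y) (x + y) + m (x + z) (x + z) (x + z) (x + z)
  + m (x + t) (x + t) (x + t) (x + t) + m (y + z) (y + z) (y + z) (y + z)
  + m (y + t) (y + t) (y + t) (y + t) + m (z + t) (z + t) (z + t) (z + t)
  - m x x x x - m y y y y - m z z z z - m t t t t); last by rewrite !m0; ring.
rewrite !m1D !m2D !m3D !m4D.
ring.
Qed.
End Polarization.

Lemma ixE (i j : nat) : (0 < i < 6)%N -> (0 < j < 6)%N -> (ix i == ix j) = (i == j).
Proof.
by case: i j => [|i] [|j] //= i5 j5; rewrite -val_eqE /= !inordK.
Qed.

Lemma sum5 (V : nmodType) (F : 'I_5 -> V) :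
  \sum_i F i = F (ix 1) + F (ix 2) + F (ix 3) + F (ix 4) + F (ix 5).
Proof.
rewrite !big_ord_recl big_ord0 addr0 !addrA.
by do ![congr (_ + _)]; congr F; apply: val_inj; rewrite /= inordK.
Qed.

Lemma ord5_ind (P : 'I_5 -> Prop) :
  P (ix 1) -> P (ix 2) -> P (ix 3) -> P (ix 4) -> P (ix 5) -> forall i, P i.
Proof.
move=> P1 P2 P3 P4 P5 i; have -> : i = ix i.+1 by apply: val_inj; rewrite /ix /= inordK ?ltn_ord.
by case: i => -[|[|[|[|[|i]]]]].
Qed.

Section Model.
Variable R : realType.
Let s : R := Num.sqrt 3.
Let V := 'cV[R]_5.
Implicit Types (x y z t u v : V) (w : 'I_5 -> 'M[R]_5).

Let s2 : s * s = 3.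
Proof. by rewrite -expr2 sqr_sqrtr. Qed.

(** The symmetric trilinear form whose cubic form is [ups_model]; it is grouped
    by the coordinates of [z], so that its coefficients are the components of the
    product of [x] and [y]. *)
Definition ups3 x y z : R :=
  (- co x 1 * co y 1 + co x 2 * co y 2 + co x 4 * co y 4
   - (co x 3 * co y 3 + co x 5 * co y 5) / 2) * co z 1
  + (co x 1 * co y 2 + co x 2 * co y 1
     + Num.sqrt 3 / 2 * (co x 3 * co y 5 + co x 5 * co y 3)) * co z 2
  + (- (co x 1 * co y 3 + co x 3 * co y 1) / 2
     + Num.sqrt 3 / 2 * (co x 2 * co y 5 + co x 5 * co y 2)
     - Num.sqrt 3 / 2 * (co x 3 * co y 4 + co x 4 * co y 3)) * co z 3
  + (co x 1 * co y 4 + co x 4 * co y 1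
     + Num.sqrt 3 / 2 * (co x 5 * co y 5 - co x 3 * co y 3)) * co z 4
  + (- (co x 1 * co y 5 + co x 5 * co y 1) / 2
     + Num.sqrt 3 / 2 * (co x 2 * co y 3 + co x 3 * co y 2)
     + Num.sqrt 3 / 2 * (co x 4 * co y 5 + co x 5 * co y 4)) * co z 5.

Lemma ups3_diag v : ups3 v v v = ups_model v.
Proof. by rewrite /ups3 /ups_model; field. Qed.

Lemma ups3C x y z : ups3 x y z = ups3 y x z.
Proof. by rewrite /ups3; ring. Qed.

Lemma ups3CA x y z : ups3 x y z = ups3 x z y.
Proof. by rewrite /ups3; field. Qed.

Lemma ups3D1 x x' y z : ups3 (x + x') y z = ups3 x y z + ups3 x' y z.
Proof. by rewrite /ups3 !mxE; field. Qed.

Lemma ups3Z1 c x y z : ups3 (c *: x) y z = c * ups3 x y z.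
Proof. by rewrite /ups3 !mxE; field. Qed.

Lemma ups3D3 x y z z' : ups3 x y (z + z') = ups3 x y z + ups3 x y z'.
Proof. by rewrite ups3CA ups3C ups3D1 ups3C ups3CA [ups3 z' _ _]ups3C (ups3CA _ z'). Qed.

(** A matrix-valued 1-form, given by its values on a basis, evaluated at [x]. *)
Definition along w x : 'M[R]_5 := \sum_l x l 0 *: w l.

Lemma alongD w x y : along w (x + y) = along w x + along w y.
Proof.
by rewrite /along -big_split; apply: eq_bigr => l _; rewrite mxE scalerDl.
Qed.

Lemma along_delta w k : along w (delta_mx k 0) = w k.
Proof.
rewrite /along (bigD1 k)//= mxE !eqxx scale1r big1 ?addr0// => l lk.
by rewrite mxE (negPf lk) scale0r.
Qed.

Definition entry w (b i j : nat) : R := w (ix b) (ix i) (ix j).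

Section Relations.
Variable w : 'I_5 -> 'M[R]_5.
Hypothesis wA : forall l, (w l)^T = - w l.
Hypothesis w0 : forall u, ups3 u u (along w u *m u) = 0.
Let m x y z t : R := ups3 z t (along w x *m y).
Let e k : V := delta_mx (ix k) 0.
Let M b i j k := msym m (e b) (e i) (e j) (e k).
Let a := entry w.

Let aA b i j : a b i j = - a b j i.
Proof. by rewrite /a /entry -{1}[w (ix b)]opprK -wA !mxE. Qed.

Let a0 b i : a b i i = 0.
Proof. by have := aA b i i; lra. Qed.

Let M0 b i j k : M b i j k = 0.
Proof.
apply: polarization => //; rewrite /m.
- by move=> x x' y z t; rewrite alongD mulmxDl ups3D3.
- by move=> x y y' z t; rewrite mulmxDr ups3D3.
- by move=> x y z z' t; rewrite ups3D1.
- by move=> x y z t t'; rewrite !(ups3C z) ups3D1.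
- by move=> x y z t; rewrite ups3C.
Qed.

Let eE j k : (0 < j < 6)%N -> (0 < k < 6)%N -> co (e j) k = (k == j)%:R.
Proof. by move=> j6 k6; rewrite mxE eqxx andbT ixE. Qed.

(* the multiplication table of the basis, each product paired with z *)
Let basis_prd (j k : nat) z : R :=
  match j, k with
  | 1, 1 => - co z 1 | 1, 2 | 2, 1 => co z 2 | 1, 4 | 4, 1 => co z 4
  | 1, 3 | 3, 1 => - co z 3 / 2 | 1, 5 | 5, 1 => - co z 5 / 2
  | 2, 2 | 4, 4 => co z 1 | 2, 3 | 3, 2 | 4, 5 | 5, 4 => s / 2 * co z 5
  | 2, 5 | 5, 2 => s / 2 * co z 3 | 3, 4 | 4, 3 => - s / 2 * co z 3
  | 3, 5 | 5, 3 => s / 2 * co z 2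
  | 3, 3 => - co z 1 / 2 - s / 2 * co z 4 | 5, 5 => - co z 1 / 2 + s / 2 * co z 4
  | _, _ => 0
  end.

Let basis_prdE j k z : (0 < j < 6)%N -> (0 < k < 6)%N -> ups3 (e j) (e k) z = basis_prd j k z.
Proof.
case: j => [|[|[|[|[|[|j]]]]]] //; case: k => [|[|[|[|[|[|k]]]]]] // _ _.
all: by rewrite /ups3 !eE// /basis_prd /= -/s; field.
Qed.

Let mE b i j k : (0 < j < 6)%N -> (0 < k < 6)%N ->
  m (e b) (e i) (e j) (e k) = basis_prd j k (w (ix b) *m e i).
Proof. by move=> j6 k6; rewrite /m along_delta basis_prdE. Qed.

Let weE b i k : co (w (ix b) *m e i) k = a b k i.
Proof. by rewrite -colE mxE. Qed.

(* Each [M b i j k] is a coefficient of the vanishing quartic form, linear in the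
   entries of [w]; [c] is the combination of them that proves the relation. *)
Ltac cert c :=
  apply/eqP; rewrite -subr_eq0; apply/eqP; transitivity c;
  [ rewrite /M /msym !mE// /basis_prd !weE ?a0 ?(aA _ 2 1) ?(aA _ 3 1) ?(aA _ 4 1)
      ?(aA _ 5 1) ?(aA _ 3 2) ?(aA _ 4 2) ?(aA _ 5 2) ?(aA _ 4 3) ?(aA _ 5 3)
      ?(aA _ 5 4); field: s2
  | by rewrite !M0; ring].

(** The linear system [M b i j k = 0] solved by elimination: twenty-five of the
    fifty entries of [w] are expressed by the others, and the certificates record
    the row operations. The free entries are one for each of the ten triples on
    which a totally skew tensor depends, and one for each of the fifteen
    coefficients of an [so(3)]-valued form. *)
Lemma quartic_relations : a 1 1 2 = 0 /\
  a 1 1 3 = s * a 1 2 5 - s * a 5 1 2 /\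
  a 1 1 4 = 0 /\
  a 1 1 5 = s * a 1 2 3 - s * a 3 1 2 /\
  a 1 3 4 = a 4 1 3 + a 1 2 5 - s * a 4 3 4 - a 5 1 2 /\
  a 1 3 5 = a 5 1 3 + 1/2 * a 1 2 4 - s * a 5 2 5 + 1/2 * a 2 1 4 /\
  a 1 4 5 = a 5 1 4 + a 1 2 3 - a 3 1 2 /\
  a 2 1 2 = 0 /\
  a 2 1 3 = s * a 2 2 5 - a 3 1 2 /\
  a 2 1 5 = s * a 2 2 3 - a 5 1 2 /\
  a 2 3 4 = a 4 2 3 + a 2 2 5 - a 4 4 5 /\
  a 2 3 5 = a 5 2 3 + 1/2 * a 2 2 4 - a 5 4 5 /\
  a 2 4 5 = a 5 2 4 + a 2 2 3 - 2 * a 5 3 5 /\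
  a 3 1 3 = s * a 3 3 4 /\
  a 3 1 4 = - a 4 1 3 + s * a 4 3 4 /\
  a 3 1 5 = - a 5 1 3 + s * a 3 2 3 + s * a 5 2 5 /\
  a 3 2 4 = - a 4 2 3 + 2 * a 3 3 5 + a 4 4 5 /\
  a 3 2 5 = - a 5 2 3 + a 3 3 4 + a 5 4 5 /\
  a 3 4 5 = a 5 3 4 + a 3 2 3 - a 5 2 5 /\
  a 4 1 2 = - a 2 1 4 /\
  a 4 1 4 = 0 /\
  a 4 1 5 = - a 5 1 4 + s * a 4 4 5 /\
  a 4 2 5 = - a 5 2 4 + a 4 3 4 + 2 * a 5 3 5 /\
  a 4 3 5 = - a 5 3 4 + 1/2 * a 4 2 4 + a 5 2 5 /\
  a 5 1 5 = s * a 5 4 5.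
Proof.
split; first by cert (- 1/9 * M 1 1 1 2).
split; first by cert (- 1/3 * s * M 1 1 2 5).
split; first by cert (- 1/9 * M 1 1 1 4).
split; first by cert (- 1/3 * s * M 1 1 2 3).
split; first by cert (- 1/3 * M 1 1 2 5 - 1/3 * s * M 1 3 4 4).
split; first by cert (1/54 * s * M 1 1 1 2 - 1/3 * s * M 1 2 3 3 - M 2 2 3 5).
split; first by cert (- 1/3 * M 1 1 2 3 + 1/3 * M 1 1 4 5).
split; first by cert (- 1/6 * M 1 1 2 2).
split; first by cert (1/3 * M 2 2 2 3).
split; first by cert (1/3 * M 2 2 2 5).
split; first by cert (1/9 * s * M 2 2 2 3 - 1/3 * s * M 2 3 4 4).
split; first by cert (- 1/36 * s * M 1 1 2 2 + 1/6 * s * M 2 2 5 5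
  + 1/18 * s * M 5 5 5 5).
split; first by cert (- 1/9 * s * M 2 2 2 5 - 2/3 * s * M 2 3 3 5).
split; first by cert (- 1/6 * M 3 3 3 3).
split; first by cert (- 1/3 * M 1 1 3 4 + 1/3 * s * M 1 3 4 4).
split; first by cert (M 2 2 3 5).
split; first by cert (2/9 * s * M 2 3 3 3 + 1/3 * s * M 2 3 4 4).
split; first by cert (1/18 * s * M 1 1 2 2 - 1/6 * s * M 2 2 3 3
  - 1/6 * s * M 2 2 5 5 - 1/18 * s * M 3 3 3 3 - 1/18 * s * M 5 5 5 5).
split; first by cert (- 1/3 * s * M 2 2 3 5 - 2/9 * s * M 3 3 3 5).
split; first by cert (- 1/3 * M 1 1 2 4).
split; first by cert (- 1/6 * M 1 1 4 4).
split; first by cert (- 1/3 * M 1 1 4 5 - 1/3 * s * M 1 4 4 5).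
split; first by cert (2/9 * s * M 2 2 2 5 + 2/3 * s * M 2 3 3 5
  - 1/3 * s * M 2 4 4 5).
split; first by cert (1/18 * s * M 1 1 2 4 + 1/3 * s * M 2 2 3 5
  - 1/3 * s * M 2 3 3 4 + 2/9 * s * M 3 3 3 5).
by cert (- 1/6 * M 5 5 5 5).
Qed.
End Relations.

Definition so3mx (c1 c2 c3 : R) : 'M[R]_5 := c1 *: E1 R + c2 *: E2 R + c3 *: E3 R.

Let so3tab (c1 c2 c3 : R) (i j : nat) : R :=
  match i, j with
  | 1, 5 => s * c1 | 5, 1 => - (s * c1) | 2, 3 | 4, 5 => c1 | 3, 2 | 5, 4 => - c1
  | 1, 3 => s * c2 | 3, 1 => - (s * c2) | 2, 5 | 3, 4 => c2 | 5, 2 | 4, 3 => - c2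
  | 2, 4 => 2 * c3 | 4, 2 => - (2 * c3) | 3, 5 => c3 | 5, 3 => - c3
  | _, _ => 0
  end.

Let e_E i j p q : (0 < i < 6)%N -> (0 < j < 6)%N -> (0 < p < 6)%N -> (0 < q < 6)%N ->
  e_ R i j (ix p) (ix q) = ((p == i) && (q == j))%:R - ((p == j) && (q == i))%:R.
Proof. by move=> i6 j6 p6 q6; rewrite !mxE !ixE. Qed.

Lemma so3mxE c1 c2 c3 i j : (0 < i < 6)%N -> (0 < j < 6)%N ->
  so3mx c1 c2 c3 (ix i) (ix j) = so3tab c1 c2 c3 i j.
Proof.
move=> i6 j6.
have -> : so3mx c1 c2 c3 (ix i) (ix j) =
    c1 * (s * e_ R 1 5 (ix i) (ix j) + e_ R 2 3 (ix i) (ix j) + e_ R 4 5 (ix i) (ix j))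
  + c2 * (s * e_ R 1 3 (ix i) (ix j) + e_ R 2 5 (ix i) (ix j) + e_ R 3 4 (ix i) (ix j))
  + c3 * (2 * e_ R 2 4 (ix i) (ix j) + e_ R 3 5 (ix i) (ix j)).
  by rewrite !mxE.
rewrite !e_E//; move: i j i6 j6.
case=> [|[|[|[|[|[|i]]]]]] //; case=> [|[|[|[|[|[|j]]]]]] // _ _ /=.
all: ring.
Qed.

Lemma so3mx_anti c1 c2 c3 : (so3mx c1 c2 c3)^T = - so3mx c1 c2 c3.
Proof.
have eA i j : (e_ R i j)^T = - e_ R i j by rewrite /e_ linearB /= !trmx_delta opprB.
have tD (A B : 'M[R]_5) : (A + B)^T = A^T + B^T by rewrite linearD.
have tZ (c : R) (A : 'M[R]_5) : (c *: A)^T = c *: A^T by rewrite linearZ.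
rewrite /so3mx /E1 /E2 /E3; move: (e_ R) eA => F FA.
by rewrite !(tD, tZ) !FA !(scalerN, scalerDr, opprD).
Qed.

Lemma so3mx_stab c1 c2 c3 u : ups3 u u (so3mx c1 c2 c3 *m u) = 0.
Proof.
rewrite /ups3 !mxE !sum5 !so3mxE//= -/s.
by field: s2.
Qed.

Lemma entryA w b i j : (forall l, (w l)^T = - w l) -> entry w b i j = - entry w b j i.
Proof. by move=> wA; rewrite /entry -{1}[w (ix b)]opprK -wA !mxE. Qed.

Lemma entry0 w b i : (forall l, (w l)^T = - w l) -> entry w b i i = 0.
Proof. by move=> wA; have := entryA b i i wA; lra. Qed.

(** The coefficients are forced by the requirement that [so3_part w - w] be totally skew.
    Its entries [b b j] must vanish, which determines the matrices of index 2 to 5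
    completely. Matrices of [so(3)] have no entries 1 2 and 1 4, so moving the
    entries 1 2 3 and 1 2 5 to 3 1 2 and 5 1 2 gives two coefficients of the first
    matrix, and comparing 1 2 4 with 2 1 4 gives the third. *)
Definition so3_parts (w : 'I_5 -> 'M[R]_5) : seq 'M[R]_5 :=
  [:: so3mx (entry w 1 2 3 - entry w 3 1 2) (entry w 1 2 5 - entry w 5 1 2)
            ((entry w 1 2 4 + entry w 2 1 4) / 2);
      so3mx (entry w 2 2 3) (entry w 2 2 5) (entry w 2 2 4 / 2);
      so3mx (entry w 3 2 3) (entry w 3 3 4) (entry w 3 3 5);
      so3mx (entry w 4 4 5) (entry w 4 3 4) (entry w 4 2 4 / 2);
      so3mx (entry w 5 4 5) (entry w 5 2 5) (entry w 5 3 5)].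

Definition so3_part w (b : 'I_5) : 'M[R]_5 := nth 0 (so3_parts w) b.

Lemma so3_partP w b : exists c1 c2 c3, so3_part w b = so3mx c1 c2 c3.
Proof.
by elim/ord5_ind: b; rewrite /so3_part /so3_parts /ix /= !inordK//=; do 3!eexists.
Qed.

Lemma so3mx0 : so3mx 0 0 0 = 0.
Proof. by rewrite /so3mx !scale0r !addr0. Qed.

(** Extend [A] to the 1-form with value [A] on the first basis vector and zero on
    the others; its quartic form is a multiple of the derivative of the cubic form
    along [A], hence vanishes, and the relations leave three free entries. *)
Lemma stabilizer (A : 'M[R]_5) : A^T = - A -> (forall u, ups3 u u (A *m u) = 0) ->
  exists c1 c2 c3, A = so3mx c1 c2 c3.
Proof.
move=> AA A0; pose w (l : 'I_5) := if l == ix 1 then A else 0.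
have wA l : (w l)^T = - w l by rewrite /w; case: ifP => // _; rewrite trmx0 oppr0.
have w0 u : ups3 u u (along w u *m u) = 0.
  have -> : along w u = co u 1 *: A.
    rewrite /along (bigD1 (ix 1))//= /w eqxx big1 ?addr0// => l /negPf ->.
    by rewrite scaler0.
  by rewrite -scalemxAl ups3CA ups3C ups3Z1 ups3C ups3CA A0 mulr0.
exists (A (ix 2) (ix 3)), (A (ix 2) (ix 5)), (A (ix 2) (ix 4) / 2).
have rel := quartic_relations wA w0.
have AE i j : A (ix i) (ix j) = entry w 1 i j by rewrite /entry /w eqxx.
have zE b i j : (1 < b < 6)%N -> entry w b i j = 0.
  by case: b => [|[|b]] // b6; rewrite /entry /w ixE//= mxE.
move: rel; rewrite !(zE 2%N)// !(zE 3%N)// !(zE 4%N)// !(zE 5%N)//.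
rewrite !(mulr0, subr0, addr0, add0r).
move=> [r12 [r13 [r14 [r15 [r34 [r35 [r45 _]]]]]]].
apply/matrixP; elim/ord5_ind; elim/ord5_ind. all: rewrite !AE !so3mxE//=.
all: rewrite ?(entry0 _ _ wA) ?(entryA _ 2 1 wA) ?(entryA _ 3 1 wA) ?(entryA _ 4 1 wA)
      ?(entryA _ 5 1 wA) ?(entryA _ 3 2 wA) ?(entryA _ 4 2 wA) ?(entryA _ 5 2 wA)
      ?(entryA _ 4 3 wA) ?(entryA _ 5 3 wA) ?(entryA _ 5 4 wA).
all: by rewrite ?(r12, r13, r14, r15, r34, r35, r45) -?/s; field.
Qed.

(** Total skewness kills row [b] of [w b]. For [b > 1] that row contains all three
    coefficients of an [so(3)] matrix; the entries of [w 1] then vanish because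
    they are, up to sign, entries of the other matrices. *)
Lemma so3_skew0 (w : 'I_5 -> 'M[R]_5) :
  (forall b, exists c1 c2 c3, w b = so3mx c1 c2 c3) ->
  (forall b i j, w b i j = - w i b j) -> forall b, w b = 0.
Proof.
move=> wso wS.
have Z b j : (w (ix b)) (ix b) (ix j) = 0 by have := wS (ix b) (ix b) (ix j); lra.
have w2 : w (ix 2) = 0.
  have [c1 [c2 [c3 E]]] := wso (ix 2); have := Z 2%N 3%N; have := Z 2%N 4%N.
  have := Z 2%N 5%N; rewrite E !so3mxE//= => -> h ->.
  have -> : c3 = 0 by lra.
  by rewrite so3mx0.
have w3 : w (ix 3) = 0.
  have [c1 [c2 [c3 E]]] := wso (ix 3); have := Z 3%N 2%N; have := Z 3%N 4%N.
  have := Z 3%N 5%N; rewrite E !so3mxE//= => -> -> h.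
  have -> : c1 = 0 by lra.
  by rewrite so3mx0.
have w4 : w (ix 4) = 0.
  have [c1 [c2 [c3 E]]] := wso (ix 4); have := Z 4%N 2%N; have := Z 4%N 3%N.
  have := Z 4%N 5%N; rewrite E !so3mxE//= => -> h2 h3.
  have -> : c2 = 0 by lra.
  have -> : c3 = 0 by lra.
  by rewrite so3mx0.
have w5 : w (ix 5) = 0.
  have [c1 [c2 [c3 E]]] := wso (ix 5); have := Z 5%N 2%N; have := Z 5%N 3%N.
  have := Z 5%N 4%N; rewrite E !so3mxE//= => h1 h3 h2.
  have -> : c1 = 0 by lra.
  have -> : c2 = 0 by lra.
  have -> : c3 = 0 by lra.
  by rewrite so3mx0.
have w1 : w (ix 1) = 0.
  have [c1 [c2 [c3 E]]] := wso (ix 1).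
  have := wS (ix 1) (ix 2) (ix 3); have := wS (ix 1) (ix 2) (ix 4).
  have := wS (ix 1) (ix 2) (ix 5); rewrite w2 E !so3mxE//= !mxE oppr0 => -> h ->.
  have -> : c3 = 0 by lra.
  by rewrite so3mx0.
by elim/ord5_ind.
Qed.

Lemma so3_part_skew w : (forall l, (w l)^T = - w l) ->
  (forall u, ups3 u u (along w u *m u) = 0) ->
  forall b i j, (so3_part w b - w b) i j = - (so3_part w i - w i) b j.
Proof.
move=> wA w0; have := quartic_relations wA w0.
move=> [f112 [f113 [f114 [f115 [f134 [f135 [f145 [f212 [f213 [f215 [f234 [f235
  [f245 [f313 [f314 [f315 [f324 [f325
  [f345 [f412 [f414 [f415 [f425 [f435 f515]]]]]]]]]]]]]]]]]]]]]]]].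
have pE b : (0 < b < 6)%N -> so3_part w (ix b) = nth 0 (0 :: so3_parts w) b.
  by case: b => [|b] // b5; rewrite /so3_part inordK.
have KE b i j : (so3_part w b - w b) i j = so3_part w b i j - w b i j by rewrite !mxE.
move=> b i j; rewrite !KE; move: b i j.
elim/ord5_ind; elim/ord5_ind; elim/ord5_ind.
all: rewrite !pE// /so3_parts /= !so3mxE//=.
all: rewrite -?[w (ix _) (ix _) (ix _)]/(entry w _ _ _).
all: rewrite ?(entry0 _ _ wA) ?(entryA _ 2 1 wA) ?(entryA _ 3 1 wA) ?(entryA _ 4 1 wA)
      ?(entryA _ 5 1 wA) ?(entryA _ 3 2 wA) ?(entryA _ 4 2 wA) ?(entryA _ 5 2 wA)
      ?(entryA _ 4 3 wA) ?(entryA _ 5 3 wA) ?(entryA _ 5 4 wA)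
      ?(f112, f113, f114, f115, f134, f135, f145, f212, f213, f215, f234,
        f235, f245, f313, f314, f315, f324, f325, f345, f412, f414, f415, f425, f435, f515).
all: by rewrite -?/s; field: s2.
Qed.

End Model.

(** * Trilinear forms and their derivatives *)

Section Trilinear.
Variables (R : comNzRingType) (n : nat).
Implicit Types (T : 'I_n -> 'I_n -> 'I_n -> R) (u v w : 'cV[R]_n).

Definition trilin T u v w : R :=
  \sum_a \sum_b \sum_c T a b c * u a 0 * v b 0 * w c 0.

Lemma trilinD1 T u u' v w : trilin T (u + u') v w = trilin T u v w + trilin T u' v w.
Proof.
rewrite /trilin -big_split; apply: eq_bigr => a _; rewrite -big_split.
apply: eq_bigr => b _; rewrite -big_split; apply: eq_bigr => c _ /=.
by rewrite mxE; ring.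
Qed.

Lemma trilinD2 T u v v' w : trilin T u (v + v') w = trilin T u v w + trilin T u v' w.
Proof.
rewrite /trilin -big_split; apply: eq_bigr => a _; rewrite -big_split.
apply: eq_bigr => b _; rewrite -big_split; apply: eq_bigr => c _ /=.
by rewrite mxE; ring.
Qed.

Lemma trilinD3 T u v w w' : trilin T u v (w + w') = trilin T u v w + trilin T u v w'.
Proof.
rewrite /trilin -big_split; apply: eq_bigr => a _; rewrite -big_split.
apply: eq_bigr => b _; rewrite -big_split; apply: eq_bigr => c _ /=.
by rewrite mxE; ring.
Qed.

Lemma trilinZ T k l m u v w :
  trilin T (k *: u) (l *: v) (m *: w) = k * l * m * trilin T u v w.
Proof.
rewrite /trilin mulr_sumr; apply: eq_bigr => a _; rewrite mulr_sumr.
apply: eq_bigr => b _; rewrite mulr_sumr; apply: eq_bigr => c _.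
by rewrite !mxE; ring.
Qed.

(** The derivative at [v], in the direction [w], of the cubic form of [T]. *)
Definition polar T v w : R := trilin T w v v + trilin T v w v + trilin T v v w.

Lemma polarZ T v k w : polar T v (k *: w) = k * polar T v w.
Proof.
have Z u u' w' : trilin T (k *: u) u' w' = k * trilin T u u' w'.
  by rewrite -{1}[u']scale1r -{1}[w']scale1r trilinZ !mulr1.
have Z2 u u' w' : trilin T u (k *: u') w' = k * trilin T u u' w'.
  by rewrite -{1}[u]scale1r -{1}[w']scale1r trilinZ mul1r mulr1.
have Z3 u u' w' : trilin T u u' (k *: w') = k * trilin T u u' w'.
  by rewrite -{1}[u']scale1r -{1}[u]scale1r trilinZ !mul1r.
by rewrite /polar Z Z2 Z3 !mulrDr.
Qed.

Lemma polarD T v w w' : polar T v (w + w') = polar T v w + polar T v w'.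
Proof. by rewrite /polar trilinD1 trilinD2 trilinD3; ring. Qed.

Lemma polar0 T v : polar T v 0 = 0.
Proof. by rewrite -(scale0r 0) polarZ mul0r. Qed.

(** The polar form is determined by the cubic form. *)
Lemma polarE T v w : 2 * polar T v w =
  trilin T (v + w) (v + w) (v + w) + trilin T (w - v) (w - v) (w - v)
  - 2 * trilin T w w w.
Proof.
have N1 u u' w' : trilin T (- u) u' w' = - trilin T u u' w'.
  by apply/eqP; rewrite -addr_eq0 -trilinD1 addNr -(scale0r 0) -[u']scale1r
     -[w']scale1r trilinZ !mul0r.
have N2 u u' w' : trilin T u (- u') w' = - trilin T u u' w'.
  by apply/eqP; rewrite -addr_eq0 -trilinD2 addNr -(scale0r 0) -[u]scale1r
     -[w']scale1r trilinZ mulr0 !mul0r.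
have N3 u u' w' : trilin T u u' (- w') = - trilin T u u' w'.
  by apply/eqP; rewrite -addr_eq0 -trilinD3 addNr -(scale0r 0) -[u]scale1r
     -[u']scale1r trilinZ mulr0 mul0r.
by rewrite !trilinD1 !trilinD2 !trilinD3 !N1 !N2 !N3 /polar; ring.
Qed.

End Trilinear.

Section TrilinearBasis.
Variables (R : comNzRingType) (n : nat) (m : 'cV[R]_n -> 'cV[R]_n -> 'cV[R]_n -> R).
Hypothesis mL1 : forall k u u' v w, m (k *: u + u') v w = k * m u v w + m u' v w.
Hypothesis mL2 : forall k u v v' w, m u (k *: v + v') w = k * m u v w + m u v' w.
Hypothesis mL3 : forall k u v w w', m u v (k *: w + w') = k * m u v w + m u v w'.

Let lin_basis (f : 'cV[R]_n -> R) :
  (forall k u u', f (k *: u + u') = k * f u + f u') ->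
  forall u, f u = \sum_a f (delta_mx a 0) * u a 0.
Proof.
move=> fL u; have f0 : f 0 = 0.
  have := fL 1 0 0; rewrite scale1r addr0 mul1r => /eqP.
  by rewrite -subr_eq0 opprD addrA subrr add0r oppr_eq0 => /eqP.
rewrite {1}(_ : u = \sum_a u a 0 *: delta_mx a 0); last first.
  by rewrite {1}[u]matrix_sum_delta; apply: eq_bigr => a _; rewrite big_ord1.
elim/big_rec2 : _ => // a y z _ <-.
by rewrite fL mulrC.
Qed.

Lemma trilin_basis u v w :
  m u v w = trilin (fun a b c => m (delta_mx a 0) (delta_mx b 0) (delta_mx c 0)) u v w.
Proof.
rewrite (@lin_basis (fun u => m u v w))//; apply: eq_bigr => a _.
rewrite (@lin_basis (fun v => m _ v w))// mulr_suml; apply: eq_bigr => b _.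
rewrite (@lin_basis (fun w => m _ _ w))// !mulr_suml; apply: eq_bigr => c _.
by ring.
Qed.
End TrilinearBasis.

Lemma trilinL1 (R : comNzRingType) (n : nat) (T : 'I_n -> 'I_n -> 'I_n -> R) k u u' v w :
  trilin T (k *: u + u') v w = k * trilin T u v w + trilin T u' v w.
Proof. by rewrite trilinD1 -{1}[v]scale1r -{1}[w]scale1r trilinZ !mulr1. Qed.
Lemma trilinL2 (R : comNzRingType) (n : nat) (T : 'I_n -> 'I_n -> 'I_n -> R) k u v v' w :
  trilin T u (k *: v + v') w = k * trilin T u v w + trilin T u v' w.
Proof. by rewrite trilinD2 -{1}[u]scale1r -{1}[w]scale1r trilinZ mulr1 mul1r. Qed.
Lemma trilinL3 (R : comNzRingType) (n : nat) (T : 'I_n -> 'I_n -> 'I_n -> R) k u v w w' :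
  trilin T u v (k *: w + w') = k * trilin T u v w + trilin T u v w'.
Proof. by rewrite trilinD3 -{1}[u]scale1r -{1}[v]scale1r trilinZ !mul1r. Qed.

(** The change of coordinates of a covariant 3-tensor, as a substitution in its
    trilinear form. *)
Lemma trilin_mulmx (R : comNzRingType) (n p : nat)
    (T : 'I_n -> 'I_n -> 'I_n -> R) (J : 'M[R]_(n, p)) (u v w : 'cV[R]_p) :
  trilin T (J *m u) (J *m v) (J *m w) =
  trilin (fun a b c => \sum_q \sum_r \sum_t T q r t * J q a * J r b * J t c) u v w.
Proof.
rewrite (@trilin_basis _ _ (fun u v w => trilin T (J *m u) (J *m v) (J *m w))).
- by congr trilin; apply/funext => a; apply/funext => b; apply/funext => c;
    rewrite -!colE; do 3!(apply: eq_bigr => ? _); rewrite !mxE.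
- by move=> k u1 u2 v1 w1; rewrite mulmxDr -scalemxAr trilinL1.
- by move=> k u1 u2 v1 w1; rewrite mulmxDr -scalemxAr trilinL2.
- by move=> k u1 u2 v1 w1; rewrite mulmxDr -scalemxAr trilinL3.
Qed.

Section PartialMx.
Variables (R : realType) (n : nat).
Implicit Types (x : 'rV[R]_n) (l : 'I_n).

Definition differentiable_mx p q (A : 'rV[R]_n -> 'M[R]_(p, q)) x :=
  forall a b, differentiable (fun y => A y a b) x.

Lemma smooth_differentiable_mx p q D (A : 'rV[R]_n -> 'M[R]_(p, q)) x :
  smooth_mx_on D A -> D x -> differentiable_mx A x.
Proof. by move=> sA Dx a b; exact: smooth_on_differentiable (sA a b) Dx. Qed.

Lemma near_partial_mx p q l (A B : 'rV[R]_n -> 'M[R]_(p, q)) x :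
  (\near x, A x = B x) -> partial_mx l A x = partial_mx l B x.
Proof.
move=> AB; apply/matrixP => a b; rewrite !mxE; apply: near_partial.
by apply: filterS AB => y ->.
Qed.

Lemma partial_mx_tr p q l (A : 'rV[R]_n -> 'M[R]_(p, q)) x :
  partial_mx l (fun y => (A y)^T) x = (partial_mx l A x)^T.
Proof.
by apply/matrixP => a b; rewrite !mxE; congr partial; apply/funext => y; rewrite mxE.
Qed.

Lemma differentiable_mx_tr p q (A : 'rV[R]_n -> 'M[R]_(p, q)) x :
  differentiable_mx A x -> differentiable_mx (fun y => (A y)^T) x.
Proof.
move=> dA a b; rewrite (_ : (fun y => _) = (fun y => A y b a)) //.
by apply/funext => y; rewrite mxE.
Qed.

Lemma partial_mxM p q r l (A : 'rV[R]_n -> 'M[R]_(p, q)) (B : 'rV[R]_n -> 'M[R]_(q, r)) x :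
  differentiable_mx A x -> differentiable_mx B x ->
  differentiable_mx (fun y => A y *m B y) x /\
  partial_mx l (fun y => A y *m B y) x = partial_mx l A x *m B x + A x *m partial_mx l B x.
Proof.
move=> dA dB.
have E a b : (fun y => (A y *m B y) a b) = (fun y => \sum_j A y a j * B y j b).
  by apply/funext => y; rewrite mxE.
have dAB a b j : differentiable (fun y => A y a j * B y j b) x.
  exact: differentiableM.
split=> [a b|]; first by rewrite E; case: (partial_sum (index_enum _) l (dAB a b)).
apply/matrixP => a b; rewrite !mxE E.
have [_ ->] := partial_sum (index_enum _) l (dAB a b).
rewrite -big_split; apply: eq_bigr => j _ /=; rewrite partialM// !mxE.
by rewrite addrC [_ * partial _ _ _]mulrC mulrC [X in _ + X]mulrC.
Qed.

Lemma partial_trilin m l (T : 'rV[R]_n -> 'I_m -> 'I_m -> 'I_m -> R)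
    (u v w : 'rV[R]_n -> 'cV[R]_m) x :
  (forall a b c, differentiable (fun y => T y a b c) x) ->
  differentiable_mx u x -> differentiable_mx v x -> differentiable_mx w x ->
  partial l (fun y => trilin (T y) (u y) (v y) (w y)) x =
  trilin (fun a b c => partial l (fun y => T y a b c) x) (u x) (v x) (w x)
  + (trilin (T x) (partial_mx l u x) (v x) (w x)
     + trilin (T x) (u x) (partial_mx l v x) (w x)
     + trilin (T x) (u x) (v x) (partial_mx l w x)).
Proof.
move=> dT du dv dw.
have d1 a b c : differentiable (fun y => T y a b c * u y a 0) x by exact: differentiableM.
have d2 a b c : differentiable (fun y => T y a b c * u y a 0 * v y b 0) x.
  exact: differentiableM.
have d3 a b c : differentiable (fun y => T y a b c * u y a 0 * v y b 0 * w y c 0) x.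
  exact: differentiableM.
have S1 a b := partial_sum (index_enum 'I_m) l (d3 a b).
have S2 a := partial_sum (index_enum 'I_m) l (fun b => (S1 a b).1).
have [_ S3] := partial_sum (index_enum 'I_m) l (fun a => (S2 a).1).
rewrite /trilin S3 -!big_split; apply: eq_bigr => a _ /=.
rewrite (S2 a).2 -!big_split; apply: eq_bigr => b _ /=.
rewrite (S1 a b).2 -!big_split; apply: eq_bigr => c _ /=.
by rewrite !partialM// !mxE; ring.
Qed.

Lemma partial_cubic m l (T : 'rV[R]_n -> 'I_m -> 'I_m -> 'I_m -> R)
    (u : 'rV[R]_n -> 'cV[R]_m) x :
  (forall a b c, differentiable (fun y => T y a b c) x) -> differentiable_mx u x ->
  partial l (fun y => trilin (T y) (u y) (u y) (u y)) x =
  trilin (fun a b c => partial l (fun y => T y a b c) x) (u x) (u x) (u x)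
  + polar (T x) (u x) (partial_mx l u x).
Proof. by move=> dT du; rewrite (partial_trilin l dT du du du). Qed.

Lemma differentiable_mx_cst p q (A : 'M[R]_(p, q)) x : differentiable_mx (fun=> A) x.
Proof. by move=> a b; exact: differentiable_cst. Qed.

Lemma partial_mx_cst p q l (A : 'M[R]_(p, q)) x : partial_mx l (fun=> A) x = 0.
Proof. by apply/matrixP => a b; rewrite !mxE partial_cst. Qed.
End PartialMx.

(** * Compatible Christoffel symbols *)

Section MetricFacts.
Variables (R : realType) (n : nat) (M : manifold R n) (g : metric M).
Variables (i : atlas_index M) (x : 'rV[R]_n).
Hypothesis Dx : img i x.

Lemma gmx_unit : gmx g i x \in unitmx.
Proof.
rewrite -row_free_unit -kermx_eq0; apply/rowV0P => u /sub_kermxP ug0.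
apply/eqP/negPn/negP => u0.
have uT0 : u^T != 0 by apply: contra u0 => /eqP h; rewrite -[u]trmxK h trmx0.
by have := gmx_pos g Dx uT0; rewrite trmxK ug0 mul0mx mxE ltxx.
Qed.

Lemma gdotC u v : gdot g i x u v = gdot g i x v u.
Proof.
by rewrite /gdot -{2}(gmx_sym g Dx) -[in RHS](trmxK u) -!trmx_mul mulmxA [RHS]mxE.
Qed.

Lemma gdotDl u u' v : gdot g i x (u + u') v = gdot g i x u v + gdot g i x u' v.
Proof. by rewrite /gdot linearD !mulmxDl mxE. Qed.

Lemma gdotZl k u v : gdot g i x (k *: u) v = k * gdot g i x u v.
Proof. by rewrite /gdot linearZ -!scalemxAl mxE. Qed.

Lemma gdotDr u v v' : gdot g i x u (v + v') = gdot g i x u v + gdot g i x u v'.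
Proof. by rewrite gdotC gdotDl !(gdotC _ u). Qed.

Lemma gdotZr k u v : gdot g i x u (k *: v) = k * gdot g i x u v.
Proof. by rewrite gdotC gdotZl gdotC. Qed.

Lemma gdotNl u v : gdot g i x (- u) v = - gdot g i x u v.
Proof. by rewrite -scaleN1r gdotZl mulN1r. Qed.

Lemma gdotNr u v : gdot g i x u (- v) = - gdot g i x u v.
Proof. by rewrite gdotC gdotNl gdotC. Qed.

Lemma gdot_gt0 u : u != 0 -> 0 < gdot g i x u u.
Proof. exact: gmx_pos. Qed.

Lemma gdot_eq0 u : gdot g i x u u = 0 -> u = 0.
Proof. by move=> u0; apply/eqP/negPn/negP => /gdot_gt0; rewrite u0 ltxx. Qed.

Lemma gdot_sep u v : (forall w, gdot g i x w u = gdot g i x w v) -> u = v.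
Proof.
move=> uv; apply/eqP; rewrite -subr_eq0; apply/eqP/gdot_eq0.
by rewrite gdotDr gdotNr uv subrr.
Qed.

Let d l a b := partial l (fun y => gmx g i y a b) x.

Let d_sym l a b : d l a b = d l b a.
Proof.
apply: near_partial; apply: (near_in (@img_open _ _ M i) Dx) => y Dy.
by rewrite -{1}(gmx_sym g Dy) mxE.
Qed.

Lemma levi_civita_sym l k m : levi_civita g i x l k m = levi_civita g i x m k l.
Proof.
rewrite !mxE; congr (_ * _); apply: eq_bigr => p _; congr (_ * _).
by rewrite -!/(d _ _ _) (d_sym p l m) [d l p m + _]addrC.
Qed.

Lemma levi_civita_metric l :
  partial_mx l (gmx g i) x =
  (levi_civita g i x l)^T *m gmx g i x + gmx g i x *m levi_civita g i x l.
Proof.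
pose Q : 'M[R]_n := \matrix_(p, m) (2^-1 * (d l p m + d m p l - d p l m)).
have gLC : gmx g i x *m levi_civita g i x l = Q.
  have -> : levi_civita g i x l = invmx (gmx g i x) *m Q.
    apply/matrixP => k m; rewrite !mxE mulr_sumr; apply: eq_bigr => p _.
    by rewrite mxE mulrCA.
  by rewrite mulmxA mulmxV ?mul1mx ?gmx_unit.
rewrite -{1}(gmx_sym g Dx) -trmx_mul gLC; apply/matrixP => a b; rewrite !mxE.
rewrite -/(d l a b) (d_sym l b a) (d_sym b l a) (d_sym a l b) (d_sym a b l).
by rewrite (d_sym b a l); field.
Qed.

End MetricFacts.

Section TrilinearDelta.
Variables (R : comNzRingType) (n : nat) (T : 'I_n -> 'I_n -> 'I_n -> R).
Implicit Types (u : 'cV[R]_n) (a b c : 'I_n).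

Let sum_delta (F : 'I_n -> R) b : \sum_a F a * (delta_mx b 0 : 'cV[R]_n) a 0 = F b.
Proof.
rewrite (bigD1 b)//= mxE !eqxx mulr1 big1 ?addr0// => a ab.
by rewrite mxE (negPf ab) mulr0.
Qed.

Lemma trilin_delta1 u b c :
  trilin T u (delta_mx b 0) (delta_mx c 0) = \sum_a T a b c * u a 0.
Proof.
apply: eq_bigr => a _; under eq_bigr do rewrite sum_delta.
by rewrite sum_delta.
Qed.

Lemma trilin_delta2 u a c :
  trilin T (delta_mx a 0) u (delta_mx c 0) = \sum_b T a b c * u b 0.
Proof.
rewrite /trilin exchange_big; apply: eq_bigr => b _ /=.
under eq_bigr do rewrite sum_delta mulrAC.
by rewrite sum_delta.
Qed.

Lemma trilin_delta3 u a b :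
  trilin T (delta_mx a 0) (delta_mx b 0) u = \sum_c T a b c * u c 0.
Proof.
rewrite /trilin; under eq_bigr do rewrite exchange_big.
rewrite exchange_big; apply: eq_bigr => c _ /=.
under eq_bigr => a' _.
  under eq_bigr => b' _ do rewrite mulrAC.
  rewrite sum_delta mulrAC.
  over.
by rewrite sum_delta.
Qed.
End TrilinearDelta.

Section Pointwise.
Variables (R : realType) (M : manifold R 5) (S : so3_structure M).
Let g := so3_metric S.
Let Y := ups S.
Implicit Types (C : 'I_5 -> 'M[R]_5) (u v w : 'cV[R]_5).

Definition tors C u v : 'cV[R]_5 := along C u *m v - along C v *m u.

(** What it means at one point to be characteristic, without reference to a
    coframe: the metric and the structure tensor are parallel for the Christoffel
    symbols [C], and the torsion is totally skew. The tensor being symmetric, its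
    cubic form carries the second condition. *)
Definition compatible i x C : Prop :=
  [/\ forall l, partial_mx l (gmx g i) x = (C l)^T *m gmx g i x + gmx g i x *m C l,
      forall l v, trilin (fun a b c => partial l (fun y => tcoef Y i y a b c) x) v v v
        = polar (tcoef Y i x) v (C l *m v)
    & forall u v w, gdot g i x w (tors C u v) = - gdot g i x v (tors C u w)].

Lemma alongB C C' v : along (fun l => C l - C' l) v = along C v - along C' v.
Proof.
by rewrite /along -sumrB; apply: eq_bigr => l _; rewrite scalerBr.
Qed.

Lemma along_mulE C u v k :
  (along C u *m v) k 0 = \sum_l \sum_m C l k m * (u l 0 * v m 0).
Proof.
rewrite mxE /along exchange_big; apply: eq_bigr => m _.
rewrite summxE mulr_suml; apply: eq_bigr => l _.
by rewrite mxE; ring.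
Qed.

Lemma tors_levi_civita i x u v : img i x -> tors (levi_civita g i x) u v = 0.
Proof.
move=> Dx; apply/eqP; rewrite subr_eq0; apply/eqP/matrixP => k j; rewrite ord1 {j}.
rewrite !along_mulE exchange_big; apply: eq_bigr => m _; apply: eq_bigr => l _.
by rewrite levi_civita_sym//; ring.
Qed.

Lemma gdot_anti i x (A : 'M[R]_5) u v : img i x ->
  A^T *m gmx g i x + gmx g i x *m A = 0 ->
  gdot g i x u (A *m v) = - gdot g i x v (A *m u).
Proof.
move=> Dx /eqP; rewrite addr_eq0 => /eqP E.
rewrite (gdotC g Dx v) /gdot trmx_mul -!mulmxA [A^T *m _]mulmxA E.
by rewrite mulNmx mulmxN [in RHS]mxE opprK !mulmxA.
Qed.

Lemma along_anti (gx : 'M[R]_5) C u :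
  (forall l, (C l)^T *m gx + gx *m C l = 0) ->
  (along C u)^T *m gx + gx *m along C u = 0.
Proof.
move=> CA; rewrite /along linear_sum mulmx_suml mulmx_sumr -big_split big1// => l _.
by rewrite linearZ /= -scalemxAl -scalemxAr -scalerDr CA scaler0.
Qed.

(** Skew torsion makes the difference with the Levi-Civita connection totally
    skew, so the two connections have the same autoparallels. *)
Lemma compatible_autoparallel i x C v : img i x -> compatible i x C ->
  along C v *m v = along (levi_civita g i x) v *m v.
Proof.
move=> Dx [Cg _ Ct]; set LC := levi_civita g i x.
pose K l := C l - LC l.
have KA l : (K l)^T *m gmx g i x + gmx g i x *m K l = 0.
  have := Cg l; rewrite levi_civita_metric// -/LC => E.
  rewrite /K linearB mulmxBl mulmxBr addrACA -opprD -E; exact: subrr.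
have kA a b c : gdot g i x b (along K a *m c) = - gdot g i x c (along K a *m b).
  by apply: gdot_anti => //; apply: along_anti.
have tK a b : tors C a b = along K a *m b - along K b *m a.
  have := tors_levi_civita a b Dx; rewrite -/LC /tors /K !alongB !mulmxBl => /eqP.
  by rewrite subr_eq0 => /eqP ->; rewrite opprB addrA subrK.
apply/eqP; rewrite -subr_eq0 -mulmxBl -alongB -/K; apply/eqP.
apply: (gdot_sep (g := g) Dx) => w; transitivity (0 : R); last by rewrite /gdot mulmx0 mxE.
have := Ct v v w; rewrite !tK !(gdotDr _ Dx) !(gdotNr _ Dx).
have kw : gdot g i x v (along K w *m v) = 0 by have := kA w v v; lra.
by have := kA v w v; rewrite kw; lra.
Qed.

(** Summing the covariant derivative of the tensor against [v] four times leaves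
    the derivative of the cubic form along [v] and one correction, in which the
    connection occurs only through its value at [v] applied to [v]. *)
Lemma nearly_integrableE i x v :
  \sum_l \sum_a \sum_b \sum_c
      nablaLC g Y i x l a b c * v l 0 * v a 0 * v b 0 * v c 0
  = \sum_l v l 0 * trilin (fun a b c => partial l (fun y => tcoef Y i y a b c) x) v v v
    - polar (tcoef Y i x) v (along (levi_civita g i x) v *m v).
Proof.
set LC := levi_civita g i x; set T := tcoef Y i x.
have -> : polar T v (along LC v *m v) = \sum_l v l 0 * polar T v (LC l *m v).
  rewrite /along mulmx_suml; elim/big_rec2 : _ => [|l y z _ <-].
    by rewrite polar0.
  by rewrite polarD -scalemxAl polarZ.
rewrite -sumrB; apply: eq_bigr => l _; rewrite -mulrBr /polar.
have E1 : trilin T (LC l *m v) v v =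
    trilin (fun a b c => \sum_m LC l m a * T m b c) v v v.
  rewrite (@trilin_basis _ _ (fun u => trilin T (LC l *m u))).
  - congr trilin; apply/funext => a; apply/funext => b; apply/funext => c.
    by rewrite -colE trilin_delta1; apply: eq_bigr => m _; rewrite mxE mulrC.
  - by move=> *; rewrite mulmxDr -scalemxAr trilinL1.
  - by move=> *; rewrite trilinL2.
  - by move=> *; rewrite trilinL3.
have E2 : trilin T v (LC l *m v) v =
    trilin (fun a b c => \sum_m LC l m b * T a m c) v v v.
  rewrite (@trilin_basis _ _ (fun u v => trilin T u (LC l *m v))).
  - congr trilin; apply/funext => a; apply/funext => b; apply/funext => c.
    by rewrite -colE trilin_delta2; apply: eq_bigr => m _; rewrite mxE mulrC.
  - by move=> *; rewrite trilinL1.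
  - by move=> *; rewrite mulmxDr -scalemxAr trilinL2.
  - by move=> *; rewrite trilinL3.
have E3 : trilin T v v (LC l *m v) =
    trilin (fun a b c => \sum_m LC l m c * T a b m) v v v.
  rewrite (@trilin_basis _ _ (fun u v w => trilin T u v (LC l *m w))).
  - congr trilin; apply/funext => a; apply/funext => b; apply/funext => c.
    by rewrite -colE trilin_delta3; apply: eq_bigr => m _; rewrite mxE mulrC.
  - by move=> *; rewrite trilinL1.
  - by move=> *; rewrite trilinL2.
  - by move=> *; rewrite mulmxDr -scalemxAr trilinL3.
rewrite E1 E2 E3 /trilin -!big_split -sumrB mulr_sumr; apply: eq_bigr => a _ /=.
rewrite -!big_split -sumrB mulr_sumr; apply: eq_bigr => b _ /=.
rewrite -!big_split -sumrB mulr_sumr; apply: eq_bigr => c _ /=.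
rewrite /nablaLC -/LC !big_split /=; ring.
Qed.

(** By [compatible_autoparallel] the correction term may be computed with [C], for
    which the cubic form is parallel in every direction. *)
Lemma compatible_nearly_integrable i x C : img i x -> compatible i x C ->
  forall v, \sum_l \sum_a \sum_b \sum_c
      nablaLC g Y i x l a b c * v l 0 * v a 0 * v b 0 * v c 0 = 0.
Proof.
move=> Dx Ccomp v; rewrite nearly_integrableE -(compatible_autoparallel v Dx Ccomp).
case: Ccomp => _ CY _; rewrite /along mulmx_suml.
apply/eqP; rewrite subr_eq0; apply/eqP.
elim/big_rec2 : _ => [|l y z _ ->]; first by rewrite polar0.
by rewrite polarD -scalemxAl polarZ CY.
Qed.

Section InFrame.
Variables (i : atlas_index M) (V : set 'rV[R]_5) (th : 'rV[R]_5 -> 'M[R]_5).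
Hypothesis adapted : adapted_coframe S i V th.
Variable x : 'rV[R]_5.
Hypothesis Vx : V x.
Let Dx : img i x. Proof. by case: adapted => _ Vi _ _ _; exact: Vi. Qed.
Let th_diff : differentiable_mx th x.
Proof. by case: adapted => _ _ sth _ _; exact: smooth_differentiable_mx sth Vx. Qed.
Let near_V : forall P : set 'rV[R]_5, (forall y, V y -> P y) -> \near x, P x.
Proof. by case: adapted => oV _ _ _ _ P; exact: (near_in oV Vx). Qed.

Lemma coframe_unit : th x \in unitmx.
Proof.
case: adapted => _ _ _ thg _; have := gmx_unit g Dx.
by rewrite -(thg _ Vx) unitmx_mul => /andP[].
Qed.
Let thu := coframe_unit.

Definition frame_conn C l : 'M[R]_5 := (th x *m C l - partial_mx l th x) *m invmx (th x).

Lemma frame_connE C l : th x *m C l = frame_conn C l *m th x + partial_mx l th x.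
Proof. by rewrite /frame_conn mulmxKV// subrK. Qed.

Lemma partial_gmx l : partial_mx l (gmx g i) x =
  (partial_mx l th x)^T *m th x + (th x)^T *m partial_mx l th x.
Proof.
case: adapted => _ _ _ thg _.
rewrite -(near_partial_mx l (A := fun y => (th y)^T *m th y)); last exact: near_V.
have [_ ->] := partial_mxM l (differentiable_mx_tr th_diff) th_diff.
by rewrite partial_mx_tr.
Qed.

(** Differentiating [g = th^T th] puts the derivative of the coframe on both sides,
    where it cancels. *)
Lemma frame_conn_anti C l :
  (partial_mx l (gmx g i) x = (C l)^T *m gmx g i x + gmx g i x *m C l) <->
  (frame_conn C l)^T = - frame_conn C l.
Proof.
set A := frame_conn C l; set dth := partial_mx l th x.
have gE : gmx g i x = (th x)^T *m th x by case: adapted => _ _ _ thg _; rewrite thg.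
have -> : (C l)^T *m gmx g i x + gmx g i x *m C l =
    (th x)^T *m (A^T + A) *m th x + (dth^T *m th x + (th x)^T *m dth).
  rewrite gE mulmxA -trmx_mul -[_ *m th x *m C l]mulmxA frame_connE -/A -/dth.
  rewrite linearD /= trmx_mul mulmxDl [in LHS]mulmxDr [in RHS]mulmxDr mulmxDl !mulmxA.
  exact: addrACA.
rewrite partial_gmx -/dth -{1}[X in X = _]add0r; split=> [/addIr E|->].
  have : A^T + A = 0.
    have := congr1 (fun B => invmx (th x)^T *m (B *m invmx (th x))) E.
    rewrite mul0mx mulmx0 mulmxK// mulmxA mulVmx ?unitmx_tr// mul1mx.
    by move=> <-.
  by move/eqP; rewrite addr_eq0 => /eqP.
by rewrite addNr mulmx0 mul0mx.
Qed.

Lemma ups3_trilin u v w : ups3 u v w =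
  trilin (fun a b c => ups3 (delta_mx a 0) (delta_mx b 0) (delta_mx c 0)) u v w.
Proof.
have L1 k u1 u2 v1 w1 : ups3 (k *: u1 + u2) v1 w1 = k * ups3 u1 v1 w1 + ups3 u2 v1 w1.
  by rewrite ups3D1 ups3Z1.
have L2 k u1 u2 v1 w1 : ups3 v1 (k *: u1 + u2) w1 = k * ups3 v1 u1 w1 + ups3 v1 u2 w1.
  by rewrite !(ups3C v1) L1.
apply: trilin_basis => // k u1 v1 w1 w2.
by rewrite (ups3CA _ v1) L2 (ups3CA _ w1) (ups3CA _ w2).
Qed.

Lemma polar_ups3 v w :
  polar (fun a b c => ups3 (delta_mx a 0) (delta_mx b 0) (delta_mx c 0)) v w
  = 3 * ups3 v v w.
Proof.
by rewrite /polar -!ups3_trilin [ups3 w v v]ups3C [ups3 v w v]ups3CA; ring.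
Qed.

Lemma polar_coframe v w :
  polar (tcoef Y i x) v w = 3 * ups3 (th x *m v) (th x *m v) (th x *m w).
Proof.
case: adapted => _ _ _ _ thY.
have Y3 u : trilin (tcoef Y i x) u u u = ups3 (th x *m u) (th x *m u) (th x *m u).
  by rewrite ups3_diag -(thY _ Vx).
apply: (@mulfI _ 2); first by rewrite pnatr_eq0.
rewrite polarE !Y3 mulmxDr mulmxBr -scaleN1r.
move: (th x *m v) (th x *m w) => p q.
have Z2 a b c : ups3 a (-1 *: b) c = - ups3 a b c by rewrite ups3C ups3Z1 mulN1r ups3C.
have Z3 a b c : ups3 a b (-1 *: c) = - ups3 a b c by rewrite ups3CA Z2 ups3CA.
have D2 a b b' c : ups3 a (b + b') c = ups3 a b c + ups3 a b' c.
  by rewrite ups3C ups3D1 !(ups3C _ a).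
rewrite !ups3D1 !D2 !ups3D3 !ups3Z1 !Z2 !Z3.
rewrite [ups3 p q p]ups3CA [ups3 q p p]ups3C [ups3 p q p]ups3CA.
rewrite [ups3 q p q]ups3C [ups3 q q p]ups3CA [ups3 q p q]ups3C.
by ring.
Qed.

Lemma partial_cubic_coframe l v :
  trilin (fun a b c => partial l (fun y => tcoef Y i y a b c) x) v v v =
  3 * ups3 (th x *m v) (th x *m v) (partial_mx l th x *m v).
Proof.
pose U (a b c : 'I_5) : R := ups3 (delta_mx a 0) (delta_mx b 0) (delta_mx c 0).
have dY a b c : differentiable (fun y => tcoef Y i y a b c) x.
  by apply: smooth_on_differentiable Dx; exact: tcoef_smooth.
have dv := @differentiable_mx_cst _ 5 _ _ v x.
have [dthv pthv] := partial_mxM l th_diff dv.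
have dU a b c : differentiable (fun _ : 'rV[R]_5 => U a b c) x.
  exact: differentiable_cst.
have := partial_cubic l dY dv; rewrite partial_mx_cst polar0 addr0 => <-.
have -> : partial l (fun y => trilin (tcoef Y i y) v v v) x =
    partial l (fun y => trilin U (th y *m v) (th y *m v) (th y *m v)) x.
  apply: near_partial; apply: near_V => y Vy.
  by case: adapted => _ _ _ _ thY; rewrite -ups3_trilin ups3_diag -(thY _ Vy).
rewrite (partial_cubic l dU dthv) pthv partial_mx_cst mulmx0 addr0 polar_ups3.
rewrite [X in X + _](_ : _ = 0) ?add0r// /trilin.
by do 3!(rewrite big1// => ? _); rewrite partial_cst !mul0r.
Qed.

(** In an adapted coframe the cubic form has constant coefficients, so it is
    parallel iff the connection matrices annihilate it. *)
Lemma frame_conn_stab C l :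
  (forall v, trilin (fun a b c => partial l (fun y => tcoef Y i y a b c) x) v v v
        = polar (tcoef Y i x) v (C l *m v)) <->
  (forall u, ups3 u u (frame_conn C l *m u) = 0).
Proof.
have E v : polar (tcoef Y i x) v (C l *m v)
    - trilin (fun a b c => partial l (fun y => tcoef Y i y a b c) x) v v v
    = 3 * ups3 (th x *m v) (th x *m v) (frame_conn C l *m (th x *m v)).
  rewrite partial_cubic_coframe polar_coframe mulmxA frame_connE -mulrBr; congr (_ * _).
  by rewrite mulmxDl ups3D3 addrK mulmxA.
split=> [CY u|A0 v]; last first.
  by apply/esym/eqP; rewrite -subr_eq0 E A0 mulr0.
have := E (invmx (th x) *m u); rewrite CY subrr mulKVmx// => /esym/eqP.
by rewrite mulf_eq0 pnatr_eq0 => /eqP.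
Qed.

Lemma frame_conn_so3 C l :
  (partial_mx l (gmx g i) x = (C l)^T *m gmx g i x + gmx g i x *m C l /\
   forall v, trilin (fun a b c => partial l (fun y => tcoef Y i y a b c) x) v v v
        = polar (tcoef Y i x) v (C l *m v)) <->
  (exists c1 c2 c3, frame_conn C l = so3mx c1 c2 c3).
Proof.
split=> [[/frame_conn_anti A /frame_conn_stab A0]|[c1 [c2 [c3 E]]]].
  exact: stabilizer.
split; first by apply/frame_conn_anti; rewrite E so3mx_anti.
by apply/frame_conn_stab => u; rewrite E so3mx_stab.
Qed.

End InFrame.
End Pointwise.

(** * Connections in an adapted coframe *)

Section Along.
Variable R : realType.
Implicit Types (C W : 'I_5 -> 'M[R]_5) (u v : 'cV[R]_5).

Lemma mulmx_alongl (A : 'M[R]_5) C u :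
  A *m along C u = along (fun l => A *m C l) u.
Proof.
by rewrite /along mulmx_sumr; apply: eq_bigr => l _; rewrite -scalemxAr.
Qed.

Lemma mulmx_alongr (A : 'M[R]_5) C u :
  along C u *m A = along (fun l => C l *m A) u.
Proof.
by rewrite /along mulmx_suml; apply: eq_bigr => l _; rewrite -scalemxAl.
Qed.

Lemma along_mulmx (A : 'M[R]_5) C u :
  along C (A *m u) = along (fun b => along C (col b A)) u.
Proof.
rewrite /along; under [RHS]eq_bigr => b _ do rewrite scaler_sumr.
rewrite exchange_big; apply: eq_bigr => l _.
rewrite mxE scaler_suml; apply: eq_bigr => b _.
by rewrite !mxE scalerA mulrC.
Qed.

Lemma alongZ C k u : along C (k *: u) = k *: along C u.
Proof.
by rewrite /along scaler_sumr; apply: eq_bigr => l _; rewrite mxE scalerA.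
Qed.

Lemma along_so3 C u : (forall l, exists c1 c2 c3, C l = so3mx c1 c2 c3) ->
  exists c1 c2 c3, along C u = so3mx c1 c2 c3.
Proof.
move=> Cso; rewrite /along; elim/big_rec : _ => [|l A _ [a1 [a2 [a3 ->]]]].
  by exists 0, 0, 0; rewrite so3mx0.
have [c1 [c2 [c3 ->]]] := Cso l.
exists (u l 0 * c1 + a1), (u l 0 * c2 + a2), (u l 0 * c3 + a3).
by rewrite /so3mx !scalerDl !scalerDr !scalerA addrACA [X in X + _ = _]addrACA.
Qed.

Lemma along_tr C u : (forall l, (C l)^T = - C l) -> (along C u)^T = - along C u.
Proof.
move=> CA; rewrite /along linear_sum -sumrN; apply: eq_bigr => l _.
by rewrite linearZ /= CA scalerN.
Qed.

Definition totally_skew W := forall b i j, W b i j = - W i b j.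

Lemma skew_along W u v w : totally_skew W ->
  w^T *m (along W u *m v) = - (u^T *m (along W w *m v)).
Proof.
have E (a b c : 'cV[R]_5) : a^T *m (along W b *m c) =
   (\sum_i \sum_l \sum_m W l i m * (a i 0 * b l 0 * c m 0))%:M.
  apply/matrixP => p q; rewrite !ord1 mxE [RHS]mxE eqxx mulr1n.
  apply: eq_bigr => i _; rewrite along_mulE mulr_sumr mxE; apply: eq_bigr => l _.
  by rewrite mulr_sumr; apply: eq_bigr => m _; ring.
move=> WS; rewrite !E -scalemx1 -[X in - X]scalemx1 -scaleNr; congr (_ *: _).
rewrite exchange_big -sumrN; apply: eq_bigr => l _; rewrite -sumrN.
apply: eq_bigr => i _; rewrite -sumrN; apply: eq_bigr => m _.
by rewrite WS; ring.
Qed.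

Lemma anti_along W u v w : (forall l, (W l)^T = - W l) ->
  w^T *m (along W u *m v) = - (v^T *m (along W u *m w)).
Proof.
move=> WA; have T (X : 'M[R]_1) : X^T = X.
  by apply/matrixP => p q; rewrite !ord1 mxE.
rewrite -[LHS]T !trmx_mul trmxK along_tr// mulmxN mulNmx.
by rewrite -mulmxA.
Qed.
End Along.

Section InFrame.
Variables (R : realType) (M : manifold R 5) (S : so3_structure M).
Let g := so3_metric S.
Let Y := ups S.
Implicit Types (C : 'I_5 -> 'M[R]_5) (u v w : 'cV[R]_5).
Variables (i : atlas_index M) (V : set 'rV[R]_5) (th : 'rV[R]_5 -> 'M[R]_5).
Hypothesis adapted : adapted_coframe S i V th.
Variable x : 'rV[R]_5.
Hypothesis Vx : V x.
Let Dx : img i x. Proof. by case: adapted => _ Vi _ _ _; exact: Vi. Qed.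
Let thu : th x \in unitmx := coframe_unit adapted Vx.
Let E := invmx (th x).

(** The connection matrices of the coframe, evaluated on the dual frame: the
    components with three frame indices, to which the algebra of the model form
    applies. *)
Definition frame_comp C b : 'M[R]_5 := along (frame_conn th x C) (col b E).

Lemma along_frame C u : along (frame_conn th x C) u = along (frame_comp C) (th x *m u).
Proof. by rewrite -{1}[u](mulKmx thu); exact: along_mulmx. Qed.

(** The derivative of the coframe cancels in a difference of connections, which is
    a tensor. *)
Lemma coframe_tors C C' u v :
  let W := along (fun b => frame_comp C b - frame_comp C' b) in
  th x *m (tors C u v - tors C' u v) =
  W (th x *m u) *m (th x *m v) - W (th x *m v) *m (th x *m u).
Proof.
have A a b : th x *m (along C a *m b - along C' a *m b) =
   along (fun b => frame_comp C b - frame_comp C' b) (th x *m a) *m (th x *m b).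
  rewrite -mulmxBl -alongB [LHS]mulmxA mulmx_alongl [in RHS]alongB -!along_frame -[in RHS]alongB.
  rewrite [RHS]mulmxA mulmx_alongr; congr (along _ a *m b); apply/funext => l.
  rewrite mulmxBr mulmxBl (frame_connE adapted Vx C) (frame_connE adapted Vx C').
  by rewrite opprD addrACA subrr addr0.
rewrite /= -!A -mulmxBr /tors; congr (_ *m _).
by rewrite !opprD !opprK addrACA.
Qed.

Lemma gdot_coframe u v : gdot g i x u v = ((th x *m u)^T *m (th x *m v)) 0 0.
Proof.
by case: adapted => _ _ _ thg _; rewrite /gdot -(thg _ Vx) trmx_mul !mulmxA.
Qed.

Let frame_e b : th x *m col b E = delta_mx b 0.
Proof. by rewrite colE mulmxA mulmxV// mul1mx. Qed.

Lemma torsionE (G : connection M) a b c : torsion G i th x a b c =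
  gdot g i x (col a E) (tors (ccoef G i x) (col b E) (col c E)).
Proof.
rewrite gdot_coframe frame_e trmx_delta -rowE mxE mulmxBr.
have subE (A B : 'cV[R]_5) : (A - B) a 0 = A a 0 - B a 0 by rewrite !mxE.
rewrite subE.
have H u v : (th x *m (along (ccoef G i x) u *m v)) a 0 =
    \sum_k \sum_l (th x *m ccoef G i x k) a l * (u k 0 * v l 0).
  by rewrite mulmxA mulmx_alongl along_mulE.
rewrite !H [X in _ - X]exchange_big -sumrB; apply: eq_bigr => k _.
rewrite -sumrB; apply: eq_bigr => l _.
have tf : torsion_form G i th x a k l =
    (th x *m ccoef G i x k) a l - (th x *m ccoef G i x l) a k.
  have SE k' l' : \sum_b conn_form G i th x k' a b * th x b l' =
      (frame_conn th x (ccoef G i x) k' *m th x) a l' by rewrite mxE.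
  have addE (A B : 'M[R]_5) l' : (A + B) a l' = A a l' + B a l' by rewrite mxE.
  rewrite (frame_connE adapted Vx _ k) (frame_connE adapted Vx _ l) !addE.
  by rewrite /torsion_form sumrB !SE; ring.
by rewrite tf ![col _ _ _ _]mxE -/E; ring.
Qed.

(** Skewness of the torsion in a frame is skewness of the trilinear form that
    the metric makes of the torsion. *)
Lemma torsion_skewP (G : connection M) :
  (forall a b c, torsion G i th x a b c = - torsion G i th x b a c
    /\ torsion G i th x a b c = - torsion G i th x a c b) <->
  (forall u v w, gdot g i x w (tors (ccoef G i x) u v) =
    - gdot g i x v (tors (ccoef G i x) u w)).
Proof.
set C := ccoef G i x.
have torsC u v : tors C u v = - tors C v u by rewrite /tors opprB.
split=> [skew u v w|skew a b c]; last first.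
  have T2 : torsion G i th x a b c = - torsion G i th x a c b.
    by rewrite !torsionE torsC (gdotNr _ Dx).
  split=> //.
  rewrite !torsionE -/C (skew (col b E) (col c E) (col a E)).
  rewrite (skew (col a E) (col c E) (col b E)) (torsC (col a E)).
  by rewrite (gdotNr _ Dx) opprK.
pose m w u v := gdot g i x (E *m w) (tors C (E *m u) (E *m v)).
have mL3 k w1 u1 v1 v2 : m w1 u1 (k *: v1 + v2) = k * m w1 u1 v1 + m w1 u1 v2.
  rewrite /m -(gdotZr _ Dx) -(gdotDr _ Dx); congr (gdot g i x _ _).
  rewrite /tors mulmxDr -scalemxAr alongD alongZ mulmxDr -scalemxAr mulmxDl.
  by rewrite -scalemxAl scalerBr addrACA opprD.
have mL2 k w1 u1 u2 v1 : m w1 (k *: u1 + u2) v1 = k * m w1 u1 v1 + m w1 u2 v1.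
  have mC w' u' v' : m w' u' v' = - m w' v' u'.
    by rewrite /m torsC (gdotNr _ Dx).
  by rewrite mC mL3 (mC _ u1) (mC _ u2); ring.
have mL1 k w1 w2 u1 v1 : m (k *: w1 + w2) u1 v1 = k * m w1 u1 v1 + m w2 u1 v1.
  by rewrite /m mulmxDr -scalemxAr gdotDl gdotZl.
have mT a b c : m (delta_mx a 0) (delta_mx b 0) (delta_mx c 0) = torsion G i th x a b c.
  by rewrite /m torsionE !colE.
have mE w' u' v' : m w' u' v' = trilin (torsion G i th x) w' u' v'.
  rewrite (trilin_basis mL1 mL2 mL3); congr trilin.
  by do 3!(apply/funext => ?); rewrite mT.
rewrite -[w](mulKmx thu) -[v](mulKmx thu) -[u](mulKmx thu) -!/(m _ _ _) !mE.
move: (th x *m u) (th x *m v) (th x *m w) => u' v' w'.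
rewrite /trilin -sumrN exchange_big /=.
under [RHS]eq_bigr do rewrite -sumrN.
rewrite [RHS]exchange_big; apply: eq_bigr => b _ /=.
under [RHS]eq_bigr do rewrite -sumrN.
rewrite [RHS]exchange_big /=; apply: eq_bigr => a _; apply: eq_bigr => c _.
have -> : torsion G i th x c b a = - torsion G i th x a b c; last by ring.
by rewrite (skew c b a).2 (skew c a b).1 opprK (skew a c b).2.
Qed.
End InFrame.

(** * Uniqueness and existence in an adapted coframe *)

Lemma so3mxB (R : realType) (c1 c2 c3 d1 d2 d3 : R) :
  so3mx c1 c2 c3 - so3mx d1 d2 d3 = so3mx (c1 - d1) (c2 - d2) (c3 - d3).
Proof.
by rewrite /so3mx !scalerBl !opprD addrACA [X in X + _ = _]addrACA.
Qed.

(** The symbols whose connection form is the [so(3)]-part of the Levi-Civita form,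
    brought back from the coframe to the chart. *)
Definition frame_char (R : realType) (M : manifold R 5) (S : so3_structure M)
    (i : atlas_index M) (th : 'rV[R]_5 -> 'M[R]_5) (x : 'rV[R]_5) (l : 'I_5) : 'M[R]_5 :=
  let LC := levi_civita (so3_metric S) i x in
  invmx (th x) *m
    (along (so3_part (frame_comp th x LC)) (col l (th x)) *m th x + partial_mx l th x).

Section InFrame.
Variables (R : realType) (M : manifold R 5) (S : so3_structure M).
Let g := so3_metric S.
Let Y := ups S.
Implicit Types (C : 'I_5 -> 'M[R]_5) (u v w : 'cV[R]_5).
Variables (i : atlas_index M) (V : set 'rV[R]_5) (th : 'rV[R]_5 -> 'M[R]_5).
Hypothesis adapted : adapted_coframe S i V th.

Section AtPoint.
Variable x : 'rV[R]_5.
Hypothesis Vx : V x.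
Let Dx : img i x. Proof. by case: adapted => _ Vi _ _ _; exact: Vi. Qed.
Let thu : th x \in unitmx := coframe_unit adapted Vx.
Let E := invmx (th x).

Lemma compatible_frameP C : compatible S i x C <->
  (forall l, exists c1 c2 c3, frame_conn th x C l = so3mx c1 c2 c3) /\
  (forall u v w, gdot g i x w (tors C u v) = - gdot g i x v (tors C u w)).
Proof.
split=> [[Cg CY Ct]|[Cso Ct]].
  by split=> // l; apply/(frame_conn_so3 adapted Vx); split; [exact: Cg|exact: CY].
by split=> // l; have [] := (frame_conn_so3 adapted Vx C l).2 (Cso l).
Qed.

Lemma characteristic_compatible (G : connection M) :
  (forall l, exists c1 c2 c3, conn_form G i th x l = c1 *: E1 R + c2 *: E2 R + c3 *: E3 R) /\
  (forall a b c, torsion G i th x a b c = - torsion G i th x b a c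
    /\ torsion G i th x a b c = - torsion G i th x a c b) <->
  compatible S i x (ccoef G i x).
Proof.
split=> [[Gso Gt]|/compatible_frameP[Gso Gt]].
  by apply/compatible_frameP; split => //; apply/(torsion_skewP adapted Vx).
by split => //; apply/(torsion_skewP adapted Vx).
Qed.

Let along_col (A : 'M[R]_5) C b : along (fun l => along C (col l A)) b = along C (A *m b).
Proof. by rewrite along_mulmx. Qed.

Lemma frame_comp_eq C C' : (forall b, frame_comp th x C b = frame_comp th x C' b) ->
  forall l, C l = C' l.
Proof.
move=> W0 l; have := along_frame adapted Vx C (delta_mx l 0).
rewrite (_ : along (frame_comp th x C) = along (frame_comp th x C')); last first.
  by congr along; apply/funext.
rewrite -(along_frame adapted Vx) !along_delta => fE.
have := frame_connE adapted Vx C l; rewrite fE -(frame_connE adapted Vx C') => thE.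
by rewrite -[C l](mulKmx thu) thE mulKmx.
Qed.

Lemma frame_comp_so3 C : (forall l, exists c1 c2 c3, frame_conn th x C l = so3mx c1 c2 c3) ->
  forall b, exists c1 c2 c3, frame_comp th x C b = so3mx c1 c2 c3.
Proof. by move=> Cso b; exact: along_so3. Qed.

(** A difference of two compatible connections is an [so(3)]-valued 1-form which
    is totally skew; there is none but zero. *)
Lemma compatible_unique C C' : compatible S i x C -> compatible S i x C' ->
  forall l, C l = C' l.
Proof.
move=> /compatible_frameP[Cso Ct] /compatible_frameP[C'so C't].
pose W b := frame_comp th x C b - frame_comp th x C' b.
have Wso b : exists c1 c2 c3, W b = so3mx c1 c2 c3.
  have [c1 [c2 [c3 e]]] := frame_comp_so3 Cso b.
  have [d1 [d2 [d3 e']]] := frame_comp_so3 C'so b.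
  by exists (c1 - d1), (c2 - d2), (c3 - d3); rewrite /W e e' so3mxB.
have WA b : (W b)^T = - W b.
  by have [c1 [c2 [c3 ->]]] := Wso b; exact: so3mx_anti.
apply: frame_comp_eq => b; apply/eqP; rewrite -subr_eq0 -/(W b); apply/eqP.
apply: so3_skew0 => // {}b k j.
have D u v w : gdot g i x w (tors C u v - tors C' u v) =
    - gdot g i x v (tors C u w - tors C' u w).
  have B a p q : gdot g i x a (p - q) = gdot g i x a p - gdot g i x a q.
    by rewrite (gdotDr _ Dx) (gdotNr _ Dx).
  by rewrite (B w) (B v) (Ct u v w) (C't u v w) opprD.
have := D (E *m delta_mx j 0) (E *m delta_mx b 0) (E *m delta_mx k 0).
rewrite !(gdot_coframe adapted Vx) !(coframe_tors adapted Vx) -!/W !mulKVmx//.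
rewrite !along_delta.
have WE p (A : 'M[R]_5) r :
  ((delta_mx p 0 : 'cV[R]_5)^T *m (A *m (delta_mx r 0 : 'cV[R]_5))) 0 0 = A p r.
  by rewrite trmx_delta -colE -rowE !mxE.
have mxB (A B : 'M[R]_1) : (A - B) 0 0 = A 0 0 - B 0 0 by rewrite !mxE.
rewrite !mulmxBr !mxB !WE.
have WA' q p r : W q p r = - W q r p by rewrite -{1}[W q]opprK -WA !mxE.
by rewrite (WA' j b k) => h; lra.
Qed.

Hypothesis ni : forall v, \sum_l \sum_a \sum_b \sum_c
      nablaLC g Y i x l a b c * v l 0 * v a 0 * v b 0 * v c 0 = 0.

Let LC := levi_civita g i x.
Let W := frame_comp th x LC.

Let LC_anti l : (frame_conn th x LC l)^T = - frame_conn th x LC l.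
Proof. by apply/(frame_conn_anti adapted Vx)/levi_civita_metric. Qed.

Let W_anti b : (W b)^T = - W b.
Proof. exact: along_tr. Qed.

(** Near integrability, read in the coframe: the derivative of the coframe enters
    the derivative of the cubic form and the connection form alike, and cancels. *)
Let W_ni u : ups3 u u (along W u *m u) = 0.
Proof.
have := ni (E *m u); rewrite nearly_integrableE.
under eq_bigr => l _ do rewrite (partial_cubic_coframe adapted Vx).
rewrite (polar_coframe adapted Vx) !mulKVmx// [th x *m (along _ _ *m _)]mulmxA mulmx_alongl.
have -> : along (fun l => th x *m LC l) (E *m u) *m (E *m u) =
    along W u *m u + \sum_l (E *m u) l 0 *: (partial_mx l th x *m (E *m u)).
  rewrite (_ : (fun l => _) = (fun l => frame_conn th x LC l *m th x + partial_mx l th x)).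
    have -> : along W u *m u = along (frame_conn th x LC) (E *m u) *m u.
      by rewrite (along_frame adapted Vx) mulKVmx.
    rewrite /along mulmx_suml; under eq_bigr => l _.
      rewrite scalerDr mulmxDl -!scalemxAl -mulmxA mulKVmx//.
      over.
    by rewrite big_split mulmx_suml; congr (_ + _); apply: eq_bigr => l _;
      rewrite scalemxAl.
  by apply/funext => l; rewrite -(frame_connE adapted Vx).
rewrite ups3D3 mulrDr opprD addrCA (_ : \sum_l _ = 3 * ups3 u u
    (\sum_l (E *m u) l 0 *: (partial_mx l th x *m (E *m u)))) ?subrr ?addr0.
  by move=> /eqP; rewrite oppr_eq0 mulf_eq0 pnatr_eq0 => /eqP.
have Z3 a b c k : ups3 a b (k *: c) = k * ups3 a b c.
  by rewrite ups3CA ups3C ups3Z1 ups3C ups3CA.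
elim/big_rec2 : _ => [|l y z _ ->].
  by rewrite -(scale0r (0 : 'cV[R]_5)) Z3 mul0r mulr0.
by rewrite ups3D3 Z3; ring.
Qed.

Lemma frame_conn_char l : frame_conn th x (frame_char S i th x) l =
  along (so3_part W) (col l (th x)).
Proof. by rewrite /frame_conn /frame_char mulKVmx// addrK mulmxK. Qed.

(** The torsion is that of the difference with the torsion-free Levi-Civita
    connection, and this difference is totally skew. *)
Lemma frame_char_compatible : compatible S i x (frame_char S i th x).
Proof.
apply/compatible_frameP; split=> [l|u v w].
  by rewrite frame_conn_char; apply: along_so3 => b; exact: so3_partP.
have torsE a b : tors (frame_char S i th x) a b =
    tors (frame_char S i th x) a b - tors LC a b.
  by rewrite (tors_levi_civita S a b Dx) subr0.
have KE b : frame_comp th x (frame_char S i th x) b - frame_comp th x LC b =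
    so3_part W b - W b.
  congr (_ - _); rewrite {1}/frame_comp.
  rewrite (_ : frame_conn _ _ _ = fun l => along (so3_part W) (col l (th x))); last first.
    by apply/funext => l; exact: frame_conn_char.
  by rewrite along_col colE mulKVmx// along_delta.
rewrite torsE [in RHS]torsE !(gdot_coframe adapted Vx) !(coframe_tors adapted Vx).
move: (th x *m u) (th x *m v) (th x *m w) => {}u {}v {}w.
rewrite (_ : (fun b => _) = (fun b => so3_part W b - W b)); last exact/funext.
set K := fun b => _.
have KS : totally_skew K by move=> b k j; exact: so3_part_skew.
have KA b : (K b)^T = - K b.
  have [c1 [c2 [c3 e]]] := so3_partP W b.
  by rewrite /K linearB /= W_anti e so3mx_anti opprB opprK addrC.
have mxB (A B : 'M[R]_1) : (A - B) 0 0 = A 0 0 - B 0 0 by rewrite !mxE.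
have mxN (A : 'M[R]_1) : (- A) 0 0 = - A 0 0 by rewrite !mxE.
rewrite !mulmxBr !mxB (anti_along u v w KA) (skew_along w u v KS) !mxN.
by ring.
Qed.

End AtPoint.

Let oV : open V. Proof. by case: adapted. Qed.
Let Vi : V `<=` img i. Proof. by case: adapted. Qed.
Let sth : smooth_mx_on V th. Proof. by case: adapted. Qed.
Let sE : smooth_mx_on V (fun y => invmx (th y)).
Proof. by apply: smooth_invmx => // y Vy; exact: (coframe_unit adapted Vy). Qed.

Let sLC l : smooth_mx_on V (fun y => levi_civita g i y l).
Proof.
have sg : smooth_mx_on V (gmx g i).
  by move=> a b; apply: (smooth_on_sub Vi); exact: gmx_smooth.
have sgV : smooth_mx_on V (fun y => invmx (gmx g i y)).
  by apply: smooth_invmx => // y /Vi; exact: gmx_unit.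
move=> k m; apply: (eq_smooth_on oV (f := fun y => 2^-1 * \sum_p invmx (gmx g i y) k p
   * (partial l (fun y => gmx g i y p m) y + partial m (fun y => gmx g i y p l) y
      - partial p (fun y => gmx g i y l m) y))).
  by move=> y _; rewrite mxE.
apply: smooth_onM => //; first exact: smooth_on_cst.
apply: smooth_on_sum => // p; apply: smooth_onM => //.
by apply: smooth_onB => //; first apply: smooth_onD => //; exact: smooth_on_partial.
Qed.

Let sW b : smooth_mx_on V (fun y => frame_comp th y (levi_civita g i y) b).
Proof.
apply: smooth_mx_sum => // l; apply: smooth_mxZ => //.
  by apply: (eq_smooth_on oV _ (sE l b)) => y _; rewrite mxE.
apply: smooth_mxM => //; apply: smooth_mxB => //; last exact: smooth_partial_mx.
exact: smooth_mxM.
Qed.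

Let sso3 (c1 c2 c3 : 'rV[R]_5 -> R) : smooth_on V c1 -> smooth_on V c2 ->
  smooth_on V c3 -> smooth_mx_on V (fun y => so3mx (c1 y) (c2 y) (c3 y)).
Proof.
move=> s1 s2 s3; apply: smooth_mxD => //; first apply: smooth_mxD => //.
all: by apply: smooth_mxZ => //; exact: smooth_mx_cst.
Qed.

Let sGam b : smooth_mx_on V (fun y => so3_part (frame_comp th y (levi_civita g i y)) b).
Proof.
have s2V : smooth_on V (fun=> 2^-1 : R) by exact: smooth_on_cst.
by elim/ord5_ind: b; rewrite /so3_part /so3_parts !inordK//=; apply: sso3;
  do ?[apply: smooth_onM => //|apply: smooth_onB => //|apply: smooth_onD => //];
  exact: sW.
Qed.

Lemma smooth_frame_char l : smooth_mx_on V (fun y => frame_char S i th y l).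
Proof.
apply: smooth_mxM => //; apply: smooth_mxD => //; last exact: smooth_partial_mx.
apply: smooth_mxM => //; apply: smooth_mx_sum => // b; apply: smooth_mxZ => //.
by apply: (eq_smooth_on oV _ (sth b l)) => y _; rewrite mxE.
Qed.

End InFrame.

(** * The algebra of a structure tensor *)

(** A Euclidean space with the commutative product of a structure tensor: the
    trilinear form [dot a (prd b c)] is totally symmetric. *)
Record cartan_algebra (R : realType) (V : lmodType R) (dot : V -> V -> R)
    (prd : V -> V -> V) : Prop := {
  ca_dotC : forall a b, dot a b = dot b a;
  ca_dotD : forall a b c, dot a (b + c) = dot a b + dot a c;
  ca_dotZ : forall a k b, dot a (k *: b) = k * dot a b;
  ca_dot_gt0 : forall a, a != 0 -> 0 < dot a a;
  ca_prdC : forall a b, prd a b = prd b a;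
  ca_prdD : forall a b c, prd a (b + c) = prd a b + prd a c;
  ca_prdZ : forall a k b, prd a (k *: b) = k *: prd a b;
  ca_prd_adj : forall a b c, dot a (prd b c) = dot c (prd b a);
  ca_prd_cube : forall a, prd a (prd a a) = dot a a *: a
}.

Section CartanAlgebra.
Variables (R : realType) (V : lmodType R) (dot : V -> V -> R) (prd : V -> V -> V).
Hypothesis CA : cartan_algebra dot prd.
Let dotC := ca_dotC CA.
Let dotD := ca_dotD CA.
Let dotZ := ca_dotZ CA.
Let prdC := ca_prdC CA.
Let prdD := ca_prdD CA.
Let prdZ := ca_prdZ CA.
Let prd_adj := ca_prd_adj CA.
Let prd_cube := ca_prd_cube CA.
Implicit Types (a b c u v w : V).

Let dotDl a b c : dot (b + c) a = dot b a + dot c a.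
Proof. by rewrite dotC dotD !(dotC a). Qed.
Let dotZl a k b : dot (k *: b) a = k * dot b a.
Proof. by rewrite dotC dotZ dotC. Qed.
Let dotN a b : dot a (- b) = - dot a b.
Proof. by rewrite -scaleN1r dotZ mulN1r. Qed.
Let dotNl a b : dot (- b) a = - dot b a.
Proof. by rewrite dotC dotN dotC. Qed.
Let prdDl a b c : prd (b + c) a = prd b a + prd c a.
Proof. by rewrite prdC prdD !(prdC a). Qed.
Let prdZl a k b : prd (k *: b) a = k *: prd b a.
Proof. by rewrite prdC prdZ prdC. Qed.
Let prdN a b : prd a (- b) = - prd a b.
Proof. by rewrite -scaleN1r prdZ scaleN1r. Qed.
Let prdNl a b : prd (- b) a = - prd b a.
Proof. by rewrite prdC prdN prdC. Qed.

Let dot0 a : dot a 0 = 0.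
Proof. by rewrite -(scale0r (0 : V)) dotZ mul0r. Qed.

Let dot_ge0 a : 0 <= dot a a.
Proof.
have [->|a0] := eqVneq a 0; first by rewrite dot0.
by apply: ltW; exact: ca_dot_gt0 CA _ a0.
Qed.

Let dot_eq0 a : dot a a = 0 -> a = 0.
Proof. by move=> a0; apply/eqP/negPn/negP => /(ca_dot_gt0 CA); rewrite a0 ltxx. Qed.

Let bilE := (dotD, dotDl, dotZ, dotZl, dotN, dotNl, prdD, prdDl, prdZ, prdZl, prdN, prdNl).

Let dot_sep a b : (forall w, dot w a = dot w b) -> a = b.
Proof.
move=> ab; apply/eqP; rewrite -subr_eq0; apply/eqP/dot_eq0.
by rewrite dotD dotN ab subrr.
Qed.

Let dot_eq a b : dot a a + dot b b = 2 * dot a b -> a = b.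
Proof.
move=> ab; apply/eqP; rewrite -subr_eq0; apply/eqP/dot_eq0.
by rewrite !bilE (dotC b a); lra.
Qed.

Let dot_prd_sq a : dot (prd a a) (prd a a) = dot a a ^+ 2.
Proof. by rewrite prd_adj prd_cube dotZ expr2. Qed.

(** Full polarisation of the cubic identity. *)
Lemma prd_cubic a b c :
  prd a (prd b c) + prd b (prd c a) + prd c (prd a b) =
  dot a b *: c + dot b c *: a + dot c a *: b.
Proof.
apply: dot_sep => w.
have P v : dot w (prd v (prd v v)) = dot v v * dot w v by rewrite prd_cube dotZ.
have := P (a + b + c); have := P (a + b); have := P (b + c); have := P (a + c).
have := P a; have := P b; have := P c.
rewrite !bilE (prdC b a) (prdC c a) (prdC c b) (dotC b a) (dotC c a) (dotC c b).
by lra.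
Qed.

(** Cauchy-Schwarz for [v] and its square, whose norm is [dot v v]. *)
Lemma Cauchy_prd v : dot v (prd v v) ^+ 2 <= dot v v ^+ 3.
Proof.
have [v0|v0] := eqVneq (dot v v) 0.
  by rewrite (dot_eq0 v0) dotC !dot0 !expr0n.
have vp : 0 < dot v v by rewrite lt_def v0 dot_ge0.
have := dot_ge0 (dot v v *: prd v v - dot v (prd v v) *: v).
rewrite !bilE dot_prd_sq (dotC _ v); move: (dot v v) vp (dot v (prd v v)) => N Np f H.
rewrite -(ler_pM2l Np); nra.
Qed.

(** Failing this, every vector would be parallel to its own square. For two
    orthonormal vectors and their sum that is contradictory: the squares would be
    [F e] and [F u] with the same [F = +-1], and the cubic form at [e + u] would be
    [2 F], whose square is 4 and not [2 ^ 3]. *)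
Lemma exists_generic e u : dot e e = 1 -> dot u u = 1 -> dot e u = 0 ->
  exists v, dot v (prd v v) ^+ 2 != dot v v ^+ 3.
Proof.
move=> ee uu eu; apply: contrapT => noV.
have sq v : dot v (prd v v) ^+ 2 = dot v v ^+ 3.
  by apply/eqP/negPn/negP => vV; apply: noV; exists v.
have par v : dot v v *: prd v v = dot v (prd v v) *: v.
  apply: dot_eq; rewrite !bilE dot_prd_sq (dotC (prd v v)).
  have := sq v; move: (dot v v) (dot v (prd v v)) => N f; rewrite expr2 => fE.
  by ring: fE.
have peE := par e; have puE := par u; rewrite ee uu !scale1r in peE puE.
have z1 : dot u (prd e u) = 0 by rewrite prdC prd_adj puE dotZ eu mulr0.
have z2 : dot u (prd e e) = 0 by rewrite peE dotZ (dotC u) eu mulr0.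
have z3 : dot e (prd u u) = 0 by rewrite puE dotZ eu mulr0.
have z4 : dot e (prd e u) = 0 by rewrite prd_adj.
have := congr1 (dot e) (par (e + u)); have := sq (e + u); have := sq e.
rewrite !bilE (prdC u e) (dotC u e) ee uu eu z1 z2 z3 z4.
move: (dot e (prd e e)) (dot u (prd u u)) => F G F2 FG2 FG.
have GF : G = F by lra.
by move: FG2; rewrite GF; nra.
Qed.

Definition flat_pair e1 e2 : Prop :=
  [/\ dot e1 e1 = 1, dot e2 e2 = 1, dot e1 e2 = 0 &
   [/\ prd e1 e1 = - e1, prd e1 e2 = e2 & prd e2 e2 = e1]].

(** In a flat pair the unit vector [v = cos t e1 + sin t e2] has square
    [- cos (2 t) e1 + sin (2 t) e2] and cubic form [- cos (3 t)]. Solving these two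
    equations for [e1] and [e2] gives the formulas below, with [k = cos t],
    [h = sin t] and determinant [sin (3 t) = 3 h - 4 h ^ 3]. *)
Definition flat1 (k h : R) v := (3 * h - 4 * h ^+ 3)^-1 *: (2 * h * k *: v - h *: prd v v).
Definition flat2 (k h : R) v :=
  (3 * h - 4 * h ^+ 3)^-1 *: ((2 * k ^+ 2 - 1) *: v + k *: prd v v).

Lemma flat_frame k h v : dot v v = 1 -> k * k = 1 - h * h ->
  dot v (prd v v) = 3 * k - 4 * k ^+ 3 -> 3 * h - 4 * h ^+ 3 != 0 ->
  flat_pair (flat1 k h v) (flat2 k h v).
Proof.
move=> vv kk vc D0; set w := prd v v.
have vw : prd v w = v by rewrite /w prd_cube vv scale1r.
have wv : prd w v = v by rewrite prdC.
have ww1 : dot w w = 1 by rewrite /w dot_prd_sq vv expr1n.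
have wwE : prd w w = (2 * dot v w) *: v - w.
  apply: dot_sep => z; have := congr1 (dot z) (prd_cubic v v w).
  rewrite -/w vw wv vv (dotC w v) -/w !bilE; lra.
rewrite /flat1 /flat2 -/w.
split; [| | |split].
- by rewrite !bilE (dotC w v) vv ww1 vc; field: kk.
- by rewrite !bilE (dotC w v) vv ww1 vc; field: kk.
- by rewrite !bilE (dotC w v) vv ww1 vc; field: kk.
- by apply: dot_sep => z; rewrite !bilE -/w vw wv wwE !bilE vc; field: kk.
- by apply: dot_sep => z; rewrite !bilE -/w vw wv wwE !bilE vc; field: kk.
- by apply: dot_sep => z; rewrite !bilE -/w vw wv wwE !bilE vc; field: kk.
Qed.

Section Flat.
Variables e1 e2 : V.
Hypothesis flat : flat_pair e1 e2.
Let e11 : dot e1 e1 = 1. Proof. by case: flat. Qed.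
Let e22 : dot e2 e2 = 1. Proof. by case: flat. Qed.
Let e12 : dot e1 e2 = 0. Proof. by case: flat. Qed.
Let p11 : prd e1 e1 = - e1. Proof. by case: flat => _ _ _ []. Qed.
Let p12 : prd e1 e2 = e2. Proof. by case: flat => _ _ _ []. Qed.
Let p22 : prd e2 e2 = e1. Proof. by case: flat => _ _ _ []. Qed.
Let s : R := Num.sqrt 3.
Let s2 : s * s = 3. Proof. by rewrite -expr2 sqr_sqrtr. Qed.
Let s0 : s != 0. Proof. by rewrite gt_eqF// sqrtr_gt0. Qed.

(** On the orthogonal complement of the plane, multiplication by [e1] has the
    eigenvalues 1 and [-1/2]; the eigenspace of [-1/2] is stable under
    multiplication by [e2], whose square there is [3/4]. The sign [ep] selects one
    of the two eigenvalues of [e2]. *)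
Definition joint_eigen (ep : R) p := [/\ dot e1 p = 0, dot e2 p = 0,
  prd e1 p = - 2^-1 *: p & prd e2 p = (ep * (s / 2)) *: p].

(** Up to a scalar, the projection to the joint eigenspace: off the plane, then
    off the eigenvalue 1 of [e1], then off the eigenvalue [- ep * (s / 2)] of
    [e2]. *)
Definition joint_part (ep : R) u :=
  let u1 := u - dot e1 u *: e1 - dot e2 u *: e2 in
  let u2 := u1 - prd e1 u1 in
  u2 + (ep * (2 / s)) *: prd e2 u2.

Let adj11 x : dot e1 (prd e1 x) = - dot e1 x.
Proof. by rewrite prd_adj p11 dotN dotC. Qed.
Let adj12 x : dot e1 (prd e2 x) = dot e2 x.
Proof. by rewrite prd_adj (prdC e2) p12 dotC. Qed.
Let adj21 x : dot e2 (prd e1 x) = dot e2 x.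
Proof. by rewrite prd_adj p12 dotC. Qed.
Let adj22 x : dot e2 (prd e2 x) = dot e1 x.
Proof. by rewrite prd_adj p22 dotC. Qed.

Let sq1 x : dot e1 x = 0 -> prd e1 (prd e1 x) = 2^-1 *: (x + prd e1 x).
Proof.
move=> x1; apply: dot_sep => z; have := congr1 (dot z) (prd_cubic e1 e1 x).
by rewrite (dotC x) x1 e11 p11 (prdC x e1) !bilE (prdC x e1); lra.
Qed.

Let sq2 x : dot e2 x = 0 -> prd e2 (prd e2 x) = 2^-1 *: (x - prd e1 x).
Proof.
move=> x2; apply: dot_sep => z; have := congr1 (dot z) (prd_cubic e2 e2 x).
by rewrite (dotC x) x2 e22 p22 !bilE (prdC x e1) (prdC x e2); lra.
Qed.

Let mixed x : dot e1 x = 0 -> dot e2 x = 0 ->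
  prd e1 (prd e2 x) = - prd e2 (prd e1 x) - prd e2 x.
Proof.
move=> x1 x2; apply: dot_sep => z; have := congr1 (dot z) (prd_cubic e1 e2 x).
by rewrite (dotC x) x1 x2 e12 p12 !bilE (prdC x e1) (prdC x e2); lra.
Qed.

Lemma joint_partP ep u : ep * ep = 1 -> joint_eigen ep (joint_part ep u).
Proof.
move=> ep1; rewrite /joint_part.
set u1 := u - _ - _.
have o11 : dot e1 u1 = 0 by rewrite /u1 !bilE e11 e12; ring.
have o21 : dot e2 u1 = 0 by rewrite /u1 !bilE (dotC e2 e1) e22 e12; ring.
clearbody u1; set u2 := u1 - _.
have o12 : dot e1 u2 = 0 by rewrite /u2 !bilE adj11 o11; ring.
have o22 : dot e2 u2 = 0 by rewrite /u2 !bilE adj21 o21; ring.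
have L1 : prd e1 u2 = - 2^-1 *: u2.
  by apply: dot_sep => z; rewrite /u2 prdD prdN (sq1 o11) !bilE; field.
clearbody u2; split.
- by rewrite !bilE adj12 o12 o22; ring.
- by rewrite !bilE adj22 o12 o22; ring.
- by apply: dot_sep => z; rewrite prdD prdZ (mixed o12 o22) L1 !bilE; field.
- apply: dot_sep => z; rewrite prdD prdZ (sq2 o22) L1 !bilE -/s.
  by field: ep1 s2.
Qed.

Section Frame.
Variables p q : V.
Hypothesis Jp : joint_eigen 1 p.
Hypothesis Jq : joint_eigen (-1) q.
Hypothesis pp : dot p p = 1.
Hypothesis qq : dot q q = 1.

(** The product of [p] and [q] has square norm [3/4]. Multiplication by [e2] is
    diagonal on [p] and [q], whereas in the normal form, with its term in
    [t2 * t3 * t5], it exchanges the directions of [e3] and [e5]; these are therefore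
    at 45 degrees to [p] and [q]. The sign of [e4] is the one that makes the
    coefficient of [t4 * t5 ^ 2] positive. *)
Definition e4 := - (2 / s) *: prd p q.
Definition e3 := (Num.sqrt 2)^-1 *: (p + q).
Definition e5 := (Num.sqrt 2)^-1 *: (p - q).
Let r := prd p q.

Let pq0 : dot p q = 0.
Proof.
case: Jp => _ _ _ e2p; case: Jq => _ _ _ e2q.
have := prd_adj p e2 q; rewrite e2p e2q !bilE (dotC q).
have : s * dot p q = 0 -> dot p q = 0 by move/eqP; rewrite mulf_eq0 (negPf s0) => /eqP.
by move=> H1 H2; apply: H1; lra.
Qed.

(* equality in Cauchy-Schwarz: the right side has the norm of the square of [x]
   and the inner product with it that an equality requires *)
Let eigen_sq ep x : ep * ep = 1 -> dot x x = 1 -> joint_eigen ep x ->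
  prd x x = - 2^-1 *: e1 + (ep * (s / 2)) *: e2.
Proof.
move=> ep1 xx [e1x e2x L1 L2]; apply: dot_eq.
rewrite dot_prd_sq xx !bilE e11 e22 (dotC e2) e12 (dotC _ e1) (dotC _ e2).
rewrite (prd_adj e1) (prdC x e1) (prd_adj e2) (prdC x e2) L1 L2 !bilE xx.
by field: ep1 s2.
Qed.

Let ppE : prd p p = - 2^-1 *: e1 + (s / 2) *: e2.
Proof. by rewrite (eigen_sq _ pp Jp) ?mulr1// mul1r. Qed.

Let qqE : prd q q = - 2^-1 *: e1 - (s / 2) *: e2.
Proof. by rewrite (eigen_sq _ qq Jq) ?mulrNN ?mulr1// mulN1r (scaleNr (s / 2)). Qed.

Let e1r : prd e1 r = r.
Proof.
case: Jp => e1p _ L1p _; case: Jq => e1q _ L1q _; apply: dot_sep => z.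
have := congr1 (dot z) (prd_cubic e1 p q).
by rewrite pq0 e1p (dotC q) e1q (prdC q e1) L1p L1q !bilE (prdC q p) -/r; lra.
Qed.

Let e2r : prd e2 r = 0.
Proof.
case: Jp => _ e2p _ L2p; case: Jq => _ e2q _ L2q; apply: dot_sep => z.
have := congr1 (dot z) (prd_cubic e2 p q).
rewrite pq0 e2p (dotC q) e2q (prdC q e2) L2p L2q !bilE (prdC q p) -/r.
by rewrite dot0; lra.
Qed.

Let pr : prd p r = (3 / 4) *: q.
Proof.
case: Jp => _ _ L1p L2p; case: Jq => _ _ L1q L2q; apply: dot_sep => z.
have := congr1 (dot z) (prd_cubic p p q).
rewrite pq0 (dotC q) pq0 pp ppE (prdC q p) -/r !bilE (prdC q e1) (prdC q e2) L1q L2q !bilE.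
move=> h; have {h} : 2 * dot z (prd p r) = (1 - 4^-1 + s * s / 4) * dot z q by lra.
by rewrite s2; lra.
Qed.

Let qr : prd q r = (3 / 4) *: p.
Proof.
case: Jp => _ _ L1p L2p; case: Jq => _ _ L1q L2q; apply: dot_sep => z.
have := congr1 (dot z) (prd_cubic q q p).
rewrite pq0 (dotC q) pq0 qq qqE (prdC q p) -/r !bilE (prdC p e1) (prdC p e2) L1p L2p !bilE.
move=> h; have {h} : 2 * dot z (prd q r) = (1 - 4^-1 + s * s / 4) * dot z p by lra.
by rewrite s2; lra.
Qed.

Let rr : dot r r = 3 / 4.
Proof. by rewrite {2}/r prd_adj (prdC p) (prdC r) pr dotZ qq mulr1. Qed.

Let rrE : prd r r = (3 / 4) *: e1.
Proof.
apply: dot_eq; rewrite dot_prd_sq rr !bilE e11 (dotC _ e1).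
by rewrite prd_adj (prdC r) e1r rr; field.
Qed.

Let r1 : dot e1 r = 0.
Proof.
case: Jp => _ _ L1p _.
by rewrite /r prd_adj (prdC p) L1p dotZ (dotC q) pq0 mulr0.
Qed.

Let r2 : dot e2 r = 0.
Proof.
case: Jp => _ _ _ L2p.
by rewrite /r prd_adj (prdC p) L2p dotZ (dotC q) pq0 mulr0.
Qed.

Let rp : dot p r = 0.
Proof.
case: Jq => e1q e2q _ _.
by rewrite /r prd_adj ppE !bilE (dotC q) e1q (dotC q) e2q; ring.
Qed.

Let rq : dot q r = 0.
Proof.
case: Jp => e1p e2p _ _.
by rewrite /r (prdC p) prd_adj qqE !bilE (dotC p) e1p (dotC p) e2p; ring.
Qed.

Let h : R := Num.sqrt 2.
Let h2 : h * h = 2. Proof. by rewrite -expr2 sqr_sqrtr. Qed.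
Let h0 : h != 0. Proof. by rewrite gt_eqF// sqrtr_gt0. Qed.

Definition frame_vec (k : nat) : V := nth 0 [:: e1; e2; e3; e4; e5] k.

Let p1 : dot e1 p = 0. Proof. by case: Jp. Qed.
Let p2 : dot e2 p = 0. Proof. by case: Jp. Qed.
Let q1 : dot e1 q = 0. Proof. by case: Jq. Qed.
Let q2 : dot e2 q = 0. Proof. by case: Jq. Qed.
Let e1p : prd e1 p = - 2^-1 *: p. Proof. by case: Jp. Qed.
Let e2p : prd e2 p = (s / 2) *: p. Proof. by case: Jp => _ _ _; rewrite mul1r. Qed.
Let e1q : prd e1 q = - 2^-1 *: q. Proof. by case: Jq. Qed.
Let e2q : prd e2 q = - (s / 2) *: q. Proof. by case: Jq => _ _ _; rewrite mulN1r. Qed.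

Let grams := (e11, e22, e12, p1, p2, q1, q2, pp, qq, pq0, rr, r1, r2, rp, rq).

Lemma frame_vec_orthonormal (j k : nat) : (j < 5)%N -> (k < 5)%N ->
  dot (frame_vec j) (frame_vec k) = (j == k)%:R.
Proof.
wlog jk : j k / (j <= k)%N => [W j5 k5|].
  by case/orP: (leq_total j k) => jk; [exact: W|rewrite dotC eq_sym; exact: W].
move: jk; case: j => [|[|[|[|[|j]]]]] //; case: k => [|[|[|[|[|k]]]]] // _ _ _.
all: rewrite /frame_vec /= /e3 /e4 /e5 -/r -/s -/h !bilE ?(dotC p e1) ?(dotC p e2)
  ?(dotC q e1) ?(dotC q e2) ?(dotC e2 e1) ?(dotC r) ?(dotC q p) ?grams.
all: by field: s2 h2; rewrite ?s0 ?h0.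
Qed.

Lemma frame_cubic (t1 t2 t3 t4 t5 : R) :
  let v := t1 *: e1 + t2 *: e2 + t3 *: e3 + t4 *: e4 + t5 *: e5 in
  dot v (prd v v) =
  2^-1 * t1 * (6 * t2 ^+ 2 + 6 * t4 ^+ 2 - 2 * t1 ^+ 2 - 3 * t3 ^+ 2 - 3 * t5 ^+ 2)
  + 3 * s / 2 * t4 * (t5 ^+ 2 - t3 ^+ 2) + 3 * s * t2 * t3 * t5.
Proof.
move=> v.
pose a := (t3 + t5) / h; pose b := (t3 - t5) / h; pose d := - (2 / s) * t4.
have vE : v = t1 *: e1 + t2 *: e2 + a *: p + b *: q + d *: r.
  apply: dot_sep => z; rewrite /v /e3 /e4 /e5 -/r -/s -/h /a /b /d !bilE; field.
  by rewrite s0 h0.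
have -> : dot v (prd v v) = - t1 ^+ 3 + 3 * t1 * t2 ^+ 2 + (9 / 4) * t1 * d ^+ 2
   - (3 / 2) * t1 * (a ^+ 2 + b ^+ 2) + (3 * s / 2) * t2 * (a ^+ 2 - b ^+ 2)
   + (9 / 2) * a * b * d.
  have -> : prd v v = (- t1 ^+ 2 + t2 ^+ 2 - (a ^+ 2 + b ^+ 2) / 2 + 3 / 4 * d ^+ 2) *: e1
      + (2 * t1 * t2 + s / 2 * (a ^+ 2 - b ^+ 2)) *: e2
      + (- t1 * a + s * t2 * a + 3 / 2 * b * d) *: p
      + (- t1 * b - s * t2 * b + 3 / 2 * a * d) *: q + (2 * a * b + 2 * t1 * d) *: r.
    apply: dot_sep => z; rewrite vE; clear vE v; clearbody a b d.
    rewrite !(prdD, prdDl, prdZ, prdZl) (prdC p e1) (prdC p e2) (prdC q e1) (prdC q e2)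
      (prdC q p) (prdC e2 e1) !(prdC r e1) !(prdC r e2) (prdC r p) (prdC r q) -/r.
    rewrite p11 p12 p22 e1p e2p e1q e2q e1r e2r ppE qqE pr qr rrE !bilE dot0.
    by field.
  rewrite vE; clear vE v; clearbody a b d.
  rewrite !bilE ?(dotC p e1) ?(dotC p e2) ?(dotC q e1) ?(dotC q e2) ?(dotC e2 e1)
    ?(dotC r e1) ?(dotC r e2) ?(dotC r p) ?(dotC r q) ?(dotC q p) ?grams.
  by field.
rewrite /a /b /d; field: s2 h2.
by rewrite s0 h0.
Qed.
End Frame.
End Flat.
End CartanAlgebra.

(** * The algebra on a tangent space *)

Section Concrete.
Variables (R : realType) (M : manifold R 5) (S : so3_structure M).
Let g := so3_metric S.
Let Y := ups S.
Variable i : atlas_index M.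
Implicit Types (u v w a b c : 'cV[R]_5) (x : 'rV[R]_5).

Definition uprod x v w : 'cV[R]_5 := tend g Y i x v *m w.

Section AtPoint.
Variable x : 'rV[R]_5.
Hypothesis Dx : img i x.
Let dot := gdot g i x.
Let prd := uprod x.
Let L v := tend g Y i x v.

Lemma gdot_tend u v w : dot u (L v *m w) = trilin (tcoef Y i x) u w v.
Proof.
rewrite /dot /gdot /L /tend !mulmxA -[_ *m gmx _ _ _ *m invmx _]mulmxA.
rewrite mulmxV ?gmx_unit// mulmx1 mxE /trilin.
rewrite (eq_bigr (fun m => \sum_k \sum_l tcoef Y i x k m l * u k 0 * w m 0 * v l 0)).
  by rewrite exchange_big.
move=> m _; rewrite mxE mulr_suml; apply: eq_bigr => k _.
by rewrite !mxE mulr_sumr mulr_suml; apply: eq_bigr => l _; ring.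
Qed.

Lemma uprod_cartan : cartan_algebra dot prd.
Proof.
have C a b : prd a b = prd b a.
  apply: (gdot_sep (g := g) Dx) => w.
  by have [_] := ups_sym S Dx w a b; rewrite /prd /uprod.
split=> //.
- exact: gdotC.
- by move=> a b c; exact: gdotDr.
- by move=> a k b; exact: gdotZr.
- exact: gdot_gt0.
- by move=> a b c; exact: mulmxDr.
- by move=> a k b; rewrite /prd /uprod -scalemxAr.
- by move=> a b c; have [] := ups_sym S Dx a b c.
- by move=> a; exact: (ups_sqr S Dx).
Qed.
Let CA := uprod_cartan.

Lemma tr_outer a b : \tr (a *m (b^T *m gmx g i x)) = dot b a.
Proof. by rewrite mxtrace_mulC /mxtrace big_ord1. Qed.

Lemma outerE a b c : a *m (b^T *m gmx g i x) *m c = dot b c *: a.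
Proof.
rewrite -mulmxA; apply/matrixP => k l; rewrite ord1 mxE big_ord1 [RHS]mxE.
by rewrite [LHS]mulrC.
Qed.

Lemma eq_mulmx (A B : 'M[R]_5) : (forall c, A *m c = B *m c) -> A = B.
Proof.
move=> AB; apply/matrixP => k l.
by have := congr1 (fun v : 'cV_5 => v k 0) (AB (delta_mx l 0)); rewrite -!colE !mxE.
Qed.

(** The trace of the polarised cubic identity, read as an identity between
    endomorphisms applied to the third argument. *)
Lemma tr_uprod a b : 2 * \tr (L a *m L b) = 7 * dot a b.
Proof.
have E : L a *m L b + L b *m L a + L (prd a b) =
    dot a b *: 1%:M + a *m (b^T *m gmx g i x) + b *m (a^T *m gmx g i x).
  apply: eq_mulmx => c; rewrite !mulmxDl !outerE -scalemxAl mul1mx.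
  rewrite -[L a *m L b *m c]mulmxA -[L b *m L a *m c]mulmxA.
  have E := prd_cubic CA a b c.
  rewrite (ca_prdC CA c a) (ca_prdC CA c (prd a b)) (ca_dotC CA c a) in E; exact: E.
have := congr1 mxtrace E; rewrite !linearD /= !tr_outer linearZ /= mxtrace1.
rewrite (ups_trace S Dx) [dot b a](gdotC g Dx) [\tr (L b *m _)]mxtrace_mulC.
by rewrite -!/dot => h; lra.
Qed.

(** As an endomorphism, [joint_part] has trace [5 - 2 - 0 = 3]: here 5 is the trace
    of [B] below, by [tr_uprod] and since multiplications have trace zero, and 2 and
    0 are its diagonal entries at [e1] and [e2]. *)
Lemma joint_part_neq0 e1 e2 ep : flat_pair dot prd e1 e2 ->
  exists u, joint_part dot prd e1 e2 ep u != 0.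
Proof.
move=> [e11 e22 e12 [p11 p12 p22]]; apply: contrapT => no.
have z u : joint_part dot prd e1 e2 ep u = 0.
  by apply/eqP/negPn/negP => u0; apply: no; exists u.
pose k := ep * (2 / Num.sqrt 3).
pose B := (1%:M + k *: L e2) *m (1%:M - L e1).
pose P := 1%:M - e1 *m (e1^T *m gmx g i x) - e2 *m (e2^T *m gmx g i x).
have X0 : B *m P = 0.
  apply: eq_mulmx => u; rewrite mul0mx -(z u) /joint_part.
  have <- : P *m u = u - dot e1 u *: e1 - dot e2 u *: e2.
    by rewrite /P !mulmxBl mul1mx !outerE.
  rewrite -[B *m P *m u]mulmxA; move: (P *m u) => u1.
  rewrite /B -[_ *m _ *m u1]mulmxA.
  have -> : (1%:M - L e1) *m u1 = u1 - prd e1 u1 by rewrite mulmxBl mul1mx.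
  by rewrite mulmxDl mul1mx -scalemxAl.
have p21 : prd e2 e1 = e2 by rewrite (ca_prdC CA).
have Be1 : dot e1 (B *m e1) = 2.
  rewrite /B -[_ *m _ *m e1]mulmxA.
  have -> : (1%:M - L e1) *m e1 = e1 + e1.
    by rewrite mulmxBl mul1mx -[L e1 *m e1]/(prd e1 e1) p11 opprK.
  rewrite mulmxDl mul1mx -scalemxAl.
  by rewrite mulmxDr -[L e2 *m e1]/(prd e2 e1) p21 !(ca_dotD CA, ca_dotZ CA) e11 e12; ring.
have Be2 : dot e2 (B *m e2) = 0.
  rewrite /B -[_ *m _ *m e2]mulmxA.
  have -> : (1%:M - L e1) *m e2 = 0.
    by rewrite mulmxBl mul1mx -[L e1 *m e2]/(prd e1 e2) p12 subrr.
  rewrite mulmx0.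
  by rewrite /dot /gdot mulmx0 mxE.
have trB : \tr B = 5.
  rewrite /B mulmxBr mulmx1 mulmxDl mul1mx -scalemxAl !linearB /= !linearD /= !linearZ /=.
  rewrite !(ups_trace S Dx) mxtrace1; have := tr_uprod e2 e1.
  by rewrite (ca_dotC CA) e12 => h; have -> : \tr (L e2 *m L e1) = 0; [lra|ring].
have := congr1 mxtrace X0; rewrite mxtrace0 /P !mulmxBr mulmx1 !linearB /= trB.
rewrite !mulmxA -![_ *m _ *m gmx _ _ _]mulmxA !tr_outer Be1 Be2.
by lra.
Qed.

(** Gram-Schmidt on two basis vectors provides the orthonormal pair that
    [exists_generic] asks for. *)
Lemma exists_generic_at : exists v, dot v (prd v v) ^+ 2 != dot v v ^+ 3.
Proof.
pose unit v := (Num.sqrt (dot v v))^-1 *: v.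
have unitP v : v != 0 -> dot (unit v) (unit v) = 1.
  move=> /(ca_dot_gt0 CA) v0.
  rewrite (ca_dotZ CA) (ca_dotC CA) (ca_dotZ CA) mulrA -invfM -expr2 sqr_sqrtr ?ltW//.
  by rewrite mulVf// gt_eqF.
pose a : 'cV[R]_5 := delta_mx ord0 0; pose b : 'cV[R]_5 := delta_mx ord_max 0.
have a0 : a != 0.
  apply/eqP => /matrixP/(_ ord0 0)/eqP.
  by rewrite !mxE !eqxx oner_eq0.
pose c := b - (dot a b / dot a a) *: a.
have c0 : c != 0.
  apply/eqP => /matrixP/(_ ord_max 0)/eqP.
  by rewrite !mxE !eqxx /= mulr0 subr0 oner_eq0.
have ac : dot a c = 0.
  rewrite /c (ca_dotD CA) -scaleNr (ca_dotZ CA) mulNr divfK ?subrr//.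
  by rewrite gt_eqF// (ca_dot_gt0 CA).
apply: (exists_generic CA (unitP _ a0) (unitP _ c0)).
by rewrite (ca_dotZ CA) (ca_dotC CA) (ca_dotZ CA) (ca_dotC CA) ac !mulr0.
Qed.
End AtPoint.
End Concrete.

(** * Existence of adapted coframes *)

Section SmoothCoframe.
Variables (R : realType) (M : manifold R 5) (S : so3_structure M).
Let g := so3_metric S.
Let Y := ups S.
Variable i : atlas_index M.

Lemma triple_angle (t : R) :
  cos (t + t + t) = 4 * cos t ^+ 3 - 3 * cos t /\
  sin (t + t + t) = 3 * sin t - 4 * sin t ^+ 3.
Proof.
have E : cos t * cos t = 1 - sin t * sin t.
  by have := cos2Dsin2 t; rewrite !expr2 => <-; ring.
by rewrite !cosD !sinD cosD; split; ring: E.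
Qed.

Lemma gdot_neq0_gt0 x (v : 'cV[R]_5) : img i x -> gdot g i x v v != 0 ->
  0 < gdot g i x v v.
Proof.
by move=> Dx v0; apply: gdot_gt0 => //; apply: contraNneq v0 => ->; rewrite /gdot mulmx0 mxE.
Qed.

Section OnOpen.
Variable D : set 'rV[R]_5.
Hypothesis oD : open D.
Hypothesis Di : D `<=` img i.
Implicit Types (u v : 'rV[R]_5 -> 'cV[R]_5).

Let sg : smooth_mx_on D (gmx g i).
Proof. by move=> a b; apply: (smooth_on_sub Di); exact: gmx_smooth. Qed.

Lemma smooth_gdot u v : smooth_mx_on D u -> smooth_mx_on D v ->
  smooth_on D (fun x => gdot g i x (u x) (v x)).
Proof.
move=> su sv; apply: (smooth_mxM oD (smooth_mxM oD (smooth_mx_tr oD su) sg) sv).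
Qed.

Lemma smooth_uprod u v : smooth_mx_on D u -> smooth_mx_on D v ->
  smooth_mx_on D (fun x => uprod S i x (u x) (v x)).
Proof.
move=> su sv; apply: smooth_mxM => //; apply: smooth_mxM => //.
  by apply: smooth_invmx => // x /Di; exact: gmx_unit.
move=> a b; apply: (eq_smooth_on oD (f := fun x => \sum_c tcoef Y i x a b c * u x c 0)).
  by move=> x _; rewrite mxE.
apply: smooth_on_sum => // c; apply: smooth_onM => //.
by apply: (smooth_on_sub Di); exact: tcoef_smooth.
Qed.

Lemma smooth_unit u : (forall x, D x -> gdot g i x (u x) (u x) != 0) ->
  smooth_mx_on D u ->
  smooth_mx_on D (fun x => (Num.sqrt (gdot g i x (u x) (u x)))^-1 *: u x).
Proof.
move=> u0 su; have up x : D x -> 0 < gdot g i x (u x) (u x).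
  by move=> Dx; apply: gdot_neq0_gt0; [exact: Di|exact: u0].
apply: smooth_mxZ => //; apply: smooth_onV => // [x Dx|].
  by rewrite gt_eqF// sqrtr_gt0 up.
by apply: smooth_on_sqrt => //; exact: smooth_gdot.
Qed.

Lemma unit_gdot x (v : 'cV[R]_5) : img i x -> gdot g i x v v != 0 ->
  let w := (Num.sqrt (gdot g i x v v))^-1 *: v in gdot g i x w w = 1.
Proof.
move=> Dx v0 w; have vp := gdot_neq0_gt0 Dx v0.
rewrite /w (gdotZr _ Dx) gdotZl mulrA -invfM -expr2 sqr_sqrtr ?ltW// mulVf//.
Qed.

Lemma smooth_joint_part ep u e1 e2 : smooth_mx_on D u -> smooth_mx_on D e1 ->
  smooth_mx_on D e2 -> smooth_mx_on D
   (fun x => joint_part (gdot g i x) (uprod S i x) (e1 x) (e2 x) ep (u x)).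
Proof.
move=> su s1 s2; rewrite /joint_part.
have su1 : smooth_mx_on D (fun x => u x - gdot g i x (e1 x) (u x) *: e1 x
    - gdot g i x (e2 x) (u x) *: e2 x).
  have sZ e : smooth_mx_on D e -> smooth_mx_on D (fun x => gdot g i x (e x) (u x) *: e x).
    by move=> se; apply: smooth_mxZ => //; exact: smooth_gdot.
  exact: (smooth_mxB oD (smooth_mxB oD su (sZ _ s1)) (sZ _ s2)).
have su2 : smooth_mx_on D (fun x => u x - gdot g i x (e1 x) (u x) *: e1 x
    - gdot g i x (e2 x) (u x) *: e2 x - uprod S i x (e1 x) (u x - gdot g i x (e1 x) (u x) *: e1 x
    - gdot g i x (e2 x) (u x) *: e2 x)).
  by apply: smooth_mxB => //; exact: smooth_uprod.
apply: smooth_mxD => //; apply: smooth_mxZ => //; first exact: smooth_on_cst.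
exact: smooth_uprod.
Qed.
End OnOpen.

Lemma joint_eigenZ x (e1 e2 p : 'cV[R]_5) ep k : img i x ->
  joint_eigen (gdot g i x) (uprod S i x) e1 e2 ep p ->
  joint_eigen (gdot g i x) (uprod S i x) e1 e2 ep (k *: p).
Proof.
move=> Dx [d1 d2 m1 m2]; have CA := uprod_cartan S Dx.
by split; rewrite ?(ca_dotZ CA) ?(ca_prdZ CA) ?d1 ?d2 ?m1 ?m2 ?mulr0// !scalerA mulrC.
Qed.

Section FromFrame.
Variables (x : 'rV[R]_5) (e1 e2 p q : 'cV[R]_5).
Hypothesis Dx : img i x.
Let dot := gdot g i x.
Let prd := uprod S i x.
Hypothesis flat : flat_pair dot prd e1 e2.
Hypothesis Jp : joint_eigen dot prd e1 e2 1 p.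
Hypothesis Jq : joint_eigen dot prd e1 e2 (-1) q.
Hypothesis pp : dot p p = 1.
Hypothesis qq : dot q q = 1.
Let CA : cartan_algebra dot prd := uprod_cartan S Dx.
Let fr := frame_vec prd e1 e2 p q.

Definition frame_mx : 'M[R]_5 := \matrix_(l, a) fr a l 0.
Let F := frame_mx.

Let frame_mx_col a : col a F = fr a.
Proof. by apply/matrixP => l m; rewrite !mxE ord1. Qed.

Let gram : F^T *m gmx g i x *m F = 1%:M.
Proof.
apply/matrixP => a b; transitivity (dot (fr a) (fr b)).
  rewrite -!frame_mx_col /dot /gdot !colE trmx_mul trmx_delta.
  by rewrite -!mulmxA -rowE !mulmxA -colE !mxE.
by rewrite [RHS]mxE; apply: (frame_vec_orthonormal CA flat Jp Jq pp qq).
Qed.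

Lemma frame_metric :
  (F^T *m gmx g i x)^T *m (F^T *m gmx g i x) = gmx g i x.
Proof.
by rewrite trmx_mul trmxK (gmx_sym g Dx) -mulmxA (mulmxA F) -[F *m _ *m _]mulmxA
   (mulmx1C gram) mulmx1.
Qed.

Lemma frame_ups_model v :
  trilin (tcoef Y i x) v v v = ups_model (F^T *m gmx g i x *m v).
Proof.
set t := _ *m v.
have vE : v = F *m t by rewrite /t [RHS]mulmxA (mulmx1C gram) mul1mx.
have vs : v = t (ix 1) 0 *: e1 + t (ix 2) 0 *: e2 + t (ix 3) 0 *: e3 p q
    + t (ix 4) 0 *: e4 prd p q + t (ix 5) 0 *: e5 p q.
  rewrite {1}vE; clearbody t; apply/matrixP => l m; rewrite ord1 mxE sum5.
  have FE a : F l a = fr a l 0 by rewrite mxE.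
  rewrite !FE /fr ![in frame_vec _ _ _ _ _ _]/ix !inordK// /frame_vec /=.
  move: (e3 p q) (e4 prd p q) (e5 p q) => a3 a4 a5.
  by rewrite !mxE; ring.
rewrite -(gdot_tend S Dx) {1 2 3}vs; have := frame_cubic CA flat Jp Jq pp qq.
by rewrite /dot /prd /uprod => ->.
Qed.
End FromFrame.

(** All the vectors of the frame are given by smooth formulas once a constant
    vector [v0] in general position, and constant vectors with nonzero joint parts,
    are fixed; the three conditions are open, and cut out the domain. *)
Lemma exists_adapted_coframe x0 : img i x0 ->
  exists V th, adapted_coframe S i V th /\ V x0.
Proof.
move=> Dx0; have [v0 v0gen] := exists_generic_at S Dx0.
have oI : open (img i) := @img_open _ _ M i.
pose N x := gdot g i x v0 v0; pose f x := gdot g i x v0 (uprod S i x v0 v0).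
have sv0 : smooth_mx_on (img i) (fun=> v0) by exact: smooth_mx_cst.
have sN : smooth_on (img i) N by exact: smooth_gdot.
have sf : smooth_on (img i) f by apply: smooth_gdot => //; exact: smooth_uprod.
(* where v0 is in general position: v0 and its square are independent *)
pose V0 := img i `&` [set x | N x ^+ 3 - f x ^+ 2 != 0].
have oV0 : open V0.
  by apply: open_smooth_neq0 => //; apply: smooth_onB => //; exact: smooth_onX.
have V0i : V0 `<=` img i by move=> x [].
have V0x0 : V0 x0 by split=> //=; rewrite subr_eq0 eq_sym.
have N0 x : V0 x -> N x != 0.
  move=> [Dx /=]; apply: contra => /eqP Nx; have v00 : v0 = 0 := gdot_eq0 Dx Nx.
  by rewrite /f Nx v00 /gdot trmx0 !mul0mx mxE !expr0n subrr.
pose v x := (Num.sqrt (N x))^-1 *: v0.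
have sv : smooth_mx_on V0 v.
  by apply: smooth_unit => //; apply: smooth_mx_cst.
have vv x : V0 x -> gdot g i x (v x) (v x) = 1.
  by move=> Vx; apply: unit_gdot; [exact: V0i|exact: N0].
pose c x := gdot g i x (v x) (uprod S i x (v x) (v x)).
have sc : smooth_on V0 c by apply: smooth_gdot => //; exact: smooth_uprod.
have c1 x : V0 x -> c x ^+ 2 < 1.
  move=> Vx; have Dx := V0i _ Vx; have CA := uprod_cartan S Dx.
  have := Cauchy_prd CA (v x); rewrite [gdot _ _ _ (v x) (v x)]vv// expr1n.
  rewrite le_eqVlt => /orP[/eqP c21|//]; exfalso.
  have {}c21 : c x ^+ 2 = 1 := c21.
  have Np : 0 < N x := gdot_neq0_gt0 Dx (N0 x Vx).
  have cE : c x = (Num.sqrt (N x))^-1 ^+ 3 * f x.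
    rewrite /c /v !(ca_prdZ CA) (ca_prdC CA) !(ca_prdZ CA) !(ca_dotZ CA).
    by rewrite (ca_dotC CA) !(ca_dotZ CA) (ca_dotC CA) -/(f x); ring.
  case: Vx => _ /=; rewrite subr_eq0 => /eqP; apply.
  have s0 : Num.sqrt (N x) != 0 by rewrite gt_eqF// sqrtr_gt0.
  have <- : Num.sqrt (N x) ^+ 2 = N x by rewrite sqr_sqrtr// ltW.
  have -> : f x = c x * Num.sqrt (N x) ^+ 3 by rewrite cE; field.
  by move: (c x) c21 (Num.sqrt (N x)) => C C2 r; ring: C2.
(* the angle from e1 to v; the cubic form of v is - cos (3 ph) *)
pose ph x := 3^-1 * acos (- c x); pose k x := cos (ph x); pose h x := sin (ph x).
have ph3 x : ph x + ph x + ph x = acos (- c x) by rewrite /ph; field.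
have sph : smooth_on V0 ph.
  apply: smooth_onM => //; first exact: smooth_on_cst.
  apply: smooth_on_acos => //; last exact: smooth_onN.
  by move=> x Vx; rewrite sqrrN c1.
have [sh sk] : smooth_on V0 h /\ smooth_on V0 k by exact: smooth_on_sin_cos.
have cI x : V0 x -> -1 <= - c x <= 1.
  move=> Vx; rewrite -ler_norml normrN -(@ler_pXn2r _ 2)// ?nnegrE// expr1n.
  by rewrite real_normK ?num_real// ltW// c1.
have kh x : k x * k x = 1 - h x * h x by rewrite -!expr2 /k cos2sin2.
have ck x : V0 x -> c x = 3 * k x - 4 * k x ^+ 3.
  move=> Vx; have [C3 _] := triple_angle (ph x).
  have := acosK (_ : - c x \in `[(-1), 1]); rewrite in_itv /= cI// => /(_ isT).
  by rewrite -ph3 C3 -/(k x) => E; lra.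
have dE x : V0 x -> 3 * h x - 4 * h x ^+ 3 != 0.
  move=> Vx; have [_ <-] := triple_angle (ph x); rewrite ph3 sin_acos ?cI//.
  by rewrite gt_eqF// sqrtr_gt0 sqrrN subr_gt0 c1.
pose e1 x := flat1 (uprod S i x) (k x) (h x) (v x).
pose e2 x := flat2 (uprod S i x) (k x) (h x) (v x).
have flat x : V0 x -> flat_pair (gdot g i x) (uprod S i x) (e1 x) (e2 x).
  move=> Vx; have CA := uprod_cartan S (V0i _ Vx).
  exact: (flat_frame CA (vv x Vx) (kh x) (ck x Vx) (dE x Vx)).
have sw : smooth_mx_on V0 (fun x => uprod S i x (v x) (v x)) by exact: smooth_uprod.
have sD : smooth_on V0 (fun x => (3 * h x - 4 * h x ^+ 3)^-1).
  apply: smooth_onV => //; apply: smooth_onB => //; apply: smooth_onM => //.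
  - exact: smooth_on_cst.
  - exact: smooth_on_cst.
  - exact: smooth_onX.
have se1 : smooth_mx_on V0 e1.
  apply: smooth_mxZ => //; apply: smooth_mxB => //; apply: smooth_mxZ => //.
  apply: smooth_onM => //; apply: smooth_onM => //; exact: smooth_on_cst.
have se2 : smooth_mx_on V0 e2.
  apply: smooth_mxZ => //; apply: smooth_mxD => //; apply: smooth_mxZ => //.
  apply: smooth_onB => //; last exact: smooth_on_cst.
  by apply: smooth_onM => //; [exact: smooth_on_cst|exact: smooth_onX].
have [up up0] := joint_part_neq0 Dx0 1 (flat x0 V0x0).
have [um um0] := joint_part_neq0 Dx0 (-1) (flat x0 V0x0).
pose P x := joint_part (gdot g i x) (uprod S i x) (e1 x) (e2 x) 1 up.
pose Q x := joint_part (gdot g i x) (uprod S i x) (e1 x) (e2 x) (-1) um.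
have sP : smooth_mx_on V0 P by apply: smooth_joint_part => //; exact: smooth_mx_cst.
have sQ : smooth_mx_on V0 Q by apply: smooth_joint_part => //; exact: smooth_mx_cst.
have sPQ : smooth_on V0 (fun x => gdot g i x (P x) (P x) * gdot g i x (Q x) (Q x)).
  by apply: smooth_onM => //; exact: smooth_gdot.
pose V := V0 `&` [set x | gdot g i x (P x) (P x) * gdot g i x (Q x) (Q x) != 0].
have oV : open V by exact: open_smooth_neq0.
have VV0 : V `<=` V0 by move=> x [].
have Vi : V `<=` img i by move=> x /VV0 /V0i.
have PQ0 x : V x -> gdot g i x (P x) (P x) * gdot g i x (Q x) (Q x) != 0 by case.
have factors (a b : R) : a * b != 0 -> a != 0 /\ b != 0.
  by rewrite mulf_eq0 negb_or => /andP.
have P0 x : V x -> gdot g i x (P x) (P x) != 0.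
  by move=> /PQ0 /factors[].
have Q0 x : V x -> gdot g i x (Q x) (Q x) != 0.
  by move=> /PQ0 /factors[].
pose p x := (Num.sqrt (gdot g i x (P x) (P x)))^-1 *: P x.
pose q x := (Num.sqrt (gdot g i x (Q x) (Q x)))^-1 *: Q x.
have sub (A : 'rV[R]_5 -> 'cV[R]_5) : smooth_mx_on V0 A -> smooth_mx_on V A.
  by move=> sA a b; exact: (smooth_on_sub VV0).
have sp : smooth_mx_on V p.
  by apply: smooth_unit; [exact: oV|exact: Vi|exact: P0|exact: sub].
have sq : smooth_mx_on V q.
  by apply: smooth_unit; [exact: oV|exact: Vi|exact: Q0|exact: sub].
pose F x := frame_mx x (e1 x) (e2 x) (p x) (q x).
exists V, (fun x => (F x)^T *m gmx g i x); split; last first.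
  split; first exact: V0x0.
  have P1 : 0 < gdot g i x0 (P x0) (P x0) by apply: gdot_gt0.
  have Q1 : 0 < gdot g i x0 (Q x0) (Q x0) by apply: gdot_gt0.
  by apply/lt0r_neq0/mulr_gt0.
have Jp x : V x -> joint_eigen (gdot g i x) (uprod S i x) (e1 x) (e2 x) 1 (p x).
  move=> Vx; apply: joint_eigenZ; first exact: Vi.
  by apply: (joint_partP (uprod_cartan S (Vi _ Vx)) (flat x (VV0 _ Vx))); rewrite mulr1.
have Jq x : V x -> joint_eigen (gdot g i x) (uprod S i x) (e1 x) (e2 x) (-1) (q x).
  move=> Vx; apply: joint_eigenZ; first exact: Vi.
  by apply: (joint_partP (uprod_cartan S (Vi _ Vx)) (flat x (VV0 _ Vx))); rewrite mulrNN mulr1.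
have pp x : V x -> gdot g i x (p x) (p x) = 1.
  by move=> Vx; apply: unit_gdot; [exact: Vi|exact: P0].
have qq x : V x -> gdot g i x (q x) (q x) = 1.
  by move=> Vx; apply: unit_gdot; [exact: Vi|exact: Q0].
have sfr a : smooth_mx_on V (fun x => frame_vec (uprod S i x) (e1 x) (e2 x) (p x) (q x) a).
  case: a => [|[|[|[|[|a]]]]]; rewrite /frame_vec /=.
  - exact: sub.
  - exact: sub.
  - apply: smooth_mxZ => //; first exact: smooth_on_cst.
    exact: smooth_mxD.
  - apply: smooth_mxZ => //; first exact: smooth_on_cst.
    exact: smooth_uprod.
  - apply: smooth_mxZ => //; first exact: smooth_on_cst.
    exact: smooth_mxB.
  - by rewrite nth_nil; exact: smooth_mx_cst.
split=> //.
- apply: smooth_mxM => //; last by move=> a b; apply: (smooth_on_sub Vi); exact: gmx_smooth.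
  apply: smooth_mx_tr => // l a.
  by apply: (eq_smooth_on oV _ (sfr a l 0)) => x _; rewrite mxE.
- move=> x Vx; exact: (frame_metric (Vi _ Vx) (flat x (VV0 _ Vx)) (Jp x Vx) (Jq x Vx)
    (pp x Vx) (qq x Vx)).
- move=> x Vx u; exact: (frame_ups_model (Vi _ Vx) (flat x (VV0 _ Vx)) (Jp x Vx) (Jq x Vx)
    (pp x Vx) (qq x Vx)).
Qed.
End SmoothCoframe.

(** * Change of coordinates *)

Section Transition.
Variables (R : realType) (M : manifold R 5) (S : so3_structure M).
Let g := so3_metric S.
Let Y := ups S.
Variables (i j : atlas_index M).
Let D := overlap i j.
Let t := transition i j.
Let J := transition_jac i j.

Lemma overlap_open : open D.
Proof.
rewrite openE => x [ix_ jx]; rewrite /interior; apply: filterI.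
  by apply: open_nbhs_nbhs; split => //; exact: img_open.
apply: (param_continuous ix_); apply: open_nbhs_nbhs; split => //.
exact: dom_open.
Qed.
Let oD := overlap_open.

Lemma overlap_img x : D x -> img j (t x).
Proof. by move=> [_ jx]; exact: chart_img. Qed.

Let st : smooth_mx_on D t.
Proof. exact: transition_smooth. Qed.

Lemma smooth_transition_jac : smooth_mx_on D J.
Proof.
move=> k l; apply: (eq_smooth_on oD _ (smooth_on_partial l (st 0 k))) => x _.
by rewrite mxE.
Qed.
Let sJ := smooth_transition_jac.

Section AtPoint.
Variable x : 'rV[R]_5.
Hypothesis Dx : D x.
Let ix_ : img i x. Proof. by case: Dx. Qed.
Let jx : img j (t x) := overlap_img Dx.
Let dJ l := partial_mx l J x.

(** The Jacobian consists of first derivatives, so this is Schwarz's theorem. *)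
Lemma transition_jac_sym l k m : dJ l k m = dJ m k l.
Proof.
have E a b : partial a (fun y => J y k b) x = partial a (partial b (fun y => t y 0 k)) x.
  by congr partial; apply/funext => y; rewrite [LHS]mxE.
rewrite /dJ [LHS]mxE [RHS]mxE !E.
exact: (smooth_partialC _ _ oD (st 0 k)).
Qed.

(** A degenerate Jacobian would make the pulled-back metric degenerate. *)
Lemma transition_jac_unit : J x \in unitmx.
Proof.
have := gmx_unit g ix_; rewrite (gmx_trans g Dx) !unitmx_mul -/(J x).
by case/andP.
Qed.
Let uJ := transition_jac_unit.

Lemma partial_comp_transition l (f : 'rV[R]_5 -> R) : smooth_on (img j) f ->
  differentiable (fun y => f (t y)) x /\
  partial l (fun y => f (t y)) x = \sum_q J x q l * partial q f (t x).
Proof.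
move=> sf; have df := smooth_on_differentiable sf jx.
have dt q : differentiable (fun y => t y 0 q) x := smooth_on_differentiable (st 0 q) Dx.
split; first by apply: (@differentiable_comp _ _ _ _ t f) => //; exact: differentiable_row.
by rewrite (partial_comp l dt df); apply: eq_bigr => q _; rewrite mxE.
Qed.

Let dJx : differentiable_mx J x. Proof. exact: smooth_differentiable_mx sJ Dx. Qed.

Lemma gdot_trans u v : gdot g i x u v = gdot g j (t x) (J x *m u) (J x *m v).
Proof. by rewrite /gdot (gmx_trans g Dx) trmx_mul !mulmxA. Qed.

Lemma cubic_trans y v : D y -> trilin (tcoef Y i y) v v v =
  trilin (tcoef Y j (t y)) (J y *m v) (J y *m v) (J y *m v).
Proof.
move=> Dy; rewrite trilin_mulmx; congr trilin.
by do 3!(apply/funext => ?); rewrite (tcoef_trans Y Dy).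
Qed.

Lemma polar_trans v w : polar (tcoef Y i x) v w =
  polar (tcoef Y j (t x)) (J x *m v) (J x *m w).
Proof.
apply: (@mulfI _ 2); first by rewrite pnatr_eq0.
by rewrite !polarE !(cubic_trans _ Dx) mulmxDr mulmxBr.
Qed.

(** The transformation law of Christoffel symbols solved for the symbols in the
    source chart. *)
Definition pull_back (C : 'I_5 -> 'M[R]_5) (l : 'I_5) : 'M[R]_5 :=
  invmx (J x) *m (\sum_q J x q l *: (C q *m J x) + dJ l).

Lemma pull_backE C l : J x *m pull_back C l = \sum_q J x q l *: (C q *m J x) + dJ l.
Proof. by rewrite mulKVmx. Qed.

Lemma pull_back_metric C :
  (forall q, partial_mx q (gmx g j) (t x) = (C q)^T *m gmx g j (t x) + gmx g j (t x) *m C q) ->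
  forall l, partial_mx l (gmx g i) x =
    (pull_back C l)^T *m gmx g i x + gmx g i x *m pull_back C l.
Proof.
move=> Cg l; set G := gmx g j (t x).
have dG : differentiable_mx (fun y => gmx g j (t y)) x.
  by move=> a b; case: (partial_comp_transition l (@gmx_smooth _ _ _ g j a b)).
have pG : partial_mx l (fun y => gmx g j (t y)) x = \sum_q J x q l *: (G *m C q + (C q)^T *m G).
  apply/matrixP => a b; rewrite mxE summxE.
  have [_ ->] := partial_comp_transition l (@gmx_smooth _ _ _ g j a b).
  apply: eq_bigr => q _.
  by rewrite addrC -Cg [RHS]mxE; congr (_ * _); rewrite mxE.
have dJT := differentiable_mx_tr dJx.
have [d1 p1] := partial_mxM l dJT dG; have [d2 p2] := partial_mxM l d1 dJx.
have -> : partial_mx l (gmx g i) x =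
    partial_mx l (fun y => (J y)^T *m gmx g j (t y) *m J y) x.
  by apply: near_partial_mx; apply: (near_in oD Dx) => y Dy; rewrite (gmx_trans g Dy).
rewrite p2 p1 partial_mx_tr pG -/(dJ l) -/G.
have gE : gmx g i x = (J x)^T *m G *m J x by rewrite (gmx_trans g Dx).
have -> : gmx g i x *m pull_back C l =
    \sum_q J x q l *: ((J x)^T *m (G *m C q) *m J x) + (J x)^T *m G *m dJ l.
  rewrite gE -mulmxA pull_backE mulmxDr mulmx_sumr; congr (_ + _); apply: eq_bigr => q _.
  by rewrite -scalemxAr !mulmxA.
have -> : (pull_back C l)^T *m gmx g i x =
    \sum_q J x q l *: ((J x)^T *m ((C q)^T *m G) *m J x) + (dJ l)^T *m G *m J x.
  rewrite gE !mulmxA -trmx_mul pull_backE linearD /= !mulmxDl linear_sum !mulmx_suml.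
  congr (_ + _); apply: eq_bigr => q _.
  by rewrite linearZ /= -!scalemxAl trmx_mul !mulmxA.
rewrite mulmxDl mulmx_sumr mulmx_suml [in RHS]addrACA -big_split /=.
rewrite [X in _ = X + _](_ : _ =
   \sum_q (J x)^T *m (J x q l *: (G *m C q + (C q)^T *m G)) *m J x).
  by rewrite [X in X + _]addrC -addrA.
by apply: eq_bigr => q _; rewrite -scalemxAr -scalemxAl mulmxDr mulmxDl scalerDr addrC.
Qed.

Lemma pull_back_cubic C :
  (forall q v, trilin (fun a b c => partial q (fun y => tcoef Y j y a b c) (t x)) v v v
        = polar (tcoef Y j (t x)) v (C q *m v)) ->
  forall l v, trilin (fun a b c => partial l (fun y => tcoef Y i y a b c) x) v v v
        = polar (tcoef Y i x) v (pull_back C l *m v).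
Proof.
move=> CY l v; have dv := @differentiable_mx_cst _ 5 _ _ v x.
have dY a b c : differentiable (fun y => tcoef Y i y a b c) x.
  by apply: smooth_on_differentiable ix_; exact: tcoef_smooth.
have dYt a b c : differentiable (fun y => tcoef Y j (t y) a b c) x.
  by case: (partial_comp_transition l (@tcoef_smooth _ _ _ Y j a b c)).
have [dJv pJv] := partial_mxM l dJx dv.
have := partial_cubic l dY dv; rewrite partial_mx_cst polar0 addr0 => <-.
have -> : partial l (fun y => trilin (tcoef Y i y) v v v) x = partial l (fun y =>
    trilin (tcoef Y j (t y)) (J y *m v) (J y *m v) (J y *m v)) x.
  by apply: near_partial; apply: (near_in oD Dx) => y Dy; exact: cubic_trans.
rewrite (partial_cubic l dYt dJv) pJv partial_mx_cst mulmx0 addr0 -/(dJ l).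
rewrite polar_trans [J x *m (_ *m v)]mulmxA pull_backE mulmxDl polarD; congr (_ + _).
rewrite mulmx_suml.
have -> : trilin (fun a b c => partial l (fun y => tcoef Y j (t y) a b c) x)
    (J x *m v) (J x *m v) (J x *m v) =
  \sum_q J x q l * trilin (fun a b c => partial q (fun y => tcoef Y j y a b c) (t x))
    (J x *m v) (J x *m v) (J x *m v).
  rewrite /trilin; under [RHS]eq_bigr do rewrite mulr_sumr.
  rewrite [RHS]exchange_big; apply: eq_bigr => a _ /=.
  under [RHS]eq_bigr do rewrite mulr_sumr.
  rewrite [RHS]exchange_big; apply: eq_bigr => b _ /=.
  under [RHS]eq_bigr do rewrite mulr_sumr.
  rewrite [RHS]exchange_big; apply: eq_bigr => c _ /=.
  have /= [_ ->] := partial_comp_transition l (@tcoef_smooth _ _ _ Y j a b c).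
  by rewrite !mulr_suml; apply: eq_bigr => q _; rewrite !mulrA.
elim/big_rec2 : _ => [|q y z _ ->]; first by rewrite polar0.
by rewrite polarD -scalemxAl polarZ CY mulmxA.
Qed.

(** The inhomogeneous term of the transformation law is symmetric, so the torsion
    transforms as a tensor. *)
Lemma pull_back_tors C u v :
  J x *m tors (pull_back C) u v = tors C (J x *m u) (J x *m v).
Proof.
have A a b : J x *m (along (pull_back C) a *m b) =
    along C (J x *m a) *m (J x *m b) + along dJ a *m b.
  rewrite mulmxA mulmx_alongl along_mulmx.
  rewrite (_ : (fun l => _) = (fun l => along C (col l (J x)) *m J x + dJ l)); last first.
    apply/funext => l; rewrite pull_backE /along mulmx_suml; congr (_ + _).
    by apply: eq_bigr => q _; rewrite [col _ _ _ _]mxE scalemxAl.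
  rewrite mulmxA mulmx_alongr -mulmxDl; congr (_ *m b).
  by rewrite /along -big_split; apply: eq_bigr => l _; rewrite scalerDr.
have sym : along dJ u *m v = along dJ v *m u.
  apply/matrixP => k m; rewrite ord1 !along_mulE exchange_big.
  apply: eq_bigr => m' _; apply: eq_bigr => l _.
  by rewrite mulrC [RHS]mulrC; congr (_ * _); [exact: mulrC|exact: transition_jac_sym].
by rewrite /tors mulmxBr !A sym opprD addrACA subrr addr0.
Qed.

Lemma pull_back_compatible C : compatible S j (t x) C -> compatible S i x (pull_back C).
Proof.
move=> [Cg CY Ct]; split; first exact: pull_back_metric.
- exact: pull_back_cubic.
- by move=> u v w; rewrite !gdot_trans !pull_back_tors Ct.
Qed.
End AtPoint.
End Transition.

(** * The characteristic connection *)

Section CharacteristicConnection.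
Variables (R : realType) (M : manifold R 5) (S : so3_structure M).

Lemma characteristicP (G : connection M) : characteristic S G <->
  forall i x, img i x -> compatible S i x (ccoef G i x).
Proof.
split=> [[Gso Gt] i x Dx|Gc].
  have [V [th [ad Vx]]] := exists_adapted_coframe S Dx.
  by apply/(characteristic_compatible ad Vx); split; [exact: (Gso _ _ _ ad)|exact: (Gt _ _ _ ad)].
split=> i V th ad x Vx; have Dx : img i x by case: ad => _ Vi _ _ _; exact: Vi.
  exact: ((characteristic_compatible ad Vx G).2 (Gc _ _ Dx)).1.
exact: ((characteristic_compatible ad Vx G).2 (Gc _ _ Dx)).2.
Qed.

Lemma compatible_inj i x C C' : img i x -> compatible S i x C -> compatible S i x C' ->
  C = C'.
Proof.
move=> Dx CC CC'; have [V [th [ad Vx]]] := exists_adapted_coframe S Dx.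
by apply/funext; exact: (compatible_unique ad Vx).
Qed.

Section Existence.
Hypothesis ni : nearly_integrable S.

(** The compatible symbols at a point are unique, so they can be chosen without
    reference to a coframe; smoothness is then a local matter. *)
Definition char_coef i x : 'I_5 -> 'M[R]_5 := xget (fun=> 0) (compatible S i x).

Lemma char_coef_local i x0 : img i x0 -> exists V th,
  [/\ V x0, adapted_coframe S i V th &
      forall x, V x -> char_coef i x = frame_char S i th x].
Proof.
move=> Dx0; have [V [th [ad Vx0]]] := exists_adapted_coframe S Dx0.
exists V, th; split => // x Vx; have Dx : img i x by case: ad => _ Vi _ _ _; exact: Vi.
have fc := frame_char_compatible ad Vx (ni Dx).
by apply: (compatible_inj Dx) => //; apply: (@xgetPex _ (fun=> 0)); exists (frame_char S i th x).
Qed.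

Lemma char_coef_compatible i x : img i x -> compatible S i x (char_coef i x).
Proof.
move=> Dx; have [V [th [Vx ad ->]]] := char_coef_local Dx; last by [].
exact: (frame_char_compatible ad Vx (ni Dx)).
Qed.

Lemma char_coef_smooth i l : smooth_mx_on (img i) (fun x => char_coef i x l).
Proof.
move=> a b s x Dx; have [V [th [Vx ad E]]] := char_coef_local Dx.
have oV : open V by case: ad.
apply: (eq_smooth_on oV _ (smooth_frame_char ad l a b)) => // y Vy.
by rewrite E.
Qed.

Lemma char_coef_trans i j x : overlap i j x -> forall l,
  transition_jac i j x *m char_coef i x l =
  (\sum_q transition_jac i j x q l *:
     (char_coef j (transition i j x) q *m transition_jac i j x))
  + partial_mx l (transition_jac i j) x.
Proof.
move=> Dx l; rewrite -(pull_backE S Dx); congr (_ *m _).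
have ix_ : img i x by case: Dx.
suff -> : char_coef i x = pull_back i j x (char_coef j (transition i j x)) by [].
apply: (compatible_inj ix_); first exact: char_coef_compatible.
by apply: pull_back_compatible => //; apply: char_coef_compatible; exact: overlap_img.
Qed.

Definition char_connection : connection M :=
  Connection char_coef_smooth char_coef_trans.
End Existence.
End CharacteristicConnection.

Theorem theorem5p5 (R : realType) (M : manifold R 5) (S : so3_structure M) :
  ((exists G : connection M, characteristic S G) -> nearly_integrable S)
  /\ (nearly_integrable S ->
      exists G : connection M, characteristic S G
        /\ forall G' : connection M, characteristic S G' -> eq_connection G G').
Proof.
split=> [[G /characteristicP Gc] i x Dx|ni].
  exact: (compatible_nearly_integrable Dx (Gc i x Dx)).
exists (char_connection ni); split.
  by apply/characteristicP => i x; exact: char_coef_compatible.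
move=> G' /characteristicP G'c i x Dx l.
by rewrite (compatible_inj Dx (G'c i x Dx) (char_coef_compatible ni Dx)).
Qed.
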